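(* Let $(X,A)$ and $(Y,B)$ be pairs of gathered CW complexes. (1) If $X,A,Y,B$ have dimension less than $N$, then every $N$-equivalence $\phi\colon(X,A)\to(Y,B)$ is a homotopy equivalence of pairs. (2) Every weak homotopy equivalence $\phi\colon(X,A)\to(Y,B)$ is a homotopy equivalence of pairs.
   Context: All spaces are diffeological spaces; $I=[0,1]$; $I^n$ and $\partial I^n$ carry the subspace diffeology of $\mathbf{R}^n$; products, coproducts, pushouts and colimits are in the category of diffeological spaces. Tame maps: for a cubical subcomplex $K$ of $I^n$, a smooth map $f\colon K\to X$ is $\epsilon$-tame ($0<\epsilon\le1/2$) if for every $j$, every $\alpha\in\{0,1\}$ and every $(t_1,\dots,t_n)\in K$ with $|t_j-\alpha|\le\epsilon$ one has $f(t_1,\dots,t_j,\dots,t_n)=f(t_1,\dots,\alpha,\dots,t_n)$ ($\alpha$ in the $j$-th place). ''Tame'' means $\epsilon$-tame for some $\epsilon>0$. Smooth CW complex: a diffeological space $X$ with a sequence of inclusions (skeleta) $\emptyset=X^{-1}\to X^0\to X^1\to\cdots$ with $X=\mathrm{colim}\,X^n$ such that for each $n\ge0$ the space $X^n$ is the pushout of $X^{n-1}\xleftarrow{\bigcup\phi_\lambda}\coprod_{\lambda\in\Lambda_n}\partial I^n\hookrightarrow\coprod_{\lambda\in\Lambda_n}I^n$. The maps $\phi_\lambda\colon\partial I^n\to X^{n-1}$ are the attaching maps and the induced maps $\Phi_\lambda\colon I^n\to X^n$ the characteristic maps. It is gathered if all attaching maps are tame, and has dimension $n$ if $X=X^n$.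 A subcomplex $A$ of $X$ is a smooth CW complex all of whose characteristic maps are characteristic maps of $X$. A pair of gathered CW complexes $(X,A)$ consists of a gathered CW complex $X$ and a subcomplex $A$. Homotopies are smooth maps $H\colon X\times I\to Y$; a homotopy of maps of pairs $(X,A)\to(Y,B)$ also satisfies $H(a,t)\in B$ for all $a\in A,t\in I$. A smooth map of pairs $f\colon(X,A)\to(Y,B)$ is a homotopy equivalence if there is a smooth map of pairs $g\colon(Y,B)\to(X,A)$ with $g\circ f\simeq 1_X$ and $f\circ g\simeq1_Y$ by homotopies of pairs. $\pi_n(X,x_0)=[I^n,\partial I^n;X,x_0]$ is the set of homotopy classes of smooth maps of pairs; for $n=0$ it is the set $\pi_0X$ of path components. A smooth map $\phi\colon X\to Y$ is an $N$-equivalence if for all $x\in X$ the map $\phi_*\colon\pi_n(X,x)\to\pi_n(Y,\phi(x))$ is injective for $0\le n<N$ and surjective for $0\le n\le N$ (for $n=0$ this is a condition on $\pi_0X\to\pi_0Y$). A smooth map of pairs $\phi\colon(X,A)\to(Y,B)$ is an $N$-equivalence if both $\phi\colon X\to Y$ and $\phi|_A\colon A\to B$ are $N$-equivalences, and a weak homotopy equivalence if it is an $N$-equivalence for all $N$. *)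

(* Defs.v *)
From Stdlib Require Import Relation_Operators.
From HB Require Import structures.
From mathcomp Require Import all_boot all_order all_algebra.
From mathcomp Require Import all_classical reals topology normedtype derive landau.
Set Implicit Arguments.
Unset Strict Implicit.
Unset Printing Implicit Defensive.
Import Order.TTheory GRing.Theory Num.Theory.
Import numFieldNormedType.Exports.
Local Open Scope classical_set_scope.
Local Open Scope ring_scope.

(* [Ck k U f]: f is of class C^k on the open set U. The values of f outside U
   are irrelevant (lemma [Ck_ext]). *)
Fixpoint Ck (R : realType) (V W : normedModType R) (k : nat) (U : set V)
    (f : V -> W) : Prop :=
  if k is k'.+1 then
    (forall x, U x -> differentiable f x) /\ (forall v, Ck k' U ('D_v f))
  else forall x, U x -> {for x, continuous f}.

Definition smooth_on (R : realType) (V W : normedModType R) (U : set V)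
  (f : V -> W) : Prop := forall k, Ck k U f.

Section CkTheory.
Context {R : realType}.
Implicit Types V W : normedModType R.

Lemma near_eq_differentiable V W (f g : V -> W) (x : V) :
  (\near x, f x = g x) -> differentiable f x -> differentiable g x.
Proof.
move=> fg df; have fgx : f x = g x by exact: nbhs_singleton fg.
have [cdf /eqaddoP Hf] := (diff_locallyP x f).1 df.
have Hg : g \o shift x = cst (g x) + 'd f x +o_ 0 id.
  apply/eqaddoP => e e0; move: (Hf e e0); apply: filter_app.
  have : \forall h \near 0, f (h + x) = g (h + x).
    by move: fg; rewrite (near_shift 0 x); apply: filterS => h /=; rewrite subr0.
  by apply: filterS => h E; rewrite !fctE /= -E -fgx.
by apply/diff_locallyP; rewrite (diff_unique cdf Hg); split.
Qed.

Lemma Ck_ext V W k (U : set V) (f g : V -> W) :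
  open U -> (forall x, U x -> f x = g x) -> Ck k U f -> Ck k U g.
Proof.
move=> oU; have nU x : U x -> \near x, U x by move=> Ux; exact: open_nbhs_nbhs.
elim: k f g => [|k IH] f g fg /=.
  move=> cf x Ux; have nfg : {near x, f =1 g} by exact: filterS fg (nU _ Ux).
  rewrite /prop_for /continuous_at -(fg _ Ux).
  by apply: cvg_trans (cf x Ux); apply: near_eq_cvg; exact: nfg.
move=> [df cf]; split=> [x Ux|v].
  by apply: near_eq_differentiable (df x Ux); exact: filterS fg (nU _ Ux).
apply: IH (cf v) => x Ux; apply: near_eq_derive.
by exact: filterS fg (nU _ Ux).
Qed.

Lemma Ck_sub V W k (U U' : set V) (f : V -> W) :
  U' `<=` U -> Ck k U f -> Ck k U' f.
Proof.
move=> UU; elim: k f => [|k IH] f /=; first by move=> H x /UU; exact: H.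
by move=> [df cf]; split=> [x /UU|v]; [exact: df|exact: IH].
Qed.

Lemma CkW V W k (U : set V) (f : V -> W) : Ck k.+1 U f -> Ck k U f.
Proof.
elim: k f => [|k IH] f /= [df cf].
  by move=> x Ux; apply: differentiable_continuous; exact: df.
by split=> // v; apply: IH; exact: cf.
Qed.

Lemma Ck_local V W k (U : set V) (f : V -> W) :
  (forall x, U x -> exists U', U' x /\ Ck k U' f) -> Ck k U f.
Proof.
elim: k f => [|k IH] f H /=.
  by move=> x /H [U' [U'x]]; exact.
split=> [x /H [U' [U'x [df _]]]|v]; first exact: df.
by apply: IH => x /H [U' [U'x [_ cf]]]; exists U'; split=> //; exact: cf.
Qed.

Lemma Ck_cst V W k (U : set V) (a : W) : Ck k U (cst a).
Proof.
elim: k a => [|k IH] a /=; first by move=> x _; exact: cvg_cst.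
split=> // v.
by have -> : 'D_v (cst a) = cst 0 by apply/funext => x; exact: derive_cst.
Qed.

Lemma Ck_id V k (U : set V) : Ck k U (@id V).
Proof.
case: k => [|k] /=; first by move=> x _; exact: cvg_id.
split=> // v.
have -> : 'D_v (@id V) = cst v by apply/funext => x; exact: derive_id.
exact: Ck_cst.
Qed.

Lemma CkD V W k (U : set V) (f g : V -> W) :
  open U -> Ck k U f -> Ck k U g -> Ck k U (fun x => f x + g x).
Proof.
move=> oU; elim: k f g => [|k IH] f g /=.
  by move=> cf cg x Ux; apply: continuousD; [exact: cf|exact: cg].
move=> [df cf] [dg cg]; split=> [x Ux|v].
  by apply: differentiableD; [exact: df|exact: dg].
apply: (@Ck_ext _ _ _ _ (fun x => 'D_v f x + 'D_v g x)) => //; last exact: IH.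
by move=> x Ux; rewrite deriveD //; apply: diff_derivable; [exact: df|exact: dg].
Qed.

Lemma Ck_sum V W k (U : set V) (I : Type) (r : seq I) (F : I -> V -> W) :
  open U -> (forall i, Ck k U (F i)) -> Ck k U (fun x => \sum_(i <- r) F i x).
Proof.
move=> oU CF; elim: r => [|i r IH].
  by apply: (@Ck_ext _ _ _ _ (cst 0)) (Ck_cst _ _ _) => // x _; rewrite big_nil.
apply: (@Ck_ext _ _ _ _ (fun x => F i x + \sum_(j <- r) F j x)) => //.
  by move=> x _; rewrite big_cons.
exact: CkD.
Qed.

Lemma Ck_lin V W W' k (U : set V) (L : {linear W -> W'}) (f : V -> W) :
  open U -> continuous L -> Ck k U f -> Ck k U (L \o f).
Proof.
move=> oU cL; elim: k f => [|k IH] f /=.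
  by move=> cf x Ux; apply: continuous_comp; [exact: cf|exact: cL].
move=> [df cf]; split=> [x Ux|v].
  apply: differentiable_comp; first exact: df.
  exact: linear_differentiable.
apply: (@Ck_ext _ _ _ _ (L \o 'D_v f)) => //; last exact: IH.
move=> x Ux /=; have dfx := df _ Ux.
have dLx : differentiable L (f x) by exact: linear_differentiable.
rewrite (deriveE v dfx) deriveE; last exact: differentiable_comp.
by rewrite (diff_comp dfx dLx) /= (diff_lin (f x) cL).
Qed.

Let scale_bilin (W : normedModType R) :
  bilinear_for
    (GRing.Scale.Law.clone _ _ *:%R _) (GRing.Scale.Law.clone _ _ *:%R _)
    (@GRing.scale R W).
Proof.
split=> [w|a] b x y /=; first by rewrite scalerDl scalerA.
by rewrite scalerDr !scalerA mulrC.
Qed.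

Lemma differentiable_scale V W (a : V -> R) (f : V -> W) (x : V) :
  differentiable a x -> differentiable f x ->
  differentiable (fun y => a y *: f y) x /\
  forall v, 'D_v (fun y => a y *: f y) x = a x *: 'D_v f x + 'D_v a x *: f x.
Proof.
move=> da df.
pose bM := bilinear_isBilinear.Build R R W W _ _ (@GRing.scale R W)
  (scale_bilin W).
pose B : {bilinear R -> W -> W} := HB.pack (@GRing.scale R W) bM.
have cB : continuous (fun p : R * W => B p.1 p.2).
  by move=> p; exact: scale_continuous.
have dB := differentiable_bilin (a x, f x) cB.
have E : (fun y => a y *: f y) = (fun p => B p.1 p.2) \o (fun y => (a y, f y)).
  by [].
have dp : differentiable (fun y => (a y, f y)) x by exact: differentiable_pair.
have dc : differentiable (fun y => a y *: f y) x.
  by rewrite E; exact: differentiable_comp.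
split=> // v; rewrite !deriveE // E (diff_comp dp dB) /=.
by rewrite (diff_bilin (a x, f x) cB) (diff_pair da df).
Qed.

Lemma CkZ V W k (U : set V) (a : V -> R) (f : V -> W) :
  open U -> Ck k U a -> Ck k U f -> Ck k U (fun x => a x *: f x).
Proof.
move=> oU; elim: k a f => [|k IH] a f.
  by move=> /= ca cf x Ux; apply: continuousZ; [exact: ca|exact: cf].
move=> Ca Cf; have [da ca] := Ca; have [df cf] := Cf; split=> [x Ux|v].
  by have [] := differentiable_scale (da x Ux) (df x Ux).
apply: (@Ck_ext _ _ _ _ (fun x => a x *: 'D_v f x + 'D_v a x *: f x)) => //.
  by move=> x Ux; have [_ ->] := differentiable_scale (da x Ux) (df x Ux).
by apply: CkD => //; apply: IH; [exact: CkW Ca|exact: cf|exact: ca|exact: CkW Cf].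
Qed.

Lemma Ck_comp m n W k (V : set 'rV[R]_m) (U : set 'rV[R]_n)
    (h : 'rV[R]_m -> 'rV[R]_n) (g : 'rV[R]_n -> W) :
  open V -> (forall x, V x -> U (h x)) ->
  Ck k V h -> Ck k U g -> Ck k V (g \o h).
Proof.
move=> oV hVU; elim: k g => [|k IH] g.
  move=> /= ch cg x Vx; apply: continuous_comp; first exact: ch.
  by apply: cg; exact: hVU.
move=> Ch Cg; have [dh ch] := Ch; have [dg cg] := Cg; split=> [x Vx|v].
  by apply: differentiable_comp; [exact: dh|apply: dg; exact: hVU].
pose e (j : 'I_n) : 'rV[R]_n := delta_mx 0 j.
apply: (@Ck_ext _ _ _ _
  (fun x => \sum_j ('D_v h x) 0 j *: ('D_(e j) g \o h) x)) => //.
  move=> x Vx; have dhx := dh x Vx; have dgx := dg _ (hVU x Vx).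
  rewrite [RHS]deriveE; last exact: differentiable_comp.
  rewrite (diff_comp dhx dgx) /= -(deriveE v dhx).
  rewrite [X in _ = 'd _ _ X](row_sum_delta ('D_v h x)).
  rewrite linear_sum; apply: eq_bigr => j _.
  by rewrite (deriveE (e j) dgx) [RHS]linearZ_LR.
apply: (@Ck_sum _ _ _ _ _ _ (fun j x => ('D_v h x) 0 j *: ('D_(e j) g \o h) x)) => // j.
apply: CkZ => //; last by apply: IH; [exact: CkW Ch|exact: cg].
have cj : continuous (fun M : 'rV[R]_n => M 0 j) by exact: coord_continuous.
have lj : linear (fun M : 'rV[R]_n => M 0 j : R^o).
  by move=> c A B; rewrite !mxE.
pose jM := GRing.isLinear.Build R _ _ _ _ lj.
pose L : {linear 'rV[R]_n -> R^o} := HB.pack (fun M : 'rV[R]_n => M 0 j : R^o) jM.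
exact: (@Ck_lin _ _ _ k V L ('D_v h) oV cj (ch v)).
Qed.

End CkTheory.

(* A parametrization is a map U -> X with U open in some
   R^n; it is encoded by U together with a total function, of which only the
   values on U matter ([plot_ext]). *)
Record diffSpace (R : realType) := DiffSpace {
  dcarrier :> Type;
  plot : forall n : nat, set 'rV[R]_n -> ('rV[R]_n -> dcarrier) -> Prop;
  plot_open : forall n (U : set 'rV[R]_n) p, plot U p -> open U;
  plot_ext : forall n (U : set 'rV[R]_n) p q,
    (forall u, U u -> p u = q u) -> plot U p -> plot U q;
  plot_cst : forall n (U : set 'rV[R]_n) x, open U -> plot U (fun=> x);
  plot_local : forall n (U : set 'rV[R]_n) p, open U ->
    (forall u, U u -> exists V, [/\ V u, V `<=` U & plot V p]) -> plot U p;
  plot_comp : forall m n (V : set 'rV[R]_m) (U : set 'rV[R]_n) h p,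
    plot U p -> open V -> smooth_on V h -> (forall v, V v -> U (h v)) ->
    plot V (p \o h)
}.

Definition smooth (R : realType) (X Y : diffSpace R) (f : X -> Y) : Prop :=
  forall n (U : set 'rV[R]_n) (p : 'rV[R]_n -> X), plot U p -> plot U (f \o p).

Lemma smooth_id (R : realType) (X : diffSpace R) : smooth (@id X).
Proof. by []. Qed.

Lemma smooth_comp (R : realType) (X Y Z : diffSpace R) (g : Y -> Z)
  (f : X -> Y) : smooth f -> smooth g -> smooth (g \o f).
Proof. by move=> sf sg n U p /sf /sg. Qed.

Lemma plot_restr (R : realType) (X : diffSpace R) n (U V : set 'rV[R]_n)
  (p : 'rV[R]_n -> X) : plot U p -> open V -> V `<=` U -> plot V p.
Proof.
move=> pU oV VU; have := @plot_comp _ _ _ _ V U id p pU oV; apply=> //.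
by move=> k; exact: Ck_id.
Qed.

Section Constructions.
Context {R : realType}.

Section Standard.
Variable W : normedModType R.

Let splot n (U : set 'rV[R]_n) (p : 'rV[R]_n -> W) : Prop :=
  open U /\ smooth_on U p.

Let splot_open n (U : set 'rV[R]_n) p : splot U p -> open U.
Proof. by case. Qed.

Let splot_ext n (U : set 'rV[R]_n) p q :
  (forall u, U u -> p u = q u) -> splot U p -> splot U q.
Proof. by move=> pq [oU sp]; split=> // k; apply: Ck_ext (sp k). Qed.

Let splot_cst n (U : set 'rV[R]_n) x : open U -> splot U (fun=> x).
Proof. by move=> oU; split=> // k; exact: Ck_cst. Qed.

Let splot_local n (U : set 'rV[R]_n) p : open U ->
  (forall u, U u -> exists V, [/\ V u, V `<=` U & splot V p]) -> splot U p.
Proof.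
move=> oU H; split=> // k; apply: Ck_local => u /H [V [Vu _ [_ sp]]].
by exists V.
Qed.

Let splot_comp m n (V : set 'rV[R]_m) (U : set 'rV[R]_n) h p :
  splot U p -> open V -> smooth_on V h -> (forall v, V v -> U (h v)) ->
  splot V (p \o h).
Proof. by move=> [oU sp] oV sh hVU; split=> // k; apply: Ck_comp (sp k). Qed.

Definition stdSpace : diffSpace R :=
  DiffSpace splot_open splot_ext splot_cst splot_local splot_comp.
End Standard.

Section Subspace.
Variables (X : diffSpace R) (A : set X).

Let splot n (U : set 'rV[R]_n) (p : 'rV[R]_n -> A) : Prop :=
  plot U (val \o p).

Let splot_open n (U : set 'rV[R]_n) p : splot U p -> open U.
Proof. exact: plot_open. Qed.

Let splot_ext n (U : set 'rV[R]_n) p q :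
  (forall u, U u -> p u = q u) -> splot U p -> splot U q.
Proof. by move=> pq; apply: plot_ext => u /pq /= ->. Qed.

Let splot_cst n (U : set 'rV[R]_n) x : open U -> splot U (fun=> x).
Proof. exact: plot_cst. Qed.

Let splot_local n (U : set 'rV[R]_n) p : open U ->
  (forall u, U u -> exists V, [/\ V u, V `<=` U & splot V p]) -> splot U p.
Proof. exact: plot_local. Qed.

Let splot_comp m n (V : set 'rV[R]_m) (U : set 'rV[R]_n) h p :
  splot U p -> open V -> smooth_on V h -> (forall v, V v -> U (h v)) ->
  splot V (p \o h).
Proof. by move=> sp oV sh hVU; exact: plot_comp sp oV sh hVU. Qed.

Definition subSpace : diffSpace R :=
  DiffSpace splot_open splot_ext splot_cst splot_local splot_comp.
End Subspace.

Section Product.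
Variables X Y : diffSpace R.

Let pplot n (U : set 'rV[R]_n) (p : 'rV[R]_n -> X * Y) : Prop :=
  plot U (fst \o p) /\ plot U (snd \o p).

Let pplot_open n (U : set 'rV[R]_n) p : pplot U p -> open U.
Proof. by case=> /plot_open. Qed.

Let pplot_ext n (U : set 'rV[R]_n) p q :
  (forall u, U u -> p u = q u) -> pplot U p -> pplot U q.
Proof.
by move=> pq [p1 p2]; split; [move: p1|move: p2]; apply: plot_ext => u /pq /= ->.
Qed.

Let pplot_cst n (U : set 'rV[R]_n) x : open U -> pplot U (fun=> x).
Proof. by move=> oU; split; exact: plot_cst. Qed.

Let pplot_local n (U : set 'rV[R]_n) p : open U ->
  (forall u, U u -> exists V, [/\ V u, V `<=` U & pplot V p]) -> pplot U p.
Proof.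
move=> oU H; split; apply: plot_local => // u /H [V [Vu VU [p1 p2]]];
by exists V.
Qed.

Let pplot_comp m n (V : set 'rV[R]_m) (U : set 'rV[R]_n) h p :
  pplot U p -> open V -> smooth_on V h -> (forall v, V v -> U (h v)) ->
  pplot V (p \o h).
Proof.
move=> [p1 p2] oV sh hVU.
by split; [exact: plot_comp p1 oV sh hVU|exact: plot_comp p2 oV sh hVU].
Qed.

Definition prodSpace : diffSpace R :=
  DiffSpace pplot_open pplot_ext pplot_cst pplot_local pplot_comp.
End Product.

(* A plot of the coproduct is a map that locally is a plot of one summand. *)
Section Coproduct.
Variables (I : Type) (F : I -> diffSpace R).

Let cplot n (U : set 'rV[R]_n) (p : 'rV[R]_n -> {i & F i}) : Prop :=
  open U /\ forall u, U u -> exists V i (q : 'rV[R]_n -> F i),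
    [/\ V u, plot V q & forall v, V v -> p v = existT _ i (q v)].

Let cplot_open n (U : set 'rV[R]_n) p : cplot U p -> open U.
Proof. by case. Qed.

Let cplot_ext n (U : set 'rV[R]_n) p q :
  (forall u, U u -> p u = q u) -> cplot U p -> cplot U q.
Proof.
move=> pq [oU H]; split=> // u Uu; have [V [i [r [Vu rV pr]]]] := H u Uu.
exists (U `&` V), i, r; split=> //.
  apply: (plot_restr rV); last by move=> v [].
  by apply: openI => //; exact: plot_open rV.
by move=> v [/pq <- /pr].
Qed.

Let cplot_cst n (U : set 'rV[R]_n) x : open U -> cplot U (fun=> x).
Proof.
move=> oU; split=> // u Uu; case: x => i x; exists U, i, (fun=> x); split=> //.
exact: plot_cst.
Qed.

Let cplot_local n (U : set 'rV[R]_n) p : open U ->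
  (forall u, U u -> exists V, [/\ V u, V `<=` U & cplot V p]) -> cplot U p.
Proof. by move=> oU H; split=> // u /H [V [Vu _ [_]]]; exact. Qed.

Let cplot_comp m n (V : set 'rV[R]_m) (U : set 'rV[R]_n) h p :
  cplot U p -> open V -> smooth_on V h -> (forall v, V v -> U (h v)) ->
  cplot V (p \o h).
Proof.
move=> [oU H] oV sh hVU; split=> // v Vv.
have [U' [i [q [U'hv qU' pq]]]] := H _ (hVU v Vv).
have oU' := plot_open qU'.
have oV' : open (V `&` h @^-1` U').
  rewrite openE => w [Vw U'hw]; apply: filterI; first exact: open_nbhs_nbhs.
  by apply: (sh 0%N w Vw); exact: open_nbhs_nbhs.
exists (V `&` h @^-1` U'), i, (q \o h); split=> //; last first.
  by move=> w [_ /pq].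
apply: (plot_comp qU' oV'); last by move=> w [].
by move=> k; apply: Ck_sub (sh k) => w [].
Qed.

Definition coprodSpace : diffSpace R :=
  DiffSpace cplot_open cplot_ext cplot_cst cplot_local cplot_comp.
End Coproduct.

Definition is_pushout (A B C P : diffSpace R) (f : A -> B) (g : A -> C)
    (i : B -> P) (j : C -> P) : Prop :=
  [/\ smooth f /\ smooth g, smooth i /\ smooth j,
      (forall a, i (f a) = j (g a)) &
      forall (Z : diffSpace R) (u : B -> Z) (v : C -> Z),
        smooth u -> smooth v -> (forall a, u (f a) = v (g a)) ->
        exists! h : P -> Z, [/\ smooth h, (forall b, h (i b) = u b) &
                                (forall c, h (j c) = v c)]].

Definition is_seq_colimit (X_ : nat -> diffSpace R)
    (inc : forall k, X_ k -> X_ k.+1) (X : diffSpace R)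
    (into : forall k, X_ k -> X) : Prop :=
  [/\ (forall k, smooth (@inc k)), (forall k, smooth (@into k)),
      (forall k x, into k.+1 (inc k x) = into k x) &
      forall (Z : diffSpace R) (g : forall k, X_ k -> Z),
        (forall k, smooth (@g k)) -> (forall k x, g k.+1 (inc k x) = g k x) ->
        exists! h : X -> Z, smooth h /\ (forall k x, h (into k x) = g k x)].

Definition diffeomorphism (X Y : diffSpace R) (f : X -> Y) : Prop :=
  smooth f /\ exists g : Y -> X, [/\ smooth g, cancel f g & cancel g f].

End Constructions.

Section CW.
Variable R : realType.

Definition unit_itv : set (stdSpace R) := [set t : R | 0 <= t <= 1].
Definition I01 : diffSpace R := subSpace unit_itv.

Let unit_itv0 : unit_itv (0 : R).
Proof. by rewrite /unit_itv /= lexx ler01. Qed.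
Let unit_itv1 : unit_itv (1 : R).
Proof. by rewrite /unit_itv /= lexx ler01. Qed.
Definition I0 : I01 := exist _ (0 : R) (mem_set unit_itv0).
Definition I1 : I01 := exist _ (1 : R) (mem_set unit_itv1).

Definition cube_set (n : nat) : set (stdSpace 'rV[R]_n) :=
  [set t : 'rV[R]_n | forall j, 0 <= t ord0 j <= 1].
Arguments cube_set n : clear implicits.
Definition cube (n : nat) : diffSpace R := subSpace (cube_set n).
Definition coord n (t : cube n) : 'rV[R]_n := val t.

Definition boundary (n : nat) : set (cube n) :=
  [set t | exists j, coord t ord0 j = 0 \/ coord t ord0 j = 1].
Arguments boundary n : clear implicits.
Definition bdcube (n : nat) : diffSpace R := subSpace (boundary n).

Definition set_coord n (t : 'rV[R]_n) (j : 'I_n) (a : R) : 'rV[R]_n :=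
  \row_k (if k == j then a else t ord0 k).

(* Meant for cubical subcomplexes K of I^n and eps <= 1/2: the point s below
   then always exists. *)
Definition eps_tame n (K : set (cube n)) (X : diffSpace R)
    (f : subSpace K -> X) (eps : R) : Prop :=
  smooth f /\ forall (j : 'I_n) (a : bool) (t s : subSpace K),
    `|coord (val t) ord0 j - a%:R| <= eps ->
    coord (val s) = set_coord (coord (val t)) j a%:R -> f t = f s.

Definition tame n (K : set (cube n)) (X : diffSpace R)
    (f : subSpace K -> X) : Prop :=
  exists eps : R, 0 < eps <= 2^-1 /\ eps_tame f eps.

(* [cw_skel k] is the skeleton of dimension k - 1. *)
Record cwStructure (X : diffSpace R) := CWStructure {
  cw_skel : nat -> diffSpace R;
  cw_inc : forall k, cw_skel k -> cw_skel k.+1;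
  cw_into : forall k, cw_skel k -> X;
  cw_cell : nat -> Type;
  cw_attach : forall n, cw_cell n -> bdcube n -> cw_skel n;
  cw_char : forall n, cw_cell n -> cube n -> cw_skel n.+1;
  cw_skel0 : cw_skel 0 -> False;
  cw_inc_inj : forall k, injective (@cw_inc k);
  cw_colimit : is_seq_colimit cw_inc cw_into;
  cw_pushout : forall n, @is_pushout R
    (coprodSpace (fun _ : cw_cell n => bdcube n)) (cw_skel n)
    (coprodSpace (fun _ : cw_cell n => cube n)) (cw_skel n.+1)
    (fun s => cw_attach (projT1 s) (projT2 s))
    (fun s => existT _ (projT1 s) (val (projT2 s)))
    (@cw_inc n)
    (fun s => cw_char (projT1 s) (projT2 s))
}.

Definition gathered (X : diffSpace R) (C : cwStructure X) : Prop :=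
  forall n (l : cw_cell C n), tame (@cw_attach _ C n l).

(* X = X^(k-1) for some k <= N; in particular the empty complex has dimension
   -1, hence less than every N. *)
Definition cw_dim_lt (X : diffSpace R) (C : cwStructure X) (N : nat) : Prop :=
  exists2 k, (k <= N)%N & diffeomorphism (@cw_into _ C k).

Definition is_subcomplex (X : diffSpace R) (C : cwStructure X) (A : set X)
    (D : cwStructure (subSpace A)) : Prop :=
  forall n (l : cw_cell D n), exists m : cw_cell C n,
    forall t : cube n, val (cw_into (cw_char l t)) = cw_into (cw_char m t).

End CW.

Arguments cube_set R n : clear implicits.
Arguments boundary R n : clear implicits.

Section Homotopy.
Variable R : realType.

Record pairMap (X : diffSpace R) (A : set X) (Y : diffSpace R) (B : set Y) :=
  PairMap {
    pair_fun :> X -> Y;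
    pair_smooth : smooth pair_fun;
    pair_sub : forall a, A a -> B (pair_fun a)
  }.

Lemma comp_sub (X Y Z : Type) (A : set X) (B : set Y) (C : set Z) (g : Y -> Z)
  (f : X -> Y) : (forall a, A a -> B (f a)) -> (forall b, B b -> C (g b)) ->
  forall a, A a -> C ((g \o f) a).
Proof. by move=> fAB gBC a /fAB /gBC. Qed.

Definition pair_id (X : diffSpace R) (A : set X) : pairMap A A :=
  PairMap (@smooth_id R X) (fun a (Aa : A a) => Aa).

Definition pair_comp (X Y Z : diffSpace R) (A : set X) (B : set Y) (C : set Z)
    (g : pairMap B C) (f : pairMap A B) : pairMap A C :=
  PairMap (smooth_comp (pair_smooth f) (pair_smooth g))
    (comp_sub (pair_sub f) (pair_sub g)).

Definition pair_homotopic (X Y : diffSpace R) (A : set X) (B : set Y)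
    (f g : pairMap A B) : Prop :=
  exists H : prodSpace X (I01 R) -> Y,
    [/\ smooth H, (forall x, H (x, I0 R) = f x), (forall x, H (x, I1 R) = g x) &
        forall a t, A a -> B (H (a, t))].

Definition pair_homotopy_equivalence (X Y : diffSpace R) (A : set X)
    (B : set Y) (f : pairMap A B) : Prop :=
  exists g : pairMap B A,
    pair_homotopic (pair_comp g f) (pair_id A) /\
    pair_homotopic (pair_comp f g) (pair_id B).

(* The quotient of T by the equivalence relation generated by r, as a set of
   equivalence classes. The relations r it is applied to (smooth homotopy,
   being joined by a smooth path) are already equivalence relations. *)
Section Quotient.
Variables (T : Type) (r : T -> T -> Prop).

Definition eqv_class (x : T) : set T := [set y | clos_refl_sym_trans T r x y].
Definition quot : Type := set_type (range eqv_class).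
Definition to_quot (x : T) : quot :=
  exist _ (eqv_class x) (mem_set (imageT eqv_class x)).

Lemma quot_ex (c : quot) : exists x, to_quot x = c.
Proof.
case: (set_valP c) => x _ E; exists x; exact: val_inj.
Qed.
Definition quot_repr (c : quot) : T := projT1 (cid (quot_ex c)).

Lemma to_quot_repr (c : quot) : to_quot (quot_repr c) = c.
Proof. by rewrite /quot_repr; case: cid. Qed.

Lemma to_quotE (x y : T) : to_quot x = to_quot y <-> clos_refl_sym_trans T r x y.
Proof.
split=> [/(congr1 val) /= E|rxy].
  have : eqv_class y y by exact: rst_refl.
  by rewrite -E.
apply: val_inj; apply/seteqP; split=> z /=.
  by apply: rst_trans; exact: rst_sym.
exact: rst_trans.
Qed.
End Quotient.

Definition quot_map (T T' : Type) (r : T -> T -> Prop) (r' : T' -> T' -> Prop)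
  (f : T -> T') (c : quot r) : quot r' := to_quot r' (f (quot_repr c)).

Lemma quot_mapE (T T' : Type) (r : T -> T -> Prop) (r' : T' -> T' -> Prop)
    (f : T -> T') : (forall x y, r x y -> r' (f x) (f y)) ->
  forall x, quot_map r' f (to_quot r x) = to_quot r' (f x).
Proof.
move=> fr x; apply/to_quotE.
have /to_quotE : to_quot r (quot_repr (to_quot r x)) = to_quot r x.
  exact: to_quot_repr.
move: (quot_repr _) => y; elim=> [a b /fr|a|a b _|a b c _ ? _]; first exact: rst_step.
- exact: rst_refl.
- exact: rst_sym.
- exact: rst_trans.
Qed.

Definition path_joined (X : diffSpace R) (x y : X) : Prop :=
  exists g : I01 R -> X, [/\ smooth g, g (I0 R) = x & g (I1 R) = y].

Definition pi0 (X : diffSpace R) : Type := quot (@path_joined X).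

Definition pi0_map (X Y : diffSpace R) (f : X -> Y) : pi0 X -> pi0 Y :=
  quot_map (@path_joined Y) f.

Definition htpy_classes (X Y : diffSpace R) (A : set X) (B : set Y) : Type :=
  quot (@pair_homotopic X Y A B).

Definition homotopy_group (n : nat) (X : diffSpace R) (x : X) : Type :=
  htpy_classes (boundary R n) [set x].

Lemma pointed_sub (X Y : Type) (f : X -> Y) (x : X) :
  forall a, [set x] a -> [set f x] (f a).
Proof. by move=> a /= ->. Qed.

Definition pointed_map (X Y : diffSpace R) (f : X -> Y) (sf : smooth f)
  (x : X) : pairMap [set x] [set f x] := PairMap sf (@pointed_sub X Y f x).

Definition homotopy_group_map (n : nat) (X Y : diffSpace R) (f : X -> Y) (sf : smooth f)
    (x : X) : homotopy_group n x -> homotopy_group n (f x) :=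
  quot_map (@pair_homotopic _ _ _ _) (pair_comp (pointed_map sf x)).

Lemma pi0_mapE (X Y : diffSpace R) (f : X -> Y) (x : X) : smooth f ->
  pi0_map f (to_quot (@path_joined X) x) = to_quot (@path_joined Y) (f x).
Proof.
move=> sf; apply: quot_mapE => a b [g [sg <- <-]].
by exists (f \o g); split=> //; exact: smooth_comp.
Qed.

Lemma homotopy_group_mapE n (X Y : diffSpace R) (f : X -> Y) (sf : smooth f) (x : X)
    (c : pairMap (boundary R n) [set x]) :
  homotopy_group_map sf (to_quot (@pair_homotopic _ _ _ _) c) =
  to_quot (@pair_homotopic _ _ _ _) (pair_comp (pointed_map sf x) c).
Proof.
apply: quot_mapE => a b [H [sH H0 H1 Hb]]; exists (f \o H); split=> /=.
- exact: smooth_comp.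
- by move=> t; rewrite H0.
- by move=> t; rewrite H1.
- by move=> t s /(Hb _ s) ->.
Qed.

Definition surjective (T T' : Type) (f : T -> T') : Prop :=
  forall y, exists x, f x = y.

(* The condition on pi_0 does not involve a base point: it is required also
   when X is empty. *)
Definition N_equivalence (N : nat) (X Y : diffSpace R) (f : X -> Y)
    (sf : smooth f) : Prop :=
  [/\ (0 < N)%N -> injective (pi0_map f),
      surjective (pi0_map f),
      forall (x : X) n, (0 < n < N)%N -> injective (@homotopy_group_map n X Y f sf x) &
      forall (x : X) n, (0 < n <= N)%N -> surjective (@homotopy_group_map n X Y f sf x)].

Section Restriction.
Variables (X Y : diffSpace R) (A : set X) (B : set Y) (f : pairMap A B).

Definition pair_restr (a : subSpace A) : subSpace B :=
  exist _ (f (val a)) (mem_set (pair_sub f (set_valP a))).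

Lemma pair_restr_smooth : smooth pair_restr.
Proof. by move=> n U p /(pair_smooth f). Qed.
End Restriction.

Definition pair_N_equivalence (N : nat) (X Y : diffSpace R) (A : set X)
    (B : set Y) (f : pairMap A B) : Prop :=
  N_equivalence N (pair_smooth f) /\ N_equivalence N (pair_restr_smooth f).

Definition pair_weak_equivalence (X Y : diffSpace R) (A : set X) (B : set Y)
    (f : pairMap A B) : Prop := forall N, pair_N_equivalence N f.

End Homotopy.

(* Main.v *)
From Stdlib Require Import Relation_Operators.
From HB Require Import structures.
From mathcomp Require Import all_boot all_order all_algebra ring lra.
From mathcomp Require Import all_classical reals topology normedtype derive landau.
From mathcomp Require Import sequences realfun exp.
Require Import Defs.

(** A map [e : Z -> W] is compressible in dimension [n] if every map of the
    [n]-cube to [W], lifted to [Z] near the boundary, deforms into [Z] rel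
    boundary. An [N]-equivalence is compressible in dimensions [n <= N]: the lift
    is first made constant near the boundary, using injectivity on [pi_(n-1)],
    and then surjectivity on [pi_n] applies. Compressibility yields lifts over
    each cell of a relative gathered complex against the mapping path space of
    [e], that is, against pairs of a point [z] of [Z] and a path in [W] ending at
    [e z]. Lifting the identity of [B], and then that of [Y] rel [B], gives a right
    homotopy inverse [g] of [phi] as a map of pairs. Since [phi] has
    compressibility to spare by one dimension, [g] is compressible as well and has
    a right homotopy inverse, so [g] is a two-sided homotopy inverse of [phi]. *)

Set Implicit Arguments.
Unset Strict Implicit.
Unset Printing Implicit Defensive.
Import Order.TTheory GRing.Theory Num.Theory.
Import numFieldNormedType.Exports.
Local Open Scope classical_set_scope.
Local Open Scope ring_scope.

(** * A smooth step function *)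

(** Smooth maps that agree on a closed set need not glue to a smooth map; gluing is available only
    along open overlaps. This is why boundary conditions are imposed on a neighbourhood of the
    boundary, why homotopies stand still outside [0, 1], and why concatenations leave an open
    interval of time on which both pieces are constant. On the boundary of a cell, where no outer
    neighbourhood is given, tameness of the attaching map supplies the missing room. A lift together
    with its homotopy is carried as one map into a product with a path space. A map out of a pushout
    or of a colimit then comes from the universal property alone, and nothing has to be known about
    the product of these spaces with the line. *)

Section FlatFunction.
Variable R : realType.
Implicit Types (P : {poly R}) (x y h : R).

(** The polynomial makes the family closed under differentiation: each derivative of exp(-1/x) is a
    polynomial in 1/x times exp(-1/x), so a single induction gives smoothness. *)
Definition flat P x : R :=
  if 0 < x then P.[x^-1] * expR (- x^-1) else 0.

(** With y = 1/x, raise exp(y/(k+1)) >= y/(k+1) to the power k+1; the one spare factor y becomes the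
    x on the right. *)
Lemma expR_pow_bound (k : nat) x : 0 < x ->
  x^-1 ^+ k * expR (- x^-1) <= (k.+1%:R ^+ k.+1) * x.
Proof.
move=> x0; have y0 : 0 < x^-1 by rewrite invr_gt0.
rewrite expRN ler_pdivrMr ?expR_gt0//.
have k0 : 0 < k.+1%:R :> R by rewrite ltr0n.
have H : (x^-1 / k.+1%:R) ^+ k.+1 <= expR x^-1.
  have -> : expR x^-1 = expR (x^-1 / k.+1%:R) ^+ k.+1.
    by rewrite -expRM_natr divfK// gt_eqF.
  have y'0 : 0 <= x^-1 / k.+1%:R by rewrite ltW// divr_gt0.
  apply: lerXn2r; rewrite ?nnegrE ?expR_ge0//.
  by apply: le_trans _ (expR_ge1Dx _); rewrite lerDr.
have -> : x^-1 ^+ k = (k.+1%:R ^+ k.+1) * x * (x^-1 / k.+1%:R) ^+ k.+1.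
  rewrite expr_div_n [x^-1 ^+ k.+1]exprS.
  have xn0 : x != 0 by rewrite gt_eqF.
  have kn0 : k.+1%:R ^+ k.+1 != 0 :> R by rewrite gt_eqF// exprn_gt0.
  move: (x^-1 ^+ k) (k.+1%:R ^+ k.+1) kn0 => u v vn0.
  by field; rewrite vn0 xn0.
by rewrite ler_pM2l// mulr_gt0// exprn_gt0.
Qed.

(** Used at the origin: applied to ['X * P], the linear bound makes the difference quotient of
    [flat P] tend to 0. *)
Lemma flat_bound P : exists2 C, 0 <= C & forall x, `|flat P x| <= C * `|x|.
Proof.
pose C := \sum_(i < size P) `|P`_i| * (i.+1%:R ^+ i.+1).
have C0 : 0 <= C by apply: sumr_ge0 => i _; rewrite mulr_ge0// exprn_ge0.
exists C => // x.
rewrite /flat; case: ifPn => x0; last by rewrite normr0 mulr_ge0.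
rewrite normrM (ger0_norm (expR_ge0 _)) (gtr0_norm x0) horner_coef.
apply: (@le_trans _ _ ((\sum_(i < size P) `|P`_i * x^-1 ^+ i|) * expR (- x^-1))).
  by rewrite ler_wpM2r ?expR_ge0// ler_norm_sum.
rewrite /C !mulr_suml; apply: ler_sum => i _.
rewrite normrM (ger0_norm (exprn_ge0 _ _)) ?invr_ge0 ?(ltW x0)//.
by rewrite -!mulrA ler_wpM2l// expR_pow_bound.
Qed.

(** With y = 1/x and dy/dx = - y^2, the derivative of P(y) exp(-y) is y^2 (P(y) - P'(y)) exp(-y). *)
Definition flat_next P : {poly R} := 'X^2 * (P - P^`()).

Lemma flat_derive P x : is_derive x 1 (flat P) (flat (flat_next P) x).
Proof.
case: (ltgtP x 0) => x0.
- have nx : \near x, (cst 0 : R -> R) x = flat P x.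
    near=> z; rewrite /flat ifF//; apply/negbTE; rewrite -leNgt; apply/ltW.
    by near: z; exact: lt_nbhsl.
  have -> : flat (flat_next P) x = 0 by rewrite /flat ifF// ltNge ltW.
  apply: (near_eq_is_derive nx); exact: is_derive_cst.
- have nx : \near x, ((horner P \o (@GRing.inv R)) * (expR \o (- (@GRing.inv R)))) x = flat P x.
    near=> z; rewrite /flat ifT//=.
    by near: z; exact: lt_nbhsr.
  apply: (near_eq_is_derive nx).
  have xn0 : x != 0 by rewrite gt_eqF.
  have dV : is_derive x 1 (@GRing.inv R) (- x ^- 2).
    have := @is_deriveV R id x 1 1 xn0 _.
    by rewrite /GRing.scale /= mulr1; apply.
  have dP : is_derive x 1 (horner P \o (@GRing.inv R)) (P^`().[x^-1] * (- x^-2)).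
    by apply: is_derive1_comp.
  have dE : is_derive x 1 (expR \o (- (@GRing.inv R))) (expR (- x^-1) * (- - x^-2)).
    by apply: is_derive1_comp.
  apply: is_derive_eq.
  rewrite /flat x0 /flat_next !hornerE /= /GRing.scale /= !(fctE, opprK) exprVn.
  set a := P.[_]; set b := P^`().[_].
  ring.
- rewrite x0; have -> : flat (flat_next P) 0 = 0 by rewrite /flat ltxx.
  (* The difference quotient of [flat P] at 0 is [flat ('X * P)], since dividing by h multiplies the
     polynomial by its variable. *)
  have [C' C'0 HC'] := flat_bound ('X * P).
  have E h : flat P h = h * flat ('X * P) h.
    rewrite /flat; case: ifPn => h0; last by rewrite mulr0.
    by rewrite hornerM hornerX !mulrA mulfV ?gt_eqF// mul1r.
  have fp0 : flat P 0 = 0 by rewrite /flat ltxx.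
  have L : (fun h => h^-1 *: ((flat P \o shift 0) (h *: 1) - flat P 0)) @ 0^' --> (0:R).
    apply/cvgrPdist_le => e e0.
    near=> h.
    have hn0 : h != 0 by near: h; exact: nbhs_dnbhs_neq.
    rewrite fp0 sub0r subr0 normrN /= addr0 /GRing.scale /= mulr1 E mulrA mulVf// mul1r.
    apply: le_trans (HC' h) _.
    have /ltW h1 : `|h| < e / (C' + 1).
      near: h. apply: dnbhs0_lt. by rewrite divr_gt0// ltr_wpDl.
    apply: (@le_trans _ _ ((C' + 1) * (e / (C' + 1)))).
      by apply: ler_pM => //; rewrite lerDl.
    by rewrite mulrC divfK// gt_eqF// ltr_wpDl.
  apply: DeriveDef; first by apply/cvg_ex; exists 0.
  by apply: cvg_lim.
Unshelve. all: by end_near. Qed.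
End FlatFunction.

Section Step.
Variable R : realType.
Implicit Types (V W : normedModType R).

Lemma Ck_flat k (P : {poly R}) : Ck k setT (flat P).
Proof.
elim: k P => [|k IH] P /=.
  move=> x _; apply: differentiable_continuous; apply/derivable1_diffP.
  by have [] := flat_derive P x.
split=> [x _|v].
  by apply/derivable1_diffP; have [] := flat_derive P x.
have -> : 'D_v (flat P) = flat (v *: flat_next P).
  apply/funext => x; have [dx Dx] := flat_derive P x.
  have dfx : differentiable (flat P) x by exact/derivable1_diffP.
  rewrite deriveE// diff1E// derive1E Dx /flat /=.
  by case: ifP => _; rewrite ?scaler0// hornerZ /GRing.scale /= mulrA.
exact: IH.
Qed.

(** [Ck_comp] composes through row vectors; here the middle space is the line itself and the chain
    rule has a single term. *)
Lemma Ck_comp_real V k (U : set V) (g : R -> R) (h : V -> R) :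
  open U -> smooth_on setT g -> Ck k U h -> Ck k U (g \o h).
Proof.
move=> oU; elim: k g => [|k IH] g sg.
  move=> /= ch x Ux; apply: continuous_comp; first exact: ch.
  exact: (sg 0%N).
move=> Ch; have [dh ch] := Ch.
have dg x : differentiable g x by have [dg _] := sg 1%N; exact: dg.
split=> [x Ux|v].
  by apply: differentiable_comp; [exact: dh|exact: dg].
apply: (@Ck_ext _ _ _ _ _ (fun x => 'D_v h x *: ('D_1 g \o h) x)) => //.
  move=> x Ux; have dhx := dh x Ux; have dgx := dg (h x).
  rewrite [RHS]deriveE; last exact: differentiable_comp.
  by rewrite (diff_comp dhx dgx) /= -(deriveE v dhx) (diff1E dgx) derive1E.
apply: (@CkZ _ V R k U ('D_v h) ('D_1 g \o h)) => //.
  exact: ch.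
apply: IH; last exact: CkW Ch.
by move=> j; have [_] := sg j.+1; exact.
Qed.

Definition flat_exp : R -> R := flat 1.

Lemma flat_exp_le0 x : x <= 0 -> flat_exp x = 0.
Proof. by rewrite /flat_exp /flat ltNge => ->. Qed.

Lemma flat_exp_gt0 x : 0 < x -> 0 < flat_exp x.
Proof. by move=> x0; rewrite /flat_exp /flat x0 hornerC mul1r expR_gt0. Qed.

Lemma flat_exp_ge0 x : 0 <= flat_exp x.
Proof. by have [/flat_exp_gt0/ltW|/flat_exp_le0->] := ltP 0 x. Qed.

Lemma le_flat_exp x y : x <= y -> flat_exp x <= flat_exp y.
Proof.
move=> xy; have [x0|x0] := ltP 0 x; last by rewrite (flat_exp_le0 x0) flat_exp_ge0.
have y0 := lt_le_trans x0 xy.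
by rewrite /flat_exp /flat x0 y0 !hornerC !mul1r ler_expR lerN2 lef_pV2.
Qed.

(* The inner [flat_exp (1 - x)] vanishes for [x >= 1] and is at least
   [flat_exp 1] for [x <= 0], so no quotient of functions is needed. *)
Definition smoothstep (x : R) : R := (flat_exp (flat_exp 1))^-1 * flat_exp (flat_exp 1 - flat_exp (1 - x)).

Let flat_exp1 : 0 < flat_exp 1. Proof. exact: flat_exp_gt0. Qed.
Let flat_exp11 : 0 < flat_exp (flat_exp 1). Proof. exact: flat_exp_gt0. Qed.

Lemma smoothstep_le0 x : x <= 0 -> smoothstep x = 0.
Proof.
move=> x0; rewrite /smoothstep [flat_exp (_ - _)]flat_exp_le0 ?mulr0// subr_le0.
by apply: le_flat_exp; rewrite lerBrDr gerDl.
Qed.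

Lemma smoothstep_ge1 x : 1 <= x -> smoothstep x = 1.
Proof.
move=> x1; rewrite /smoothstep [flat_exp (1 - x)]flat_exp_le0 ?subr_le0// subr0.
by rewrite mulVf// gt_eqF.
Qed.

Lemma smoothstep_ge0 x : 0 <= smoothstep x.
Proof. by rewrite /smoothstep mulr_ge0 ?flat_exp_ge0// invr_ge0 flat_exp_ge0. Qed.

Lemma smoothstep_le1 x : smoothstep x <= 1.
Proof.
rewrite /smoothstep mulrC ler_pdivrMr// mul1r le_flat_exp// gerBl flat_exp_ge0//.
Qed.

Lemma smooth_smoothstep : smooth_on setT smoothstep.
Proof.
move=> k; have sp : smooth_on setT flat_exp by move=> j; exact: Ck_flat.
have oT : open [set: R] by exact: openT.
apply: (@CkZ _ _ _ k setT (cst (flat_exp (flat_exp 1))^-1)) => //; first exact: Ck_cst.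
apply: (@Ck_comp_real R k setT flat_exp (fun x => flat_exp 1 - flat_exp (1 - x))) => //.
have H (f : R -> R) : Ck k setT f -> Ck k setT (fun x => flat_exp 1 - flat_exp (1 - f x)).
  move=> Cf; apply: CkD => //; first exact: Ck_cst.
  apply: (@Ck_ext _ _ _ _ _ (fun x => (-1) *: flat_exp (1 - f x))) => //.
    by move=> x _; rewrite scaleN1r.
  apply: (@CkZ _ _ _ k setT (cst (-1))) => //; first exact: Ck_cst.
  apply: (@Ck_comp_real R k setT flat_exp (fun x => 1 - f x)) => //.
  apply: CkD => //; first exact: Ck_cst.
  apply: (@Ck_ext _ _ _ _ _ (fun x => (-1) *: f x)) => //.
    by move=> x _; rewrite scaleN1r.
  by apply: (@CkZ _ _ _ k setT (cst (-1))) => //; first exact: Ck_cst.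
apply: H; exact: Ck_id.
Qed.

Lemma Ck_row V n k (U : set V) (f : V -> 'rV[R]_n) : open U ->
  (forall j, Ck k U (fun x => f x ord0 j)) -> Ck k U f.
Proof.
move=> oU H.
apply: (@Ck_ext _ _ _ _ _ (fun x => \sum_j f x ord0 j *: (delta_mx 0 j : 'rV[R]_n))) => //.
  by move=> x _; rewrite [RHS]row_sum_delta.
apply: (@Ck_sum _ _ _ _ _ _ _ (fun j x => f x ord0 j *: (delta_mx 0 j : 'rV[R]_n))) => // j.
by apply: CkZ => //; exact: Ck_cst.
Qed.

Lemma Ck_coord V n k (U : set V) (f : V -> 'rV[R]_n) (j : 'I_n) : open U ->
  Ck k U f -> Ck k U (fun x => f x ord0 j).
Proof.
move=> oU Cf.
have cj : continuous (fun M : 'rV[R]_n => M 0 j) by exact: coord_continuous.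
have lj : linear (fun M : 'rV[R]_n => M 0 j : R^o).
  by move=> c A B; rewrite !mxE.
pose jM := GRing.isLinear.Build R _ _ _ _ lj.
pose L : {linear 'rV[R]_n -> R^o} := HB.pack (fun M : 'rV[R]_n => M 0 j : R^o) jM.
exact: (@Ck_lin _ _ _ _ k U L f oU cj Cf).
Qed.

End Step.

(** * Smooth maps on subsets and homotopies *)

(* Smoothness of a total function on a subset [O]; meant for D-open [O], where
   it does not depend on the values outside [O]. *)
Definition smooth_in (R : realType) (E Z : diffSpace R) (O : set E) (f : E -> Z) :=
  forall n (U : set 'rV[R]_n) (p : 'rV[R]_n -> E),
    plot U p -> (forall u, U u -> O (p u)) -> plot U (f \o p).

(** Openness in the D-topology; smoothness is local for such sets. *)
Definition dopen (R : realType) (E : diffSpace R) (O : set E) :=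
  forall n (U : set 'rV[R]_n) (p : 'rV[R]_n -> E), plot U p -> open (U `&` p @^-1` O).

Arguments smooth_in : simpl never.

Section Local.
Variable R : realType.
Implicit Types E F Z W : diffSpace R.
Local Notation line := (stdSpace R).

Lemma smooth_smooth_in E Z (O : set E) (f : E -> Z) : smooth f -> smooth_in O f.
Proof. by move=> sf n U p pU _; exact: sf. Qed.

Lemma smooth_inT E Z (f : E -> Z) : smooth_in setT f -> smooth f.
Proof. by move=> sf n U p pU; exact: sf. Qed.

Lemma smooth_in_sub E Z (O O' : set E) (f : E -> Z) :
  O' `<=` O -> smooth_in O f -> smooth_in O' f.
Proof. by move=> OO sf n U p pU pO; apply: sf => // u /pO /OO. Qed.

Lemma smooth_in_ext E Z (O : set E) (f g : E -> Z) :
  (forall x, O x -> f x = g x) -> smooth_in O f -> smooth_in O g.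
Proof.
by move=> fg sf n U p pU pO; apply: plot_ext (sf _ _ _ pU pO) => u /pO /fg.
Qed.

Lemma smooth_in_comp E F Z (O' : set E) (O : set F) (h : E -> F) (f : F -> Z) :
  smooth_in O f -> smooth_in O' h -> (forall x, O' x -> O (h x)) ->
  smooth_in O' (fun x => f (h x)).
Proof.
move=> sf sh hO n U p pU pO; apply: (sf n U (h \o p)); first exact: sh.
by move=> u /pO /hO.
Qed.

Lemma smooth_comp_on E F Z (O' : set E) (h : E -> F) (f : F -> Z) :
  smooth f -> smooth_in O' h -> smooth_in O' (fun x => f (h x)).
Proof. by move=> sf sh; apply: (@smooth_in_comp _ _ _ _ setT) => //; exact: smooth_smooth_in. Qed.

Lemma smooth_in_cst E Z (O : set E) (z : Z) : smooth_in O (fun=> z).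
Proof. by move=> n U p pU pO; apply: plot_cst; exact: plot_open pU. Qed.

Lemma smooth_in_id E (O : set E) : smooth_in O (fun x => x).
Proof. by []. Qed.

Lemma smooth_in_pair E Z W (O : set E) (f : E -> Z) (g : E -> W) :
  smooth_in O f -> smooth_in O g ->
  smooth_in O (fun x => (f x, g x) : prodSpace Z W).
Proof. by move=> sf sg n U p pU pO; split; [exact: sf|exact: sg]. Qed.

Lemma smooth_in_fst E Z W (O : set E) (f : E -> prodSpace Z W) :
  smooth_in O f -> smooth_in O (fun x => (f x).1 : Z).
Proof. by move=> sf n U p pU pO; have [] := sf _ _ _ pU pO. Qed.

Lemma smooth_in_snd E Z W (O : set E) (f : E -> prodSpace Z W) :
  smooth_in O f -> smooth_in O (fun x => (f x).2 : W).
Proof. by move=> sf n U p pU pO; have [] := sf _ _ _ pU pO. Qed.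

Lemma smooth_in_glue E Z (O1 O2 O : set E) (f : E -> Z) :
  dopen O1 -> dopen O2 -> smooth_in O1 f -> smooth_in O2 f ->
  (forall x, O x -> O1 x \/ O2 x) -> smooth_in O f.
Proof.
move=> o1 o2 s1 s2 OO n U p pU pO; apply: plot_local; first exact: plot_open pU.
move=> u Uu; have [H1u|H2u] := OO _ (pO u Uu).
  exists (U `&` p @^-1` O1); split; [by []|exact: subIsetl|].
  by apply: s1 => [|v []//]; apply: (plot_restr pU); [exact: o1|exact: subIsetl].
exists (U `&` p @^-1` O2); split; [by []|exact: subIsetl|].
by apply: s2 => [|v []//]; apply: (plot_restr pU); [exact: o2|exact: subIsetl].
Qed.

Lemma glue2 E Z (O1 O2 : set E) (f1 f2 : E -> Z) :
  dopen O1 -> dopen O2 -> smooth_in O1 f1 -> smooth_in O2 f2 ->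
  (forall x, O1 x -> O2 x -> f1 x = f2 x) ->
  exists f : E -> Z, [/\ smooth_in (O1 `|` O2) f, (forall x, O1 x -> f x = f1 x) &
    forall x, O2 x -> f x = f2 x].
Proof.
move=> o1 o2 s1 s2 f12.
pose f x := if pselect (O1 x) then f1 x else f2 x.
have e1 x : O1 x -> f x = f1 x by rewrite /f; case: pselect.
have e2 x : O2 x -> f x = f2 x.
  by rewrite /f; case: pselect => // O1x O2x; exact: f12.
exists f; split=> //; apply: (smooth_in_glue o1 o2) => //.
  by apply: smooth_in_ext s1 => x /e1.
by apply: smooth_in_ext s2 => x /e2.
Qed.

Lemma dopenI E (O1 O2 : set E) : dopen O1 -> dopen O2 -> dopen (O1 `&` O2).
Proof.
move=> o1 o2 n U p pU.
have -> : U `&` p @^-1` (O1 `&` O2) = (U `&` p @^-1` O1) `&` (U `&` p @^-1` O2).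
  by apply/seteqP; split=> u /= [] => [? []|[? ?] []].
by apply: openI; [exact: o1|exact: o2].
Qed.

Lemma dopen_bigcup E I (O : I -> set E) :
  (forall i, dopen (O i)) -> dopen [set x | exists i, O i x].
Proof.
move=> oO n U p pU.
have -> : U `&` p @^-1` [set x | exists i, O i x] = \bigcup_i (U `&` p @^-1` O i).
  apply/seteqP; split=> u /=; first by move=> [Uu [i Oi]]; exists i.
  by move=> [i _ [Uu Oi]]; split=> //; exists i.
by apply: bigcup_open => i _; exact: oO.
Qed.

Lemma dopen_bigcap E (I : finType) (O : I -> set E) :
  (forall i, dopen (O i)) -> dopen [set x | forall i, O i x].
Proof.
move=> oO n U p pU; rewrite openE => u [Uu Ou].
have : \forall v \near u, forall i : I, (U `&` p @^-1` O i) v.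
  apply: (@filter_forall _ I (fun i => U `&` p @^-1` O i) (nbhs u) (nbhs_filter u)) => i; apply: open_nbhs_nbhs; split; first exact: oO.
  by split=> //; exact: Ou.
have nU : \forall v \near u, U v.
  by apply: open_nbhs_nbhs; split=> //; exact: plot_open pU.
by apply: filterS2 nU => v Uv H; split=> // i; have [] := H i.
Qed.

Lemma dopen_ltl E (g : E -> line) (c : R) : smooth g -> dopen [set x | (g x : R) < c].
Proof.
move=> sg n U p pU; have [opU sgp] := sg _ _ _ pU.
rewrite openE => u [Uu gu]; apply: filterI; first exact: open_nbhs_nbhs.
apply: (sgp 0%N u Uu [set y : R | y < c]).
by apply: open_nbhs_nbhs; split=> //; exact: open_lt.
Qed.

Lemma dopen_ltr E (g : E -> line) (c : R) : smooth g -> dopen [set x | c < (g x : R)].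
Proof.
move=> sg n U p pU; have [opU sgp] := sg _ _ _ pU.
rewrite openE => u [Uu gu]; apply: filterI; first exact: open_nbhs_nbhs.
apply: (sgp 0%N u Uu [set y : R | c < y]).
by apply: open_nbhs_nbhs; split=> //; exact: open_gt.
Qed.

Lemma smooth_inD E (O : set E) (f g : E -> line) : smooth_in O f -> smooth_in O g ->
  smooth_in O (fun x => (f x : R) + g x : line).
Proof.
move=> sf sg n U p pU pO; have [opU fU] := sf _ _ _ pU pO.
by have [_ gU] := sg _ _ _ pU pO; split=> // k; apply: CkD.
Qed.

Lemma smooth_inM E (O : set E) (f g : E -> line) : smooth_in O f -> smooth_in O g ->
  smooth_in O (fun x => (f x : R) * g x : line).
Proof.
move=> sf sg n U p pU pO; have [opU fU] := sf _ _ _ pU pO.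
by have [_ gU] := sg _ _ _ pU pO; split=> // k; apply: (@CkZ _ _ R k U (f \o p) (g \o p)).
Qed.

Lemma smooth_inN E (O : set E) (f : E -> line) : smooth_in O f ->
  smooth_in O (fun x => - (f x : R) : line).
Proof.
move=> sf; apply: (@smooth_in_ext _ _ _ (fun x => (-1) * (f x : R) : line)) => [x _|].
  by rewrite mulN1r.
exact: (@smooth_inM _ O (fun=> -1 : line) f (smooth_in_cst _) sf).
Qed.

Lemma smooth_inB E (O : set E) (f g : E -> line) : smooth_in O f -> smooth_in O g ->
  smooth_in O (fun x => (f x : R) - g x : line).
Proof. by move=> sf sg; apply: (smooth_inD sf); exact: smooth_inN. Qed.

Lemma smooth_in_step E (O : set E) (f : E -> line) : smooth_in O f ->
  smooth_in O (fun x => smoothstep (f x) : line).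
Proof.
move=> sf n U p pU pO; have [opU fU] := sf _ _ _ pU pO; split=> // k.
by apply: (@Ck_comp_real _ _ k U _ (f \o p)) => //; exact: smooth_smoothstep.
Qed.

Lemma smooth_in_prod E (O : set E) (I : Type) (r : seq I) (f : I -> E -> line) :
  (forall i, smooth_in O (f i)) -> smooth_in O (fun x => \prod_(i <- r) (f i x : R) : line).
Proof.
move=> sf; elim: r => [|i r IH].
  apply: (@smooth_in_ext E line O (fun=> 1)) => [x _|]; last exact: smooth_in_cst.
  by rewrite big_nil.
apply: smooth_in_ext (smooth_inM (sf i) IH) => x _; by rewrite big_cons.
Qed.

Lemma smooth_in_row E (O : set E) n (f : E -> stdSpace 'rV[R]_n) :
  (forall j, smooth_in O (fun x => (f x : 'rV[R]_n) ord0 j : line)) -> smooth_in O f.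
Proof.
move=> sf m U p pU pO; split; first exact: plot_open pU.
move=> k; apply: Ck_row => [|j]; first exact: plot_open pU.
by have [_] := sf j _ _ _ pU pO; exact.
Qed.

Lemma smooth_in_coord E (O : set E) n (j : 'I_n) (f : E -> stdSpace 'rV[R]_n) :
  smooth_in O f -> smooth_in O (fun x => (f x : 'rV[R]_n) ord0 j : line).
Proof.
move=> sf m U p pU pO; have [opU fU] := sf _ _ _ pU pO; split=> // k.
exact: (@Ck_coord _ _ _ k U (f \o p)).
Qed.

Lemma smooth_in_val E Z (O : set E) (A : set Z) (f : E -> subSpace A) :
  smooth_in O f -> smooth_in O (fun x => val (f x) : Z).
Proof. by move=> sf n U p pU pO; exact: sf. Qed.

Lemma smooth_in_sub_intro E Z (O : set E) (A : set Z) (f : E -> subSpace A) :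
  smooth_in O (fun x => val (f x) : Z) -> smooth_in O f.
Proof. by move=> sf n U p pU pO; exact: sf. Qed.

End Local.

(* Homotopies run over all of the line and are stationary outside [0, 1], so
   that two of them can be glued along open sets. The constraint [c] covers both
   homotopies rel a subset and homotopies of pairs. *)
Definition htpy_in (R : realType) (X Y : diffSpace R) (c : X -> Y -> Prop)
    (f g : X -> Y) : Prop :=
  exists k : prodSpace X (stdSpace R) -> Y, [/\ smooth k,
    (forall x (s : R), s <= 0 -> k (x, s) = f x),
    (forall x (s : R), 1 <= s -> k (x, s) = g x) &
    (forall x (s : R), c x (k (x, s)))].

Section Chtp.
Variable R : realType.
Implicit Types X Y Z : diffSpace R.
Local Notation line := (stdSpace R).

Lemma htpy_in_refl X Y (c : X -> Y -> Prop) (f : X -> Y) :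
  smooth f -> (forall x, c x (f x)) -> htpy_in c f f.
Proof.
move=> sf cf; exists (fun p => f p.1); split=> //.
by apply: smooth_inT; apply: (smooth_comp_on sf); exact: smooth_in_fst (@smooth_in_id _ _ _).
Qed.

Lemma htpy_in_sym X Y (c : X -> Y -> Prop) (f g : X -> Y) : htpy_in c f g -> htpy_in c g f.
Proof.
move=> [k [sk k0 k1 kc]]; exists (fun p => k (p.1, 1 - (p.2 : R))); split=> //.
- apply: smooth_inT; apply: (smooth_comp_on sk); apply: smooth_in_pair.
    exact: smooth_in_fst (@smooth_in_id _ _ _).
  by apply: smooth_inB; [exact: smooth_in_cst|exact: smooth_in_snd (@smooth_in_id _ _ _)].
- by move=> x s s0; apply: k1; rewrite lerBrDr gerDl.
- by move=> x s s0; apply: k0; rewrite subr_le0.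
Qed.

(** Both homotopies run at triple speed. For 1/3 < s < 2/3 the first has ended and the second has
    not begun, so both equal g on an open overlap. *)
Lemma htpy_in_trans X Y (c : X -> Y -> Prop) (f g h : X -> Y) :
  htpy_in c f g -> htpy_in c g h -> htpy_in c f h.
Proof.
move=> [k [sk k0 k1 kc]] [l [sl l0 l1 lc]].
have sp2 : smooth (snd : prodSpace X line -> line).
  by apply: smooth_inT; exact: smooth_in_snd (@smooth_in_id _ _ _).
have sk' : smooth (fun p : prodSpace X line => k (p.1, 3 * (p.2 : R) : line)).
  apply: smooth_inT; apply: (smooth_comp_on sk); apply: smooth_in_pair.
    exact: smooth_in_fst (@smooth_in_id _ _ _).
  by apply: smooth_inM; [exact: smooth_in_cst|exact: smooth_smooth_in].
have sl' : smooth (fun p : prodSpace X line => l (p.1, 3 * (p.2 : R) - 2 : line)).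
  apply: smooth_inT; apply: (smooth_comp_on sl); apply: smooth_in_pair.
    exact: smooth_in_fst (@smooth_in_id _ _ _).
  apply: smooth_inB; last exact: smooth_in_cst.
  by apply: smooth_inM; [exact: smooth_in_cst|exact: smooth_smooth_in].
have o1 := dopen_ltl (c := 2/3) sp2; have o2 := dopen_ltr (c := 1/3) sp2.
have [|q [sq q1 q2]] := glue2 o1 o2 (smooth_smooth_in sk') (smooth_smooth_in sl').
  by move=> [x s] /= s1 s2; rewrite k1 ?l0//; lra.
exists q; split.
- apply: smooth_inT; apply: smooth_in_sub sq => -[x s] _ /=; have [s1|s1] := ltP s (2/3); first by left.
  by right; lra.
- by move=> x s s0; rewrite q1 /=; [apply: k0; lra|lra].
- by move=> x s s0; rewrite q2 /=; [apply: l1; lra|lra].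
- move=> x s; have [s1|s1] := ltP s (2/3); first by rewrite q1.
  by rewrite q2 //=; lra.
Qed.

Lemma htpy_in_comp X Y Z (c : X -> Y -> Prop) (d : X -> Z -> Prop) (e : Y -> Z) (f g : X -> Y) :
  smooth e -> (forall x y, c x y -> d x (e y)) ->
  htpy_in c f g -> htpy_in d (fun x => e (f x)) (fun x => e (g x)).
Proof.
move=> se cd [k [sk k0 k1 kc]]; exists (fun p => e (k p)); split.
- exact: (smooth_comp sk se).
- by move=> x s s0; rewrite k0.
- by move=> x s s0; rewrite k1.
- by move=> x s; apply: cd.
Qed.

Lemma htpy_in_precomp X Y Z (c : Y -> Z -> Prop) (d : X -> Z -> Prop) (e : X -> Y) (f g : Y -> Z) :
  smooth e -> (forall x y, c (e x) y -> d x y) ->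
  htpy_in c f g -> htpy_in d (fun x => f (e x)) (fun x => g (e x)).
Proof.
move=> se cd [k [sk k0 k1 kc]]; exists (fun p => k (e p.1, p.2)); split.
- apply: smooth_inT; apply: (smooth_comp_on sk); apply: smooth_in_pair.
    by apply: (smooth_comp_on se); exact: smooth_in_fst (@smooth_in_id _ _ _).
  exact: smooth_in_snd (@smooth_in_id _ _ _).
- by move=> x s s0; rewrite k0.
- by move=> x s s0; rewrite k1.
- by move=> x s; apply: cd.
Qed.

Lemma htpy_in_sub X Y (c d : X -> Y -> Prop) (f g : X -> Y) :
  (forall x y, c x y -> d x y) -> htpy_in c f g -> htpy_in d f g.
Proof. by move=> cd [k [sk k0 k1 kc]]; exists k; split=> // x s; exact: cd. Qed.

End Chtp.

(** * Compression problems near the boundary of the cube *)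

Section Cutoff.
Variables (R : realType) (E : diffSpace R) (I : finType) (g : I -> E -> stdSpace R).
Hypothesis sg : forall i, smooth (g i).
Local Notation line := (stdSpace R).

(** The finite family is arbitrary so that the same gluing serves the faces of the cube, their
    pullbacks to the product with the line, and all faces but the top one. *)
Definition low (c : R) : set E := [set x | exists i, (g i x : R) < c].
Definition high (c : R) : set E := [set x | forall i, c < (g i x : R)].

Lemma dopen_low c : dopen (low c).
Proof. by apply: dopen_bigcup => i; apply: dopen_ltl. Qed.

Lemma dopen_high c : dopen (high c).
Proof. by apply: dopen_bigcap => i; apply: dopen_ltr. Qed.

Lemma low_sub c c' : c <= c' -> low c `<=` low c'.
Proof. by move=> cc x [i gi]; exists i; apply: lt_le_trans cc. Qed.

Lemma low_or_high c' c x : c' < c -> low c x \/ high c' x.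
Proof.
move=> cc; have [?|H] := pselect (low c x); first by left.
right=> i; apply: (lt_le_trans cc); rewrite leNgt; apply/negP => gi.
by apply: H; exists i.
Qed.

Lemma cutoff c' c : c' < c -> exists chi : E -> line,
  [/\ smooth chi, (forall x, low c' x -> chi x = 1) & (forall x, high c x -> chi x = 0)].
Proof.
move=> cc; have cc0 : 0 < c - c' by rewrite subr_gt0.
(* One vanishing factor kills the product, which realises the existential in [low]; all factors are
   1 on [high c]. *)
exists (fun x => 1 - \prod_i smoothstep ((g i x - c') / (c - c')) : R); split.
- apply: smooth_inT; apply: smooth_inB; first exact: smooth_in_cst.
  apply: smooth_in_prod => i; apply: smooth_in_step; apply: smooth_inM; last exact: smooth_in_cst.
  by apply: smooth_inB; [exact: smooth_smooth_in|exact: smooth_in_cst].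
- move=> x [i gi]; rewrite (bigD1 i)//= smoothstep_le0 ?mul0r ?subr0//.
  by rewrite pmulr_lle0 ?invr_gt0// subr_le0 ltW.
- move=> x hx; rewrite big1 ?subrr// => i _; apply: smoothstep_ge1.
  by rewrite ler_pdivlMr// mul1r lerB// ltW.
Qed.

Lemma glue_low (Z : diffSpace R) c' c (f1 f2 : E -> Z) : c' < c ->
  smooth_in (low c) f1 -> smooth_in (high c') f2 ->
  (forall x, low c x -> high c' x -> f1 x = f2 x) ->
  exists f : E -> Z, [/\ smooth f, (forall x, low c x -> f x = f1 x) &
    (forall x, high c' x -> f x = f2 x)].
Proof.
move=> cc s1 s2 f12; have [f [sf e1 e2]] := glue2 (@dopen_low c) (@dopen_high c') s1 s2 f12.
exists f; split=> //; apply: smooth_inT; apply: smooth_in_sub sf => x _.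
exact: low_or_high.
Qed.

End Cutoff.

Section CompressionProblems.
Variable R : realType.
Local Notation line := (stdSpace R).
Local Notation E n := (stdSpace 'rV[R]_n).

Definition face n (i : 'I_n * bool) (t : E n) : line :=
  if i.2 then 1 - (t : 'rV[R]_n) ord0 i.1 else (t : 'rV[R]_n) ord0 i.1.

Lemma smooth_face n (i : 'I_n * bool) : smooth (@face n i).
Proof.
have sc : smooth (fun t : E n => (t : 'rV[R]_n) ord0 i.1 : line).
  by apply: smooth_inT; apply: smooth_in_coord; exact: smooth_in_id.
apply: smooth_inT; rewrite /face; case: i sc => j [] /= sc; last exact: smooth_smooth_in.
by apply: smooth_inB; [exact: smooth_in_cst|exact: smooth_smooth_in].
Qed.

(* [out eps] is an open neighbourhood of the complement of the open cube. Maps on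
   [out eps] replace tame maps on the boundary: gluing along open sets needs no
   tameness, and [eps] may shrink at each step. *)
Definition out n : R -> set (E n) := low (@face n).
Definition inn n : R -> set (E n) := high (@face n).

Definition solvable n (Z W : diffSpace R) (e : Z -> W) (b : E n -> Z) (f : E n -> W) :=
  exists F : E n -> Z, smooth F /\ exists eps : R, [/\ 0 < eps,
    (forall t, out eps t -> F t = b t) &
    htpy_in (fun t w => out eps t -> w = f t) f (fun t => e (F t))].

Definition compressible n (Z W : diffSpace R) (e : Z -> W) :=
  forall (eps : R) (b : E n -> Z) (f : E n -> W), 0 < eps ->
    smooth_in (out eps) b -> smooth f -> (forall t, out eps t -> f t = e (b t)) ->
    solvable e b f.

Lemma solvable_ext n (Z W : diffSpace R) (e : Z -> W) (b b' : E n -> Z) f (eps : R) :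
  0 < eps -> (forall t, out eps t -> b t = b' t) -> solvable e b f -> solvable e b' f.
Proof.
move=> e0 bb [F [sF [d [d0 Fb k]]]]; exists F; split=> //.
exists (Num.min d eps); split; first by rewrite lt_min d0.
  by move=> t ot; rewrite Fb ?bb//; apply: low_sub ot; rewrite ge_min lexx ?orbT.
by apply: htpy_in_sub k => t w H ot; apply: H; apply: low_sub ot; rewrite ge_min lexx.
Qed.

(* Extend [e \o B] to a homotopy from [f] by damping the time with a cutoff, solve
   at time 1, then push the solution back along [B]. On the boundary the
   resulting homotopy goes forth and back along [e \o B], so damping the time once
   more makes it stationary there. *)
Lemma transport n (Z W : diffSpace R) (e : Z -> W) (eps : R)
    (B : prodSpace (E n) line -> Z) (f : E n -> W) :
  smooth e -> 0 < eps -> smooth_in [set p : prodSpace (E n) line | out eps p.1] B -> smooth f ->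
  (forall t, out eps t -> f t = e (B (t, 0))) ->
  (forall eps1 (f1 : E n -> W), 0 < eps1 -> smooth f1 ->
    (forall t, out eps1 t -> f1 t = e (B (t, 1))) ->
    solvable e (fun t => B (t, 1)) f1) ->
  solvable e (fun t => B (t, 0)) f.
Proof.
move=> se e0 sB sf fB IH.
have sfc := @smooth_face n.
pose P := prodSpace (E n) line.
have s1 (O : set P) : smooth_in O (fun p : P => p.1).
  exact: smooth_in_fst (@smooth_in_id _ _ _).
have s2 (O : set P) : smooth_in O (fun p : P => p.2).
  exact: smooth_in_snd (@smooth_in_id _ _ _).
pose face' i (p : P) : line := face i p.1.
have sfc' i : smooth (face' i) by apply: smooth_inT; apply: (smooth_comp_on (sfc i)).
have sB' (F : diffSpace R) (O : set F) (x : F -> E n) (s : F -> line) :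
    smooth_in O x -> smooth_in O s -> (forall y, O y -> out eps (x y)) ->
    smooth_in O (fun y => B (x y, s y)).
  by move=> sx ss Ox; apply: (smooth_in_comp sB (smooth_in_pair sx ss)).
have seB' (F : diffSpace R) (O : set F) (x : F -> E n) (s : F -> line) :
    smooth_in O x -> smooth_in O s -> (forall y, O y -> out eps (x y)) ->
    smooth_in O (fun y => e (B (x y, s y))).
  by move=> sx ss Ox; apply: (smooth_comp_on se); apply: sB'.
have [chi [schi chi1 chi0]] := cutoff sfc (c' := eps / 4) (c := eps / 2) ltac:(lra).
have [f1 [sf1 f1o f1i]] : exists f1 : E n -> W, [/\ smooth f1,
    (forall t, out eps t -> f1 t = e (B (t, chi t))) &
    (forall t, inn (eps / 2) t -> f1 t = f t)].
  apply: (glue_low sfc) => //; first lra.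
  - by apply: seB' => //; exact: smooth_smooth_in.
  - exact: smooth_smooth_in.
  - by move=> t ot it; rewrite chi0// fB.
have [F1 [sF1 [d' [d'0 F1b' k']]]] : solvable e (fun t => B (t, 1)) f1.
  apply: (IH (eps / 4)) => //; first lra.
  by move=> t ot; rewrite f1o ?chi1//; apply: low_sub ot; lra.
pose d := Num.min d' (eps / 4).
have d0 : 0 < d by rewrite lt_min d'0; lra.
have dd' : d <= d' by rewrite ge_min lexx.
have de : d <= eps / 4 by rewrite ge_min lexx orbT.
have F1b (t : E n) : out d t -> F1 t = B (t, 1) by move=> ot; apply: F1b'; exact: low_sub ot.
have [k [sk k0 k1 kr]] := k'.
have {}kr (t : E n) s : out d t -> k (t, s) = f1 t by move=> ot; apply: kr; exact: low_sub ot.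
have [chj [schj chj1 chj0]] := cutoff sfc (c' := d / 4) (c := d / 2) ltac:(lra).
have oe (t : E n) : out d t -> out eps t by apply: low_sub; lra.
have oe2 (t : E n) : out (d / 4) t -> out d t by apply: low_sub; lra.
have [F [sF Fo Fi]] : exists F : E n -> Z, [/\ smooth F,
    (forall t, out d t -> F t = B (t, 1 - (chj t : R))) &
    (forall t, inn (d / 2) t -> F t = F1 t)].
  apply: (glue_low sfc) => //; first lra.
  - apply: sB' => [||t ot]; [exact: smooth_in_id| |exact: oe].
    by apply: smooth_inB; [exact: smooth_in_cst|exact: smooth_smooth_in].
  - exact: smooth_smooth_in.
  - by move=> t ot it; rewrite chj0// subr0 F1b.
exists F; split=> //; exists (d / 4); split; first lra.
  by move=> t ot; rewrite Fo ?chj1 ?subrr//; exact: oe2.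
(* The time along B reached at the end of [h]: it is [1 - chj] on [out d], matching the start of [q]
   below, and 0 on [out (d / 4)], where the homotopy must stand still. *)
pose rho t : R := (chi t : R) * (1 - (chj t : R)).
have srho : smooth (rho : E n -> line).
  apply: smooth_inT; apply: smooth_inM; first exact: smooth_smooth_in.
  by apply: smooth_inB; [exact: smooth_in_cst|exact: smooth_smooth_in].
have [h [sh ho hi]] : exists h : P -> W, [/\ smooth h,
    (forall p, out eps p.1 -> h p = e (B (p.1, smoothstep p.2 * rho p.1))) &
    (forall p, inn (eps / 2) p.1 -> h p = f p.1)].
  apply: (@glue_low _ _ _ _ sfc' _ (eps / 2) eps) => //; first lra.
  - apply: seB' => //; apply: smooth_inM; first by apply: smooth_in_step.
    exact: (smooth_comp_on srho).
  - exact: (smooth_comp_on sf).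
  - by move=> p ot it; rewrite /rho chi0// mul0r mulr0 fB.
have io (t : E n) : out eps t \/ inn (eps / 2) t by apply: low_or_high; lra.
have iod (t : E n) : out d t \/ inn (d / 2) t by apply: low_or_high; lra.
have sh1 : smooth (fun t : E n => h (t, 1 : line)).
  apply: smooth_inT; apply: (smooth_comp_on sh); apply: smooth_in_pair; first exact: smooth_in_id.
  exact: smooth_in_cst.
have h1 (t : E n) : h (t, 1) = if pselect (out eps t) then e (B (t, rho t)) else f t.
  case: pselect => [ot|/= nt]; first by rewrite ho //= smoothstep_ge1// mul1r.
  by have [|it] := io t; [|rewrite hi].
apply: (@htpy_in_trans _ _ _ _ _ (fun t => h (t, 1 : line))).
  exists h; split=> //.
  - move=> t s s0; have [ot|it] := io t; last by rewrite hi.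
    by rewrite ho //= smoothstep_le0// mul0r fB.
  - move=> t s s0; have [ot|it] := io t; last by rewrite !hi.
    by rewrite !ho /= ?(smoothstep_ge1 s0) ?(smoothstep_ge1 (lexx 1)).
  - move=> t s ot; rewrite ho /=; last by apply: oe; exact: oe2.
    rewrite /rho chj1// subrr !mulr0 fB//; apply: oe; exact: oe2.
have [q [sq qo qi]] : exists q : P -> W, [/\ smooth q,
    (forall p, out d p.1 -> q p = e (B (p.1, 1 - (chj p.1 : R)))) &
    (forall p, inn (d / 2) p.1 -> q p = k p)].
  apply: (@glue_low _ _ _ _ sfc' _ (d / 2) d) => //; first lra.
  - apply: seB' => [||t ot]; [exact: s1| |exact: oe].
    by apply: smooth_inB; [exact: smooth_in_cst|exact: (smooth_comp_on schj)].
  - exact: smooth_smooth_in.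
  - move=> [t s] /= ot it; rewrite chj0// subr0 kr// f1o ?chi1//; last exact: oe.
    by apply: low_sub ot.
exists q; split=> //.
- move=> t s s0; have [ot|it] := iod t.
    rewrite qo//= ho/=; last exact: oe.
    by rewrite smoothstep_ge1// /rho chi1 ?mul1r//; apply: low_sub ot.
  rewrite qi// k0//; have [ot|it'] := io t; last by rewrite hi// f1i.
  by rewrite ho//= f1o// smoothstep_ge1// /rho chj0// subr0 mulr1 mul1r.
- move=> t s s1'; have [ot|it] := iod t; first by rewrite qo//= Fo.
  by rewrite qi// k1// Fi.
- move=> t s ot; rewrite qo//=; last exact: oe2.
  by rewrite chj1// subrr fB//; apply: oe; exact: oe2.
Qed.

End CompressionProblems.

(** * Collapsing the cube *)

Section Collapse.
Variable R : realType.
Local Notation line := (stdSpace R).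
Local Notation E n := (stdSpace 'rV[R]_n).

Definition ramp (e x : R) : R := x * smoothstep ((x - e / 2) / (e / 2)).
(* Equal to 0 up to [e / 2], the identity on [e, 1 - e], and 1 from
   [1 - e / 2] on. *)
Definition clamp (e x : R) : R := ramp e x + (1 - ramp e (1 - x)) - x.

Section Clamp.
Variable e : R.
Hypothesis he : 0 < e <= 2^-1.
Let e0 : 0 < e. Proof. by case/andP: he. Qed.
Let e2 : e <= 2^-1. Proof. by case/andP: he. Qed.

Ltac lra_eps := move: e0 e2 => ? ?; lra.

Let ramp_id x : e <= x -> ramp e x = x.
Proof.
move=> ex; rewrite /ramp smoothstep_ge1 ?mulr1// ler_pdivlMr; last lra_eps.
by rewrite mul1r; lra_eps.
Qed.

Let ramp_0 x : x <= e / 2 -> ramp e x = 0.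
Proof.
move=> ex; rewrite /ramp smoothstep_le0 ?mulr0// pmulr_lle0 ?invr_gt0; lra_eps.
Qed.

Let ramp_le x : x <= e -> 0 <= ramp e x <= e.
Proof.
move=> xe; have [?|x0] := leP x (e / 2); first by rewrite ramp_0// lexx ltW.
have s0 := smoothstep_ge0 ((x - e / 2) / (e / 2)).
have s1 := smoothstep_le1 ((x - e / 2) / (e / 2)).
rewrite /ramp; move: (smoothstep _) s0 s1 => u u0 u1.
apply/andP; split; first by apply: mulr_ge0 => //; lra_eps.
by move: e0 e2 => ? ?; nra.
Qed.

(** Since e <= 1/2, every x satisfies x <= 1 - e or e <= x, so one of the two ramps in [clamp] is
    always the identity and cancels, leaving the other. *)
Let clampL x : x <= 1 - e -> clamp e x = ramp e x.
Proof. by move=> ex; rewrite /clamp (ramp_id (x := 1 - x)); lra_eps. Qed.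

Let clampR x : e <= x -> clamp e x = 1 - ramp e (1 - x).
Proof. by move=> ex; rewrite /clamp (ramp_id (x := x)); lra_eps. Qed.

Lemma clamp_id x : e <= x <= 1 - e -> clamp e x = x.
Proof. by move=> /andP[ex xe]; rewrite clampL// ramp_id. Qed.

Lemma clamp_0 x : x <= e / 2 -> clamp e x = 0.
Proof. by move=> ex; rewrite clampL ?ramp_0//; lra_eps. Qed.

Lemma clamp_1 x : 1 - e / 2 <= x -> clamp e x = 1.
Proof. by move=> ex; rewrite clampR ?ramp_0; lra_eps. Qed.

Lemma clamp_le x : x <= e -> 0 <= clamp e x <= e.
Proof. by move=> xe; rewrite clampL; [exact: ramp_le|lra_eps]. Qed.

Lemma clamp_ge x : 1 - e <= x -> 1 - e <= clamp e x <= 1.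
Proof.
move=> xe; rewrite clampR; last lra_eps.
have : 0 <= ramp e (1 - x) <= e by apply: ramp_le; lra_eps.
by move=> ?; lra.
Qed.

Lemma clamp_itv x : 0 <= clamp e x <= 1.
Proof.
have [xe|xe] := leP x e; first by move: (clamp_le xe) => ?; lra_eps.
have [xe'|xe'] := leP (1 - e) x; first by move: (clamp_ge xe') => ?; lra_eps.
by rewrite clamp_id; lra_eps.
Qed.

Lemma collapse_subproof n (t : 'rV[R]_n) : cube_set R n (\row_j clamp e (t ord0 j)).
Proof. by move=> j; rewrite mxE clamp_itv. Qed.

(** Precomposition with [collapse] turns maps on the cube into maps on all of R^n, and conditions on
    the boundary into conditions on [out (e / 2)]. *)
Definition collapse n (t : E n) : cube R n :=
  exist _ (\row_j clamp e (t ord0 j) : 'rV[R]_n) (mem_set (collapse_subproof t)).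

Lemma coord_collapse n (t : E n) j :
  coord (collapse t) ord0 j = clamp e ((t : 'rV[R]_n) ord0 j).
Proof. by rewrite /coord /= mxE. Qed.

Lemma smooth_collapse n : smooth (@collapse n).
Proof.
apply: smooth_inT; apply: smooth_in_sub_intro; apply: smooth_in_row => j.
have sj : smooth_in setT (fun t : E n => (t : 'rV[R]_n) ord0 j : line).
  by apply: smooth_in_coord; exact: smooth_in_id.
have sk (f : E n -> line) : smooth_in setT f -> smooth_in setT (fun t => ramp e (f t) : line).
  move=> sf; apply: smooth_inM => //; apply: smooth_in_step; apply: smooth_inM.
    by apply: smooth_inB => //; exact: smooth_in_cst.
  exact: smooth_in_cst.
apply: (@smooth_in_ext _ _ _ _ (fun t : E n => clamp e ((t : 'rV[R]_n) ord0 j) : line)).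
  by move=> t _; rewrite /= mxE.
apply: smooth_inB => //; apply: smooth_inD; first exact: sk.
apply: smooth_inB; first exact: smooth_in_cst.
by apply: sk; apply: smooth_inB => //; exact: smooth_in_cst.
Qed.

Lemma collapse_boundary n (t : E n) : out (e / 2) t -> boundary R n (collapse t).
Proof.
move=> [[j b]] /=; rewrite /face /=; case: b => H; exists j; rewrite coord_collapse.
  by right; apply: clamp_1; lra_eps.
by left; apply: clamp_0; lra_eps.
Qed.
End Clamp.

Lemma half_ok : 0 < (2^-1 : R) <= 2^-1. Proof. lra. Qed.

Definition half_collapse n : E n -> cube R n := @collapse _ half_ok n.
Lemma smooth_half_collapse n : smooth (@half_collapse n). Proof. exact: smooth_collapse. Qed.
Lemma half_collapse_boundary n (t : E n) : out (1/4) t -> boundary R n (half_collapse t).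
Proof. by move=> ot; apply: collapse_boundary; apply: low_sub ot; lra. Qed.

Lemma smooth_coord n : smooth (@coord R n : cube R n -> E n).
Proof. by []. Qed.

Lemma stepI_subproof (s : R) : @unit_itv R (smoothstep s).
Proof. by rewrite /unit_itv /= smoothstep_ge0 smoothstep_le1. Qed.

(** Turns a homotopy over I into one over the line that is stationary outside [0, 1]. *)
Definition stepI (s : line) : I01 R := exist _ (smoothstep s : R) (mem_set (stepI_subproof s)).

Lemma smooth_stepI : smooth stepI.
Proof.
apply: smooth_inT; apply: smooth_in_sub_intro; apply: smooth_in_step; exact: smooth_in_id.
Qed.

Lemma stepI_le0 (s : R) : s <= 0 -> stepI s = I0 R.
Proof. by move=> s0; apply: val_inj; rewrite /= smoothstep_le0. Qed.

Lemma stepI_ge1 (s : R) : 1 <= s -> stepI s = I1 R.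
Proof. by move=> s0; apply: val_inj; rewrite /= smoothstep_ge1. Qed.

Lemma smooth_interp (F : diffSpace R) (O : set F) n (x y : F -> E n) (s : F -> line) :
  smooth_in O x -> smooth_in O y -> smooth_in O s ->
  smooth_in O (fun p => (1 - (s p : R)) *: (x p : 'rV[R]_n) + (s p : R) *: (y p : 'rV[R]_n) : E n).
Proof.
move=> sx sy ss; apply: smooth_in_row => j.
apply: (@smooth_in_ext _ _ _ _ (fun p : F => (1 - (s p : R)) * ((x p : 'rV[R]_n) ord0 j)
   + (s p : R) * ((y p : 'rV[R]_n) ord0 j) : line)); first by move=> p _; rewrite !mxE.
by apply: smooth_inD; apply: smooth_inM => //; try exact: smooth_in_coord;
  apply: smooth_inB => //; exact: smooth_in_cst.
Qed.

(** Restricting f to the cube and pulling back loses nothing up to homotopy. As d <= 1/4, the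
    collapse sends a coordinate below d to 0 and one above 1 - d to 1, so the straight line from
    such a point to its collapse stays in [out eps]. *)
Lemma straighten n (W : diffSpace R) (f : E n -> W) (w0 : W) (eps : R) :
  0 < eps -> smooth f -> (forall t, out eps t -> f t = w0) ->
  exists d : R, [/\ 0 < d, d <= eps & htpy_in (fun t w => out d t -> w = w0) f (fun t => f (coord (half_collapse t)))].
Proof.
move=> e0 sf fo; pose d := Num.min eps (1/4).
have d0 : 0 < d by rewrite lt_min e0; lra.
have de : d <= eps by rewrite ge_min lexx.
have d4 : d <= 1/4 by rewrite ge_min lexx orbT.
exists d; split=> //.
exists (fun p => f ((1 - smoothstep p.2) *: (p.1 : 'rV[R]_n) + smoothstep p.2 *: coord (half_collapse p.1))).
split.
- apply: smooth_inT; apply: (smooth_comp_on sf).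
  apply: (@smooth_interp (prodSpace (E n) line) setT n (fun p => p.1) (fun p => coord (half_collapse p.1)) (fun p => smoothstep p.2)).
  + exact: smooth_in_fst (@smooth_in_id _ _ _).
  + apply: (smooth_comp_on (@smooth_coord n)); apply: (smooth_comp_on (@smooth_half_collapse n)).
    exact: smooth_in_fst (@smooth_in_id _ _ _).
  + by apply: smooth_in_step; exact: smooth_in_snd (@smooth_in_id _ _ _).
- by move=> x s s0; rewrite smoothstep_le0// subr0 scale1r scale0r addr0.
- by move=> x s s0; rewrite smoothstep_ge1// subrr scale1r scale0r add0r.
- move=> t s [[j b] H]; apply: fo; exists (j, b); move: H; rewrite /face /=.
  rewrite !mxE.
  have := smoothstep_ge0 s; have := smoothstep_le1 s.
  move: (smoothstep s) => u u1 u0.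
  have key y : y < eps -> (1 - u) * y < eps by move=> ye; have [y0|y0] := leP y 0; nra.
  move: (t ord0 j) => x; case: b => H.
    rewrite (clamp_1 half_ok); last lra.
    by have := key (1 - x); lra.
  rewrite (clamp_0 half_ok); last lra.
  by have := key x; lra.
Qed.

End Collapse.

(** * Homotopy groups in terms of plots *)

Section HomotopyGroups.
Variable R : realType.
Local Notation line := (stdSpace R).
Local Notation E n := (stdSpace 'rV[R]_n).

(** Classes are taken for a generated equivalence relation; as [htpy_in] is symmetric and
    transitive, an equality of classes still yields a single homotopy. *)
Lemma htpy_in_eqv (A : Type) (r : A -> A -> Prop) (X Y : diffSpace R) (c : X -> Y -> Prop)
    (f : A -> X -> Y) :
  (forall a, htpy_in c (f a) (f a)) -> (forall a b, r a b -> htpy_in c (f a) (f b)) ->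
  forall a b, clos_refl_sym_trans A r a b -> htpy_in c (f a) (f b).
Proof.
move=> H0 H1 a b; elim=> [x y|x|x y _|x y z _ xy _]; [exact: H1|exact: H0|exact: htpy_in_sym|].
exact: (htpy_in_trans xy).
Qed.

Lemma path_htpy_in (X Y : diffSpace R) (x y : Y) : path_joined x y ->
  htpy_in (fun (_ : X) _ => True) (fun=> x) (fun=> y).
Proof.
move=> [g [sg g0 g1]]; exists (fun p => g (stepI p.2)); split=> //.
- apply: smooth_inT; apply: (smooth_comp_on sg); apply: (smooth_comp_on (@smooth_stepI R)).
  exact: smooth_in_snd (@smooth_in_id _ _ _).
- by move=> z s s0; rewrite stepI_le0.
- by move=> z s s0; rewrite stepI_ge1.
Qed.

Lemma pi0_htpy_in (X Y : diffSpace R) (x y : Y) :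
  to_quot (@path_joined R Y) x = to_quot (@path_joined R Y) y ->
  htpy_in (fun (_ : X) _ => True) (fun=> x) (fun=> y).
Proof.
move=> /to_quotE; apply: (@htpy_in_eqv Y _ X Y _ (fun y _ => y)) => [z|z z']; last exact: path_htpy_in.
by apply: htpy_in_refl => //; apply: smooth_inT; exact: smooth_in_cst.
Qed.

Definition cube_plot n (Z : diffSpace R) (z0 : Z) (c : pairMap (boundary R n) [set z0]) (t : E n) : Z :=
  c (half_collapse t).

Lemma smooth_cube_plot n (Z : diffSpace R) (z0 : Z) (c : pairMap (boundary R n) [set z0]) :
  smooth (cube_plot c).
Proof. exact: smooth_comp (@smooth_half_collapse R n) (pair_smooth c). Qed.

Lemma cube_plot_out n (Z : diffSpace R) (z0 : Z) (c : pairMap (boundary R n) [set z0]) t :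
  out (1/4) t -> cube_plot c t = z0.
Proof. by move=> /half_collapse_boundary; exact: (pair_sub c). Qed.

Lemma group_htpy_in n (Z : diffSpace R) (z0 : Z) (c d : pairMap (boundary R n) [set z0]) :
  to_quot (@pair_homotopic R _ _ _ _) c = to_quot (@pair_homotopic R _ _ _ _) d ->
  htpy_in (fun t z => out (1/4) t -> z = z0) (cube_plot c) (cube_plot d).
Proof.
move=> /to_quotE; apply: htpy_in_eqv => [a|a b [H [sH H0 H1 HA]]].
  by apply: htpy_in_refl => [|t]; [exact: smooth_cube_plot|exact: cube_plot_out].
exists (fun p => H (half_collapse p.1, stepI p.2)); split.
- apply: smooth_inT; apply: (smooth_comp_on sH); apply: smooth_in_pair.
    by apply: (smooth_comp_on (@smooth_half_collapse R n)); exact: smooth_in_fst (@smooth_in_id _ _ _).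
  by apply: (smooth_comp_on (@smooth_stepI R)); exact: smooth_in_snd (@smooth_in_id _ _ _).
- by move=> t s s0; rewrite stepI_le0// H0.
- by move=> t s s0; rewrite stepI_ge1// H1.
- by move=> t s /half_collapse_boundary; exact: HA.
Qed.

Lemma coord_boundary n (eps : R) (t : cube R n) : 0 < eps -> boundary R n t -> out eps (coord t).
Proof.
move=> e0 [j [H|H]]; [exists (j, false)|exists (j, true)]; rewrite /face /= H//.
by rewrite subrr.
Qed.

Lemma cube_sub n (Z : diffSpace R) (z0 : Z) (u : E n -> Z) (eps : R) :
  0 < eps -> (forall t, out eps t -> u t = z0) ->
  forall a, boundary R n a -> [set z0] (u (coord a)).
Proof. by move=> e0 uo a /(coord_boundary e0); exact: uo. Qed.

Definition cube_map n (Z : diffSpace R) (z0 : Z) (u : E n -> Z) (su : smooth u) (eps : R)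
  (e0 : 0 < eps) (uo : forall t, out eps t -> u t = z0) : pairMap (boundary R n) [set z0] :=
  PairMap (smooth_comp (@smooth_coord R n) su) (cube_sub e0 uo).

Section Equivalence.
Variables (Z W : diffSpace R) (e : Z -> W) (se : smooth e) (N : nat).
Hypothesis eqv : N_equivalence N se.

(** Surjectivity on pi_n at z0, transferred from the cube to R^n: a representative of a preimage of
    the class of f is the solution, and [straighten] compares f with its restriction to the cube. *)
Lemma N_equivalence_solvable_const n (z0 : Z) (f : E n -> W) (eps : R) :
  (0 < n <= N)%N -> 0 < eps -> smooth f -> (forall t, out eps t -> f t = e z0) ->
  solvable e (fun=> z0) f.
Proof.
move=> nN e0 sf fo; have [_ _ _ surj] := eqv.
have [c Hc] := surj z0 n nN (to_quot (@pair_homotopic R _ _ _ _) (cube_map sf e0 fo)).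
have [c' ec] := quot_ex c; rewrite -ec homotopy_group_mapE in Hc.
have h1 := group_htpy_in Hc.
have [d [d0 de h2]] := straighten e0 sf fo.
exists (cube_plot c'); split; first exact: smooth_cube_plot.
exists (Num.min d (1/4)).
have m4 : Num.min d (1 / 4) <= 1/4 by rewrite ge_min lexx orbT.
have md : Num.min d (1 / 4) <= d by rewrite ge_min lexx.
split; first by rewrite lt_min d0; lra.
  by move=> t ot; apply: cube_plot_out; apply: low_sub ot.
have fot t : out (Num.min d (1/4)) t -> f t = e z0.
  by move=> ot; apply: (fo t); apply: low_sub ot; apply: le_trans de.
apply: (@htpy_in_trans _ _ _ _ _ (cube_plot (cube_map sf e0 fo))).
  by apply: htpy_in_sub h2 => t w H ot; rewrite fot//; apply: H; apply: low_sub ot.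
apply: htpy_in_sym; apply: htpy_in_sub h1 => t w H ot; rewrite fot//; apply: H; apply: low_sub ot => //.
Qed.

(** Injectivity on pi_n: K shows that the image of the class of u is trivial. For n = 0 the
    condition on path components takes over. *)
Lemma N_equivalence_null n (z0 : Z) (u : E n -> Z) (K : prodSpace (E n) line -> W) (eps : R) :
  (n < N)%N -> 0 < eps -> smooth u -> (forall t, out eps t -> u t = z0) ->
  smooth K -> (forall t, K (t, 0) = e (u t)) -> (forall t, K (t, 1) = e z0) ->
  (forall t s, out eps t -> K (t, s) = e z0) ->
  exists d : R, 0 < d /\ htpy_in (fun t z => out d t -> z = z0) u (fun=> z0).
Proof.
move=> nN e0 su uo sK K0 K1 Ko; have [inj0 _ injn _] := eqv.
have sI : smooth (val : I01 R -> line) by [].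
case: (posnP n) => n0.
  (* In dimension 0 there are no faces and [out] is empty, so any positive radius will do. *)
  subst n; exists 1; split; first exact: ltr01.
  have E0 (t : E 0) : t = 0 by apply/rowP => -[].
  have : to_quot (@path_joined R Z) (u 0) = to_quot (@path_joined R Z) z0.
    apply: (inj0 nN); rewrite !pi0_mapE//; apply/to_quotE; apply: rst_step.
    exists (fun s => K (0, val s)); split; rewrite ?K0 ?K1//.
    by apply: smooth_inT; apply: (smooth_comp_on sK); apply: smooth_in_pair => //; exact: smooth_in_cst.
  move=> /(@pi0_htpy_in (E 0)); have -> : u = (fun=> u 0) by apply/funext => t; rewrite (E0 t).
  by apply: htpy_in_sub => t z _ [[]] [].
have sc : smooth (fun _ : E n => z0) by apply: smooth_inT; exact: smooth_in_cst.
pose cu := cube_map su e0 uo; pose cz := cube_map sc e0 (fun _ _ => erefl z0).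
have : to_quot (@pair_homotopic R _ _ _ _) cu = to_quot (@pair_homotopic R _ _ _ _) cz.
  apply: (injn z0 n); first by rewrite n0.
  rewrite !homotopy_group_mapE; apply/to_quotE; apply: rst_step.
  exists (fun p => K (coord p.1, val p.2)); split => //=.
  - apply: smooth_inT; apply: (smooth_comp_on sK); apply: smooth_in_pair.
      by apply: (smooth_comp_on (@smooth_coord R n)); exact: smooth_in_fst (@smooth_in_id _ _ _).
    by apply: smooth_in_val; exact: smooth_in_snd (@smooth_in_id _ _ _).
  - by move=> a t /(coord_boundary e0); exact: Ko.
move=> /group_htpy_in h1; have [d [d0 de h2]] := straighten e0 su uo.
exists (Num.min d (1/4)); split; first by rewrite lt_min d0; lra.
have m4 : Num.min d (1 / 4) <= 1/4 by rewrite ge_min lexx orbT.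
have md : Num.min d (1 / 4) <= d by rewrite ge_min lexx.
apply: (@htpy_in_trans _ _ _ _ _ (cube_plot cu)).
  by apply: htpy_in_sub h2 => t w H ot; apply: H; apply: low_sub ot.
by apply: htpy_in_sub h1 => t w H ot; apply: H; apply: low_sub ot.
Qed.

End Equivalence.
End HomotopyGroups.

(** * N-equivalences are compressible *)

Section Compress.
Variable R : realType.
Local Notation line := (stdSpace R).
Local Notation E n := (stdSpace 'rV[R]_n).

Definition headc n (t : E n.+1) : line := (t : 'rV[R]_n.+1) ord0 ord0.
Definition tailc n (t : E n.+1) : E n := \row_j (t : 'rV[R]_n.+1) ord0 (lift ord0 j).
Definition consc n (a : line) (t : E n) : E n.+1 :=
  \row_j (if unlift ord0 j is Some k then (t : 'rV[R]_n) ord0 k else a).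

Lemma headc_cons n (a : line) (t : E n) : headc (consc a t) = a.
Proof. by rewrite /headc mxE unlift_none. Qed.

Lemma tailc_cons n (a : line) (t : E n) : tailc (consc a t) = t.
Proof. by apply/rowP => j; rewrite !mxE liftK. Qed.

Lemma consc_eta n (t : E n.+1) : consc (headc t) (tailc t) = t.
Proof.
apply/rowP => j; rewrite mxE; case: unliftP => [k|] ->; last by [].
by rewrite mxE.
Qed.

Lemma smooth_headc n : smooth (@headc n).
Proof. by apply: smooth_inT; apply: smooth_in_coord; exact: smooth_in_id. Qed.

Lemma smooth_tailc n : smooth (@tailc n).
Proof.
apply: smooth_inT; apply: smooth_in_row => j.
apply: (@smooth_in_ext _ _ _ _ (fun t : E n.+1 => (t : 'rV[R]_n.+1) ord0 (lift ord0 j) : line)).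
  by move=> t _; rewrite mxE.
by apply: smooth_in_coord; exact: smooth_in_id.
Qed.

Lemma smooth_in_consc (F : diffSpace R) (O : set F) n (a : F -> line) (t : F -> E n) :
  smooth_in O a -> smooth_in O t -> smooth_in O (fun p => consc (a p) (t p)).
Proof.
move=> sa st; apply: smooth_in_row => j.
apply: (@smooth_in_ext _ F line O (fun p => if unlift ord0 j is Some k then (t p : 'rV[R]_n) ord0 k else a p)).
  by move=> p _; rewrite mxE.
by case: (unlift ord0 j) => [k|//]; exact: smooth_in_coord.
Qed.

(** The box of all faces except the top one, where the first coordinate is 1; [None] stands for the
    bottom face. *)
Definition jface n (i : option ('I_n * bool)) (t : E n.+1) : line :=
  if i is Some i then face i (tailc t) else headc t.
Definition jout n : R -> set (E n.+1) := low (@jface n).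

Lemma smooth_jface n i : smooth (@jface n i).
Proof.
case: i => [i|]; last exact: smooth_headc.
exact: smooth_comp (@smooth_tailc n) (smooth_face i).
Qed.

Lemma joutE n c (t : E n.+1) : jout c t <-> ((headc t : R) < c \/ out c (tailc t)).
Proof.
split=> [[[i|] H]|[H|[i H]]]; [by right; exists i|by left|by exists None|by exists (Some i)].
Qed.

Lemma outSE n c (t : E n.+1) : out c t <-> (1 - (headc t : R) < c \/ jout c t).
Proof.
split=> [[[j b]]|].
  rewrite /face /=; case: (unliftP ord0 j) => [k ->|->] H; last first.
    by case: b H => H; [left|right; exists None].
  by right; exists (Some (k, b)); rewrite /jface /face /= mxE.
move=> [H|[[[k b]|] H]]; first by exists (ord0, true).
  by exists (lift ord0 k, b); move: H; rewrite /jface /face /= mxE.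
by exists (ord0, false).
Qed.

Lemma jout_out n c : @jout n c `<=` out c.
Proof. by move=> t ?; apply/outSE; right. Qed.

Section Equivalence.
Variables (Z W : diffSpace R) (e : Z -> W) (se : smooth e) (N : nat).
Hypothesis eqv : N_equivalence N se.

(* [b] is constant near all faces but the top one, where it is an element of
   pi_n(Z), and [f] is a null-homotopy of its image; injectivity makes [b]
   homotopic to a constant, and surjectivity on pi_(n+1) then applies. *)
Lemma compress_top n (z0 : Z) (b : E n.+1 -> Z) (f : E n.+1 -> W) (eps : R) :
  (n < N)%N -> 0 < eps <= 2^-1 -> smooth_in (out eps) b -> smooth f ->
  (forall t, out eps t -> f t = e (b t)) -> (forall t, jout eps t -> b t = z0) ->
  solvable e b f.
Proof.
move=> nN /andP[e0 e2] sb sf fb bz.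
pose P := prodSpace (E n.+1) line.
have s1 (O : set P) : smooth_in O (fun p : P => p.1).
  exact: smooth_in_fst (@smooth_in_id _ _ _).
have s2 (O : set P) : smooth_in O (fun p : P => p.2).
  exact: smooth_in_snd (@smooth_in_id _ _ _).
have stop (c : R) : dopen [set p : P | 1 - (headc p.1 : R) < c].
  apply: (@dopen_ltl _ P (fun p => 1 - (headc p.1 : R))).
  apply: smooth_inT; apply: smooth_inB; first exact: smooth_in_cst.
  by apply: (smooth_comp_on (@smooth_headc n)).
have sjo (c : R) : dopen [set p : P | jout c p.1].
  apply: (@dopen_low _ P _ (fun i (p : P) => jface i p.1)) => i.
  by apply: smooth_inT; apply: (smooth_comp_on (@smooth_jface n i)).
pose u (t : E n) := b (consc 1 t).
have su : smooth u.
  apply: smooth_inT; apply: (smooth_in_comp sb).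
    by apply: smooth_in_consc; [exact: smooth_in_cst|exact: smooth_in_id].
  by move=> t _; apply/outSE; left; rewrite headc_cons subrr.
have uo t : out eps t -> u t = z0.
  by move=> ot; apply: bz; apply/joutE; right; rewrite tailc_cons.
have fj t : jout eps t -> f t = e z0 by move=> jt; rewrite fb ?bz//; exact: jout_out.
have [d [d0 [v [sv v0 v1 vo]]]] : exists d : R, 0 < d /\ htpy_in (fun t z => out d t -> z = z0) u (fun=> z0).
  (* Read from the top face down to the bottom one, f is a null-homotopy of [e \o u]. *)
  apply: (N_equivalence_null eqv (K := fun p => f (consc (1 - (p.2 : R)) p.1)) nN e0 su uo).
  - apply: smooth_inT; apply: (smooth_comp_on sf); apply: smooth_in_consc.
      by apply: smooth_inB; [exact: smooth_in_cst|exact: smooth_in_snd (@smooth_in_id _ _ _)].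
    exact: smooth_in_fst (@smooth_in_id _ _ _).
  - move=> t; rewrite subr0 fb//; apply/outSE; left; by rewrite headc_cons subrr.
  - by move=> t; rewrite subrr fj//; apply/joutE; left; rewrite headc_cons.
  - by move=> t s ot; apply: fj; apply/joutE; right; rewrite tailc_cons.
(* First motion: near the top face slide the first coordinate to 1, after which b depends on the
   other coordinates only, through u. *)
have [B [sB Bt Bj]] : exists B : P -> Z, [/\
   smooth_in ([set p : P | 1 - (headc p.1 : R) < eps] `|` [set p | jout eps p.1]) B,
   (forall p, 1 - (headc p.1 : R) < eps ->
      B p = b (consc ((1 - smoothstep p.2) * headc p.1 + smoothstep p.2) (tailc p.1))) &
   (forall p, jout eps p.1 -> B p = z0)].
  have key (h s : R) : 1 - h < eps -> 1 - ((1 - smoothstep s) * h + smoothstep s) < eps.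
    have := smoothstep_ge0 s; have := smoothstep_le1 s; move: (smoothstep s) => w w1 w0 he.
    by have [h0|h0] := leP (1 - h) 0; nra.
  apply: glue2 => //.
  - apply: (smooth_in_comp sb).
      apply: smooth_in_consc; last exact: (smooth_comp_on (@smooth_tailc n)).
      have ss (O : set P) : smooth_in O (fun p : P => smoothstep p.2 : line).
        exact: smooth_in_step.
      apply: smooth_inD => //; apply: smooth_inM; last exact: (smooth_comp_on (@smooth_headc n)).
      by apply: smooth_inB => //; exact: smooth_in_cst.
    move=> p /= hp; apply/outSE; left; rewrite headc_cons; exact: key.
  - exact: smooth_in_cst.
  - move=> p /= hp /joutE [hp'|ot]; first by exfalso; lra.
    by apply: bz; apply/joutE; right; rewrite tailc_cons.
have B0 t : out eps t -> B (t, 0) = b t.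
  move=> /outSE [H|H]; last by rewrite Bj// bz.
  by rewrite Bt//= smoothstep_le0// subr0 mul1r addr0 consc_eta.
apply: (solvable_ext e0 B0).
apply: (transport se e0 _ sf) => [|t ot|eps1 f1 e10 sf1 f1b].
- apply: smooth_in_sub sB => p /outSE [H|H]; [by left|by right].
- by rewrite B0// fb.
have B1 t : 1 - (headc t : R) < eps -> B (t, 1) = u (tailc t).
  by move=> H; rewrite Bt//= smoothstep_ge1// subrr mul0r add0r.
pose m := Num.min eps1 (Num.min d eps).
have m0 : 0 < m by rewrite !lt_min e10 d0.
have me1 : m <= eps1 by rewrite ge_min lexx.
have md : m <= d by rewrite !ge_min lexx orbT.
have me : m <= eps by rewrite !ge_min lexx !orbT.
(* Second motion: near the top face follow v to the constant; it fits with z0 on the other faces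
   because v is fixed on [out d]. *)
have [C [sC Ct Cj]] : exists C : P -> Z, [/\
   smooth_in ([set p : P | 1 - (headc p.1 : R) < m] `|` [set p | jout m p.1]) C,
   (forall p, 1 - (headc p.1 : R) < m -> C p = v (tailc p.1, p.2)) &
   (forall p, jout m p.1 -> C p = z0)].
  apply: glue2 => //.
  - apply: (smooth_comp_on sv); apply: smooth_in_pair => //.
    exact: (smooth_comp_on (@smooth_tailc n)).
  - exact: smooth_in_cst.
  - move=> [t s] /= hp /joutE [hp'|ot]; first by exfalso; lra.
    by apply: vo; apply: low_sub ot.
have C0 t : out m t -> C (t, 0) = B (t, 1).
  move=> /outSE [H|H]; last by rewrite Cj// Bj//; apply: low_sub H.
  by rewrite Ct//= v0// B1//; lra.
have C1 t : out m t -> C (t, 1) = z0.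
  by move=> /outSE [H|H]; [rewrite Ct//= v1|rewrite Cj].
apply: (solvable_ext m0 C0).
apply: (transport se m0 _ sf1) => [|t ot|eps2 f2 e20 sf2 f2b].
- apply: smooth_in_sub sC => p /outSE [H|H]; [by left|by right].
- by rewrite C0// f1b//; apply: low_sub ot.
have C1' t : out m t -> z0 = C (t, 1) by move=> /C1.
apply: (solvable_ext m0 C1').
apply: (N_equivalence_solvable_const eqv (eps := Num.min m eps2)) => //.
  by rewrite lt_min m0.
move=> t ot; rewrite f2b ?C1//; apply: low_sub ot; by rewrite ge_min lexx ?orbT.
Qed.

(* A neighbourhood of all faces but the top one contracts to a corner: first push
   the distinguished coordinate to 0, then the others. *)
Lemma N_equivalence_compressible n : (n <= N)%N -> compressible n e.
Proof.
case: n => [_|n nN] eps b f e0 sb sf fb.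
  have [_ surj _ _] := eqv.
  have E0 (t : E 0) : t = 0 by apply/rowP => -[].
  have [c Hc] := surj (to_quot (@path_joined R W) (f 0)).
  have [z ez] := quot_ex c; rewrite -ez pi0_mapE// in Hc.
  have h := @pi0_htpy_in R (E 0) _ _ _ Hc.
  exists (fun=> z); split; first by apply: smooth_inT; exact: smooth_in_cst.
  exists 1; split; [exact: ltr01|by move=> t [[[]]]|].
  apply: htpy_in_sym; have -> : f = (fun=> f 0) by apply/funext => t; rewrite (E0 t).
  by apply: htpy_in_sub h => t w _ [[[]]].
wlog e2 : eps e0 sb fb / eps <= 2^-1.
  move=> IH; apply: (IH (Num.min eps 2^-1)).
  - by rewrite lt_min e0; lra.
  - by apply: smooth_in_sub sb => t; apply: low_sub; rewrite ge_min lexx.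
  - by move=> t ot; apply: fb; apply: low_sub ot; rewrite ge_min lexx.
  - by rewrite ge_min lexx orbT.
pose P := prodSpace (E n.+1) line.
have s1 (O : set P) : smooth_in O (fun p : P => p.1).
  exact: smooth_in_fst (@smooth_in_id _ _ _).
have s2 (O : set P) : smooth_in O (fun p : P => p.2).
  exact: smooth_in_snd (@smooth_in_id _ _ _).
have sj i : smooth (fun p : P => jface i p.1).
  by apply: smooth_inT; apply: (smooth_comp_on (@smooth_jface n i)).
have [chi [schi chi1 chi0]] := cutoff (@smooth_jface n) (c' := eps / 4) (c := eps / 2) ltac:(lra).
(* The two motions take the two halves of the time. During the second one the first coordinate is 0,
   so the point remains in [jout] whatever the others do. *)
pose c (t : E n.+1) (s : R) : E n.+1 := consc ((1 - smoothstep (2 * s)) * headc t)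
  ((1 - smoothstep (2 * s - 1)) *: (tailc t : 'rV[R]_n) : 'rV[R]_n).
have cj t s : jout eps t -> jout eps (c t s).
  move=> /joutE jt; apply/joutE; rewrite headc_cons tailc_cons.
  have [s2'|s2'] := leP 1 (2 * s).
    by left; rewrite smoothstep_ge1// subrr mul0r.
  rewrite (@smoothstep_le0 _ (2 * s - 1)) ?subr0 ?scale1r; last lra.
  case: jt => [H|H]; [left|by right].
  have := smoothstep_ge0 (2 * s); have := smoothstep_le1 (2 * s).
  move: (smoothstep _) (headc t : R) H => w h H w1 w0.
  by have [h0|h0] := leP h 0; nra.
have c0 t : c t 0 = t.
  by rewrite /c mulr0 !smoothstep_le0 ?subr0 ?mul1r ?scale1r ?consc_eta//; lra.
have c1 t : c t 1 = 0.
  rewrite /c mulr1 !smoothstep_ge1 ?subrr ?mul0r ?scale0r; [|lra|lra].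
  by apply/rowP => j; rewrite !mxE; case: unlift => // k; rewrite mxE.
have sc (O : set P) (s : P -> line) : smooth_in O s -> smooth_in O (fun p => c p.1 (s p)).
  move=> ss; have ss2 : smooth_in O (fun p => 2 * (s p : R) : line).
    by apply: smooth_inM => //; exact: smooth_in_cst.
  apply: smooth_in_consc.
    apply: smooth_inM; last by apply: (smooth_comp_on (@smooth_headc n)).
    by apply: smooth_inB; [exact: smooth_in_cst|exact: smooth_in_step].
  apply: smooth_in_row => j.
  apply: (@smooth_in_ext _ _ _ _ (fun p : P => (1 - smoothstep (2 * (s p : R) - 1)) * headc (n := 0) 
      (\row_k (tailc p.1 : 'rV[R]_n) ord0 j) : line)).
    by move=> p _; rewrite /headc !mxE.
  apply: smooth_inM.
    apply: smooth_inB; first exact: smooth_in_cst.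
    by apply: smooth_in_step; apply: smooth_inB => //; exact: smooth_in_cst.
  apply: (@smooth_in_ext _ _ _ _ (fun p : P => (tailc p.1 : 'rV[R]_n) ord0 j : line)).
    by move=> p _; rewrite /headc !mxE.
  by apply: smooth_in_coord; apply: (smooth_comp_on (@smooth_tailc n)).
(* The factor [chi] makes the contraction fade out away from the box, so that it joins the unmoved b
   on the rest of [out eps]. *)
have [B [sB Bj Bi]] : exists B : P -> Z, [/\
   smooth_in ([set p : P | jout eps p.1] `|`
             ([set p | out eps p.1] `&` [set p | high (@jface n) (eps / 2) p.1])) B,
   (forall p, jout eps p.1 -> B p = b (c p.1 ((p.2 : R) * chi p.1))) &
   (forall p, ([set p : P | out eps p.1] `&` [set p | high (@jface n) (eps / 2) p.1]) p ->
     B p = b p.1)].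
  apply: glue2.
  - by apply: (@dopen_low _ P _ (fun i (p : P) => jface i p.1)).
  - apply: dopenI; last by apply: (@dopen_high _ P _ (fun i (p : P) => jface i p.1)).
    apply: (@dopen_low _ P _ (fun i (p : P) => face i p.1)) => i.
    by apply: smooth_inT; apply: (smooth_comp_on (@smooth_face _ _ i)).
  - apply: (smooth_in_comp sb); last by move=> p /= jp; apply: jout_out; exact: cj.
    by apply: sc; apply: smooth_inM => //; exact: (smooth_comp_on schi).
  - by apply: (smooth_in_comp sb) => // p [].
  - by move=> p jp [op hp]; rewrite chi0// mulr0 c0.
have oj t : out eps t -> jout eps t \/ high (@jface n) (eps / 2) t.
  by move=> _; apply: low_or_high; lra.
have B0 t : out eps t -> B (t, 0) = b t.
  by move=> ot; have [H|H] := oj t ot; [rewrite Bj//= mul0r c0|rewrite Bi].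
apply: (solvable_ext e0 B0).
apply: (transport se e0 _ sf) => [|t ot|eps1 f1 e10 sf1 f1b].
- apply: smooth_in_sub sB => p op; have [H|H] := oj p.1 op; [by left|by right].
- by rewrite B0// fb.
pose m := Num.min eps1 (eps / 4).
have m0 : 0 < m by rewrite lt_min e10; lra.
have me1 : m <= eps1 by rewrite ge_min lexx.
have me4 : m <= eps / 4 by rewrite ge_min lexx orbT.
have sB1 : smooth_in (out m) (fun t : E n.+1 => B (t, 1 : line)).
  apply: (smooth_in_comp sB); first by apply: smooth_in_pair => //; exact: smooth_in_cst.
  move=> t ot; have ot' : out eps t by apply: low_sub ot; lra.
  by have [H|H] := oj t ot'; [left|right].
apply: (compress_top (z0 := b 0) (eps := m)) => //; first by rewrite m0; lra.
  by move=> t ot; apply: f1b; apply: low_sub ot.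
move=> t jt; rewrite Bj/=; last by apply: low_sub jt; lra.
by rewrite chi1 ?mulr1 ?c1//; apply: low_sub jt.
Qed.

End Equivalence.
End Compress.

(** * Path spaces and tame maps *)

Section CellLift.
Variable R : realType.
Local Notation line := (stdSpace R).
Local Notation E n := (stdSpace 'rV[R]_n).

(* The solution along [h] followed by a rel boundary homotopy runs through [h] at a
   different speed on the boundary; interpolating the speeds gives [h] itself. *)
Lemma compress_along n (Z W : diffSpace R) (e : Z -> W) (eps : R)
    (b : E n -> Z) (f : E n -> W) (h : prodSpace (E n) line -> W) :
  smooth e -> compressible n e -> 0 < eps -> smooth_in (out eps) b -> smooth f ->
  smooth_in [set p : prodSpace (E n) line | out eps p.1] h ->
  (forall t (s : R), out eps t -> s <= 0 -> h (t, s) = f t) ->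
  (forall t (s : R), out eps t -> 1 <= s -> h (t, s) = e (b t)) ->
  exists (F : E n -> Z) (k : prodSpace (E n) line -> W) (d : R),
    [/\ [/\ smooth F, smooth k & 0 < d], (forall t, out d t -> F t = b t),
      (forall t (s : R), s <= 0 -> k (t, s) = f t),
      (forall t (s : R), 1 <= s -> k (t, s) = e (F t)) &
      forall t (s : R), out d t -> k (t, s) = h (t, s)].
Proof.
move=> se ce e0 sb sf sh h0 h1.
have sfc := @smooth_face R n.
pose P := prodSpace (E n) line.
have s1 (O : set P) : smooth_in O (fun p : P => p.1).
  exact: smooth_in_fst (@smooth_in_id _ _ _).
have s2 (O : set P) : smooth_in O (fun p : P => p.2).
  exact: smooth_in_snd (@smooth_in_id _ _ _).
pose face' i (p : P) : line := face i p.1.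
have sfc' i : smooth (face' i) by apply: smooth_inT; apply: (smooth_comp_on (sfc i)).
have [chi [schi chi1 chi0]] := cutoff sfc (c' := eps / 4) (c := eps / 2) ltac:(lra).
have [H [sH Ho Hi]] : exists H : P -> W, [/\ smooth H,
    (forall p, out eps p.1 -> H p = h (p.1, smoothstep p.2 * chi p.1)) &
    (forall p, inn (eps / 2) p.1 -> H p = f p.1)].
  apply: (@glue_low _ _ _ _ sfc' _ (eps / 2) eps) => //; first lra.
  - apply: (smooth_in_comp sh) => //; apply: smooth_in_pair => //; apply: smooth_inM.
      exact: smooth_in_step.
    exact: (smooth_comp_on schi).
  - exact: (smooth_comp_on sf).
  - by move=> p ot it; rewrite chi0// mulr0 h0.
have io (t : E n) : out eps t \/ inn (eps / 2) t by apply: low_or_high; lra.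
pose f1 (t : E n) := H (t, 1).
have sf1 : smooth f1.
  apply: smooth_inT; apply: (smooth_comp_on sH); apply: smooth_in_pair => //.
  exact: smooth_in_cst.
have o4 (t : E n) : out (eps / 4) t -> out eps t by apply: low_sub; lra.
have H4 (t : E n) (s : R) : out (eps / 4) t -> H (t, s) = h (t, smoothstep s).
  by move=> ot; rewrite Ho/= ?chi1 ?mulr1//; exact: o4.
have f1b (t : E n) : out (eps / 4) t -> f1 t = e (b t).
  by move=> ot; rewrite /f1 H4// smoothstep_ge1// h1//; exact: o4.
have H1 t s : 1 <= s -> H (t, s) = f1 t.
  move=> s1'; rewrite /f1; have [ot|it] := io t; last by rewrite !Hi.
  by rewrite !Ho /= ?(smoothstep_ge1 s1') ?(smoothstep_ge1 (lexx 1)).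
have sb4 : smooth_in (out (eps / 4)) b by apply: smooth_in_sub sb => t /o4.
have [F [sF [d' [d'0 Fb' [k [sk k0 k1 kr]]]]]] := ce (eps / 4) b f1 ltac:(lra) sb4 sf1 f1b.
pose d := Num.min d' (eps / 4).
have d0 : 0 < d by rewrite lt_min d'0; lra.
have dd' : d <= d' by rewrite ge_min lexx.
have de : d <= eps / 4 by rewrite ge_min lexx orbT.
have od4 (t : E n) : out d t -> out (eps / 4) t by apply: low_sub.
have od' (t : E n) : out d t -> out d' t by apply: low_sub.
have o2 : dopen [set p : P | (p.2 : R) < 2/3] by apply: dopen_ltl; apply: smooth_inT.
have o1 : dopen [set p : P | 1/3 < (p.2 : R)] by apply: dopen_ltr; apply: smooth_inT.
have s3 (O : set P) : smooth_in O (fun p : P => 3 * (p.2 : R) : line).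
  by apply: smooth_inM => //; exact: smooth_in_cst.
have [|q [sq q1 q2]] := glue2 o2 o1
    (f1 := fun p : P => H (p.1, 3 * (p.2 : R))) (f2 := fun p : P => k (p.1, 3 * (p.2 : R) - 2))
    (smooth_comp_on sH (smooth_in_pair (s1 _) (s3 _)))
    (smooth_comp_on sk (smooth_in_pair (s1 _) (smooth_inB (s3 _) (smooth_in_cst _)))).
  by move=> [t s] /= s1' s2'; rewrite H1 ?k0//; lra.
have {}sq : smooth q.
  apply: smooth_inT; apply: smooth_in_sub sq => -[t s] _ /=.
  by have [?|?] := ltP s (2/3); [left|right; lra].
have qd (t : E n) (s : R) : out d t -> q (t, s) = h (t, smoothstep (3 * s)).
  move=> ot; have [?|?] := ltP s (2/3); first by rewrite q1//= H4//; exact: od4.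
  rewrite q2/=; last lra.
  rewrite kr; last exact: od'.
  by rewrite /f1 H4 ?[smoothstep 1]smoothstep_ge1 ?smoothstep_ge1//; [lra|exact: od4].
have [chj [schj chj1 chj0]] := cutoff sfc (c' := d / 4) (c := d / 2) ltac:(lra).
pose th (p : P) : R := (1 - smoothstep (chj p.1)) * smoothstep (3 * (p.2 : R)) +
   smoothstep (chj p.1) * (p.2 : R).
have sth : smooth (th : P -> line).
  have ss (O : set P) : smooth_in O (fun p : P => smoothstep (chj p.1) : line).
    by apply: smooth_in_step; exact: (smooth_comp_on schj).
  apply: smooth_inT; apply: smooth_inD; apply: smooth_inM => //; last exact: smooth_in_step.
  by apply: smooth_inB => //; exact: smooth_in_cst.
have [l [sl lo li]] : exists l : P -> W, [/\ smooth l,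
    (forall p, out d p.1 -> l p = h (p.1, th p)) &
    (forall p, inn (d / 2) p.1 -> l p = q p)].
  apply: (@glue_low _ _ _ _ sfc' _ (d / 2) d) => //; first lra.
  - apply: (smooth_in_comp sh); last by move=> p /= /od4/o4.
    by apply: smooth_in_pair => //; exact: smooth_smooth_in.
  - exact: smooth_smooth_in.
  - move=> [t s] /= ot it; rewrite qd// /th/= chj0// smoothstep_le0// subr0 mul1r.
    by rewrite mul0r addr0.
have iod (t : E n) : out d t \/ inn (d / 2) t by apply: low_or_high; lra.
have odd (t : E n) : out (d / 4) t -> out d t by apply: low_sub; lra.
exists F, l, (d / 4); split.
- by split=> //; lra.
- by move=> t /odd/od'; exact: Fb'.
- move=> t s s0; have [ot|it] := iod t.
    rewrite lo// h0//; first by apply: o4; exact: od4.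
    rewrite /th /= [smoothstep (3 * s)]smoothstep_le0; last lra.
    by rewrite mulr0 add0r mulr_ge0_le0// smoothstep_ge0.
  rewrite li// q1/=; last lra.
  have [ot|it'] := io t; last by rewrite Hi.
  by rewrite Ho//= smoothstep_le0 ?mul0r ?h0//; lra.
- move=> t s s1'; have [ot|it] := iod t.
    rewrite lo// h1//; [|by apply: o4; exact: od4|].
      by rewrite Fb'//; exact: od'.
    rewrite /th /= [smoothstep (3 * s)]smoothstep_ge1; last lra.
    by have := smoothstep_ge0 (chj t); move: (smoothstep _) => w w0; nra.
  by rewrite li// q2/= ?k1//; lra.
- move=> t s ot; rewrite lo//; last exact: odd.
  by rewrite /th/= chj1// smoothstep_ge1// subrr mul0r add0r mul1r.
Qed.

Section PathSpace.
Variable W : diffSpace R.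

(* Functional diffeology, tested on pairs of a plot of the parameter and a plot of
   the time. *)
Definition smooth_path : Type := {g : R -> W | smooth (g : line -> W)}.

Let pplot n (U : set 'rV[R]_n) (p : 'rV[R]_n -> smooth_path) : Prop :=
  open U /\ forall m (V : set 'rV[R]_m) (a : 'rV[R]_m -> 'rV[R]_n) (s : 'rV[R]_m -> R),
    open V -> smooth_on V a -> (forall v, V v -> U (a v)) -> smooth_on V s ->
    plot V (fun v => sval (p (a v)) (s v)).

Let pplot_open n (U : set 'rV[R]_n) p : pplot U p -> open U.
Proof. by case. Qed.

Let pplot_ext n (U : set 'rV[R]_n) p q :
  (forall u, U u -> p u = q u) -> pplot U p -> pplot U q.
Proof.
move=> pq [opU H]; split=> // m V a s oV sa VU ss.
by apply: plot_ext (H m V a s oV sa VU ss) => v /VU/pq ->.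
Qed.

Let pplot_cst n (U : set 'rV[R]_n) x : open U -> pplot U (fun=> x).
Proof.
move=> opU; split=> // m V a s oV sa VU ss.
by case: x => g sg /=; exact: (sg m V s).
Qed.

Let pplot_local n (U : set 'rV[R]_n) p : open U ->
  (forall u, U u -> exists V, [/\ V u, V `<=` U & pplot V p]) -> pplot U p.
Proof.
move=> opU H; split=> // m V a s oV sa VU ss; apply: plot_local => // v Vv.
have [V' [V'a V'U [oV' HV']]] := H _ (VU v Vv).
have oV'' : open (V `&` a @^-1` V').
  rewrite openE => w [Vw V'w]; apply: filterI; first exact: open_nbhs_nbhs.
  by apply: (sa 0%N w Vw); exact: open_nbhs_nbhs.
exists (V `&` a @^-1` V'); split; [by []|exact: subIsetl|].
apply: HV' => //; last 1 first.
- by move=> k; apply: Ck_sub (ss k); exact: subIsetl.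
- by move=> k; apply: Ck_sub (sa k); exact: subIsetl.
- by move=> w [].
Qed.

Let pplot_comp m n (V : set 'rV[R]_m) (U : set 'rV[R]_n) h p :
  pplot U p -> open V -> smooth_on V h -> (forall v, V v -> U (h v)) ->
  pplot V (p \o h).
Proof.
move=> [opU H] oV sh hVU; split=> // l V' a s oV' sa V'V ss.
apply: (H l V' (h \o a) s oV') => //; last by move=> v /V'V/hVU.
by move=> k; apply: Ck_comp (sh k).
Qed.

Definition pathSpace : diffSpace R :=
  DiffSpace pplot_open pplot_ext pplot_cst pplot_local pplot_comp.

Lemma smooth_in_eval (F : diffSpace R) (O : set F) (f : F -> pathSpace) (s : F -> line) :
  smooth_in O f -> smooth_in O s -> smooth_in O (fun x => sval (f x) (s x)).
Proof.
move=> sf ss n U p pU pO; have [opU H] := sf _ _ _ pU pO.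
have [_ sU] := ss _ _ _ pU pO.
by apply: (H n U id (s \o p)) => // k; exact: Ck_id.
Qed.

Lemma slice_smooth (F : diffSpace R) (k : prodSpace F line -> W) (x : F) :
  smooth k -> smooth (fun s : line => k (x, s)).
Proof.
move=> sk; apply: smooth_inT; apply: (smooth_comp_on sk); apply: smooth_in_pair => //.
exact: smooth_in_cst.
Qed.

Definition curry_path (F : diffSpace R) (k : prodSpace F line -> W) (sk : smooth k) (x : F) : pathSpace :=
  exist _ (fun s : R => k (x, s)) (slice_smooth x sk).

Lemma smooth_curry (F : diffSpace R) (k : prodSpace F line -> W) (sk : smooth k) :
  smooth (curry_path sk).
Proof.
move=> n U p pU; split; first exact: plot_open pU.
move=> m V a s oV sa VU ss; apply: (sk m V (fun v => (p (a v), s v))).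
split; last by split.
exact: plot_comp pU oV sa VU.
Qed.

Lemma smooth_path_eq (g h : smooth_path) : (forall s, sval g s = sval h s) -> g = h.
Proof.
case: g h => g sg [h sh] /= /funext gh; subst h; congr exist; exact: Prop_irrelevance.
Qed.

End PathSpace.

(** Points of A over h can be chosen arbitrarily, with no smoothness asked of the choice: plots of a
    subspace are tested in the ambient space, where the choice becomes h. *)
Lemma smooth_in_partial (F G Y : diffSpace R) (O : set F) (A : set G) (h : F -> G)
    (a : subSpace A -> Y) (f : F -> Y) :
  smooth_in O h -> smooth a ->
  (forall x, O x -> exists y : subSpace A, val y = h x /\ f x = a y) -> smooth_in O f.
Proof.
move=> sh sa H n U p pU pO.
have opU := plot_open pU.
(* A point of U provides the default value [y0] of [q]; if U is empty, locality holds vacuously. *)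
have [[u0 Uu0]|noU] := pselect (exists u, U u); last first.
  by apply: plot_local => // u Uu; case: noU; exists u.
have [y0 _] := H _ (pO u0 Uu0).
pose q u : subSpace A := if pselect (O (p u)) is left Ou then sval (cid (H _ Ou)) else y0.
have qE u : U u -> val (q u) = h (p u) /\ f (p u) = a (q u).
  by move=> /pO Ou; rewrite /q; case: pselect => // Ou'; case: cid.
have qU : plot U q by apply: plot_ext (sh _ _ _ pU pO) => u /qE[].
by apply: plot_ext (sa _ _ _ qU) => u /qE[_] /= ->.
Qed.

Definition mkcube n (v : 'rV[R]_n) (H : cube_set R n v) : cube R n := exist _ (v : 'rV[R]_n) (mem_set H).
Definition mkbd n (c : cube R n) (H : boundary R n c) : bdcube R n := exist _ c (mem_set H).

Lemma coord_itv n (c : cube R n) j : 0 <= coord c ord0 j <= 1.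
Proof. exact: (set_valP c). Qed.

Lemma coord_inj n : injective (@coord R n).
Proof. by move=> c d; exact: val_inj. Qed.

Section Snap.
Variables (n : nat) (eps : R) (X : diffSpace R) (a : bdcube R n -> X).
Hypotheses (e0 : 0 < eps <= 4^-1) (ta : eps_tame a eps).

Let snap (x : R) : R := if x <= eps then 0 else if 1 - eps <= x then 1 else x.

Let snap_itv x : 0 <= x <= 1 -> 0 <= snap x <= 1.
Proof. by rewrite /snap; case: ifP => _; [lra|case: ifP => _; lra]. Qed.

Let snapto (i : nat) (t : 'rV[R]_n) : 'rV[R]_n :=
  \row_j (if (j < i)%N then snap (t ord0 j) else t ord0 j).

Let snapto_cube i (t : bdcube R n) : cube_set R n (snapto i (coord (val t))).
Proof.
move=> j; rewrite mxE; case: ifP => _; last exact: coord_itv.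
by apply: snap_itv; exact: coord_itv.
Qed.

Let snapto_bd i (t : bdcube R n) : boundary R n (mkcube (snapto_cube i t)).
Proof.
move: (e0) => e1; have [j H] := set_valP t; exists j; rewrite /coord /= mxE; case: ifP => // _.
rewrite /snap; case: H => ->; [left|right]; first by rewrite ifT//; lra.
by rewrite ifF; [rewrite ifT//; lra|apply/negbTE; rewrite -ltNge; lra].
Qed.

(* Tameness moves one coordinate at a time; both points are moved to a common one
   obtained by rounding the coordinates near 0 and 1. *)
Lemma eps_tame_eq (t s : bdcube R n) :
  (forall j, [\/ coord (val t) ord0 j = coord (val s) ord0 j,
     coord (val t) ord0 j <= eps /\ coord (val s) ord0 j <= eps |
     1 - eps <= coord (val t) ord0 j /\ 1 - eps <= coord (val s) ord0 j]) -> a t = a s.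
Proof.
move=> H; move: (e0) => e1.
pose S i (t : bdcube R n) := mkbd (snapto_bd i t).
have step i (u : bdcube R n) : (i <= n)%N -> a u = a (S i u).
  elim: i => [_|i IH i_n].
    congr a; apply: val_inj; apply: coord_inj; apply/rowP => j.
    by rewrite [in RHS]/coord /= mxE.
  rewrite IH ?(ltnW i_n)//; have [_ tm] := ta.
  pose j : 'I_n := Ordinal i_n.
  have Sj v k : coord (val (S v u)) ord0 k = if (k < v)%N then snap (coord (val u) ord0 k) else coord (val u) ord0 k.
    by rewrite /S /coord /= mxE.
  have neq (k : 'I_n) : k != j -> (k < i.+1)%N = (k < i)%N.
    by move=> kj; rewrite ltnS leq_eqVlt; case: eqP => // ki; case/eqP: kj; apply: val_inj.
  have := coord_itv (val u) j => uj.
  have eqS (b : bool) : snap (coord (val u) ord0 j) = b%:R ->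
      coord (val (S i.+1 u)) = set_coord (coord (val (S i u))) j b%:R.
    move=> sb; apply/rowP => k; rewrite [RHS]mxE !Sj; case: eqP => [->|/eqP kj].
      by rewrite ltnSn.
    by rewrite neq.
  have [ue|ue] := leP (coord (val u) ord0 j) eps.
    apply: (tm j false); last by apply: eqS; rewrite /snap ue.
    by rewrite Sj ltnn /= subr0 ger0_norm; lra.
  have [ue'|ue'] := leP (1 - eps) (coord (val u) ord0 j).
    apply: (tm j true); last by apply: eqS; rewrite /snap leNgt ue /= ue'.
    by rewrite Sj ltnn /= ler0_norm; lra.
  congr a; apply: val_inj; apply: coord_inj; apply/rowP => k; rewrite !Sj.
  have [->|kj] := eqVneq k j; last by rewrite neq.
  by rewrite ltnSn ltnn /snap !leNgt ue ue'.
rewrite (step n t)// (step n s)//; congr a; apply: val_inj; apply: coord_inj.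
apply/rowP => j; rewrite /S /coord /= !mxE ltn_ord.
have := H j; rewrite /coord.
set x := (val (val t) : 'rV[R]_n) ord0 j; set y := (val (val s) : 'rV[R]_n) ord0 j.
rewrite /snap; case=> [->//|[-> ->]//|[x1 y1]].
have -> : (x <= eps) = false by apply/negbTE; rewrite -ltNge; lra.
have -> : (y <= eps) = false by apply/negbTE; rewrite -ltNge; lra.
by rewrite x1 y1.
Qed.
End Snap.

End CellLift.

(** * Lifting over one cell *)

Section Lift.
Variable R : realType.
Local Notation line := (stdSpace R).
Local Notation E n := (stdSpace 'rV[R]_n).

Section PathLift.
Variables (Z W : diffSpace R) (e : Z -> W).

Definition path_start (x : prodSpace Z (pathSpace W)) : W := sval x.2 0.

(** A point of the mapping path space of e, with a pause up to time d. The pause is the room in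
    which [cell_lift] adjusts the path over a new cell. *)
Definition path_lift (d : R) (x : prodSpace Z (pathSpace W)) : Prop :=
  (forall s : R, s <= d -> sval x.2 s = path_start x) /\ (forall s : R, 1 <= s -> sval x.2 s = e x.1).

Lemma path_lift_le d d' x : d' <= d -> path_lift d x -> path_lift d' x.
Proof. by move=> dd [x0 x1]; split=> // s sd; apply: x0; exact: le_trans dd. Qed.

End PathLift.

(* A characteristic map is tame on the boundary only. The spare time between [d']
   and [d] is used to deform [f] to [f \o C], with [C] a collapse that is
   invisible to tame maps on the boundary; [f \o C] extends to all of R^n. *)
Lemma cell_lift n (Z W : diffSpace R) (e : Z -> W) (d' d : R)
    (a : bdcube R n -> prodSpace Z (pathSpace W)) (f : cube R n -> W) :
  smooth e -> compressible n e -> (W -> inhabited Z) -> 0 < d' -> d' < d -> d < 1 ->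
  tame a -> smooth f -> (forall t, path_lift e d (a t)) ->
  (forall t, path_start (a t) = f (val t)) ->
  exists F : cube R n -> prodSpace Z (pathSpace W),
    [/\ smooth F, forall t, path_lift e d' (F t), forall t, path_start (F t) = f t &
      forall t : bdcube R n, F (val t) = a t].
Proof.
move=> se ce inh d'0 dd' d1 ta sf aP af.
have [eps [e0 ta']] : exists eps : R, 0 < eps <= 4^-1 /\ eps_tame a eps.
  have [eps [e0 [sa tm]]] := ta; exists (Num.min eps 4^-1); split.
    by rewrite lt_min ge_min lexx orbT; lra.
  split=> // j b t s ts; apply: (tm j b); apply: le_trans ts _.
  by rewrite ge_min lexx.
have [sa _] := ta'.
have he : 0 < eps <= 2^-1 by lra.
pose C := @collapse R eps he n.
have sC : smooth C by exact: smooth_collapse.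
have CE (t : E n) j : coord (C t) ord0 j = clamp eps ((t : 'rV[R]_n) ord0 j).
  exact: coord_collapse.
have v0 : cube_set R n (0 : 'rV[R]_n) by move=> j; rewrite mxE; lra.
have [z0] := inh (f (mkcube v0)).
have sc0 : smooth (fun _ : line => f (mkcube v0)) by apply: smooth_inT; exact: smooth_in_cst.
pose g0 : pathSpace W := exist _ (fun _ : R => f (mkcube v0)) sc0.
(* Extends a to R^n along the collapse. The pair [(z0, g0)] is a default value away from the
   boundary zone [Ob]. *)
pose ab (t : E n) : prodSpace Z (pathSpace W) :=
  if pselect (boundary R n (C t)) is left H then a (mkbd H) else (z0, g0).
pose Ob := out (n := n) (eps / 2).
have abE (t : E n) : Ob t -> exists y : bdcube R n, val y = C t /\ ab t = a y.
  move=> ot; have H := collapse_boundary he ot.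
  by rewrite /ab; case: pselect => // H'; exists (mkbd H').
have sab : smooth_in Ob ab by apply: smooth_in_partial abE => //; exact: smooth_smooth_in.
pose b (t : E n) : Z := (ab t).1.
have sb : smooth_in Ob b by exact: smooth_in_fst sab.
pose P := prodSpace (E n) line.
have s1 (O : set P) : smooth_in O (fun p : P => p.1).
  exact: smooth_in_fst (@smooth_in_id _ _ _).
have s2 (O : set P) : smooth_in O (fun p : P => p.2).
  exact: smooth_in_snd (@smooth_in_id _ _ _).
(* The boundary path after its pause, with [d, 1] rescaled to [0, 1]. *)
pose h (p : P) : W := sval (ab p.1).2 (d + (1 - d) * p.2).
have sh : smooth_in [set p : P | Ob p.1] h.
  apply: (smooth_in_eval (f := fun p : P => (ab p.1).2) (s := fun p : P => d + (1 - d) * p.2)).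
    apply: (@smooth_in_snd _ _ Z _ _ (fun p : P => ab p.1)).
    by apply: (smooth_in_comp sab).
  apply: smooth_inD; first exact: smooth_in_cst.
  by apply: smooth_inM => //; exact: smooth_in_cst.
pose f' (t : E n) : W := f (C t).
have sf' : smooth f' by exact: smooth_comp sC sf.
have h0 t (s : R) : Ob t -> s <= 0 -> h (t, s) = f' t.
  move=> /abE[y [yC aby]] s0; rewrite /h /= aby.
  rewrite (proj1 (aP y)) ?af ?yC//; nra.
have h1 t (s : R) : Ob t -> 1 <= s -> h (t, s) = e (b t).
  move=> /abE[y [yC aby]] s1'; rewrite /h /b /= aby.
  rewrite (proj2 (aP y))//; nra.
have e20 : 0 < eps / 2 by lra.
have [F [k [eta [[sF sk eta0] Fb k0 k1 kh]]]] := compress_along se ce e20 sb sf' sh h0 h1.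
pose Q := prodSpace (cube R n) line.
have q1 (O : set Q) : smooth_in O (fun p : Q => p.1).
  exact: smooth_in_fst (@smooth_in_id _ _ _).
have q2 (O : set Q) : smooth_in O (fun p : Q => p.2).
  exact: smooth_in_snd (@smooth_in_id _ _ _).
have Lc (p : Q) : cube_set R n ((1 - smoothstep p.2) *: coord p.1 +
    smoothstep p.2 *: coord (C (coord p.1)) : 'rV[R]_n).
  move=> j; rewrite 3!mxE.
  have := smoothstep_ge0 p.2; have := smoothstep_le1 p.2.
  have := coord_itv p.1 j; have := coord_itv (C (coord p.1)) j.
  by move: (smoothstep _) (coord _ _ _) (coord _ _ _) => w x y *; nra.
pose L (p : Q) : cube R n := mkcube (Lc p).
have sL : smooth L.
  apply: smooth_inT; apply: smooth_in_sub_intro.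
  apply: (@smooth_interp R Q setT n (fun p => coord p.1) (fun p => coord (C (coord p.1))) (fun p => smoothstep p.2)).
  - exact: (smooth_comp_on (@smooth_coord R n)).
  - apply: (smooth_comp_on (@smooth_coord R n)); apply: (smooth_comp_on sC).
    exact: (smooth_comp_on (@smooth_coord R n)).
  - exact: smooth_in_step.
have L0 t (s : R) : s <= 0 -> L (t, s) = t.
  move=> s0; apply: coord_inj; rewrite [LHS]/coord /= smoothstep_le0//.
  by rewrite subr0 scale1r scale0r addr0.
have L1 t (s : R) : 1 <= s -> L (t, s) = C (coord t).
  move=> s0; apply: coord_inj; rewrite [LHS]/coord /= smoothstep_ge1//.
  by rewrite subrr scale1r scale0r add0r.
(* [r] rescales [d', m], where f is deformed along L, and [c] rescales [d, 1], where k runs. Between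
   m and d both are stationary at the composite of f with C, which gives the open overlap. *)
pose r (s : R) : R := (s - d') / ((d - d') / 2).
pose m := (d + d') / 2.
have r0 s : s <= d' -> r s <= 0.
  by move=> sd; rewrite /r pmulr_lle0 ?invr_gt0; lra.
have r1 s : m <= s -> 1 <= r s.
  by move=> sd; rewrite /r ler_pdivlMr; [move: sd; rewrite /m; lra|lra].
pose c (s : R) : R := (s - d) / (1 - d).
have c0 s : s <= d -> c s <= 0.
  by move=> sd; rewrite /c pmulr_lle0 ?invr_gt0; lra.
have c1 s : 1 <= s -> 1 <= c s.
  by move=> sd; rewrite /c ler_pdivlMr; lra.
have cK s : d + (1 - d) * c s = s.
  by rewrite /c mulrC divfK; [lra|rewrite gt_eqF; lra].
have sr (O : set Q) : smooth_in O (fun p : Q => r p.2 : line).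
  apply: smooth_inM; last exact: smooth_in_cst.
  by apply: smooth_inB => //; exact: smooth_in_cst.
have scc (O : set Q) : smooth_in O (fun p : Q => c p.2 : line).
  apply: smooth_inM; last exact: smooth_in_cst.
  by apply: smooth_inB => //; exact: smooth_in_cst.
have sfr (O : set Q) : smooth_in O (fun p : Q => f (L (p.1, r p.2))).
  by apply: (smooth_comp_on sf); apply: (smooth_comp_on sL); exact: smooth_in_pair.
have skc (O : set Q) : smooth_in O (fun p : Q => k (coord p.1, c p.2)).
  apply: (smooth_comp_on sk); apply: smooth_in_pair => //.
  exact: (smooth_comp_on (@smooth_coord R n)).
have oL : dopen [set p : Q | (p.2 : R) < d] by apply: dopen_ltl; apply: smooth_inT.
have oR : dopen [set p : Q | m < (p.2 : R)] by apply: dopen_ltr; apply: smooth_inT.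
have [|q [sq qL qR]] := glue2 oL oR (sfr _) (skc _).
  move=> [t s] /= sd sm; rewrite L1; last by apply: r1; exact: ltW.
  by rewrite k0//; apply: c0; exact: ltW.
have {}sq : smooth q.
  apply: smooth_inT; apply: smooth_in_sub sq => -[t s] _ /=.
  by have [?|?] := ltP s d; [left|right; rewrite /m; lra].
exists (fun t => (F (coord t), curry_path sq t) : prodSpace Z (pathSpace W)).
have startE t : path_start ((F (coord t), curry_path sq t) : prodSpace Z (pathSpace W)) = f t.
  by rewrite /path_start /= qL/= ?L0//; [apply: r0; lra|lra].
split=> //.
- apply: smooth_inT; apply: smooth_in_pair; last exact: smooth_smooth_in (smooth_curry sq).
  by apply: (smooth_comp_on sF); exact: smooth_smooth_in.
- move=> t; split=> s sd; rewrite ?startE /=.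
    by rewrite qL/= ?L0//; [exact: r0|lra].
  by rewrite qR/= ?k1//; [exact: c1|rewrite /m; lra].
- move=> t; have ot c' : 0 < c' -> out c' (coord (val t)).
    by move=> ?; apply: coord_boundary => //; exact: (set_valP t).
  have abt : ab (coord (val t)) = a t.
    have [y [yC ->]] := abE _ (ot _ e20); apply: (eps_tame_eq e0 ta') => j.
    rewrite yC CE; have [ue|ue] := leP (coord (val t) ord0 j) eps.
      by apply: Or32; split=> //; have := clamp_le he ue; lra.
    have [ue'|ue'] := leP (1 - eps) (coord (val t) ord0 j).
      by apply: Or33; split=> //; have := clamp_ge he ue'; lra.
    by apply: Or31; rewrite clamp_id//; lra.
  have Fz : F (coord (val t)) = (a t).1 by rewrite Fb ?/b ?abt//; exact: ot.
  have Lbd s : boundary R n (L (val t, s)).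
    have [j H] := set_valP t; exists j.
    rewrite [coord (L _)]/coord /= 3!mxE CE.
    case: H => ->; [left; rewrite clamp_0|right; rewrite clamp_1] => //; lra.
  (* On the way to the collapse a coordinate within eps of 0 or 1 stays within eps of it, and every
     other coordinate is fixed, so tameness makes a blind to the motion. *)
  have aL s : a (mkbd (Lbd s)) = a t.
    apply: (eps_tame_eq e0 ta') => j /=.
    have -> : coord (L (val t, s)) ord0 j = (1 - smoothstep s) * coord (val t) ord0 j +
        smoothstep s * coord (C (coord (val t))) ord0 j.
      by rewrite [coord (L _)]/coord /= 3!mxE.
    rewrite CE; have := smoothstep_ge0 s; have := smoothstep_le1 s.
    move: (smoothstep s) => w w1 w0.
    have [ue|ue] := leP (coord (val t) ord0 j) eps.
      by apply: Or32; split=> //; have := clamp_le he ue; move: (clamp _ _) => x ?; nra.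
    have [ue'|ue'] := leP (1 - eps) (coord (val t) ord0 j).
      by apply: Or33; split=> //; have := clamp_ge he ue'; move: (clamp _ _) => x ?; nra.
    by apply: Or31; rewrite clamp_id//; lra.
  rewrite [RHS]surjective_pairing -Fz; congr pair; apply: smooth_path_eq => s /=.
  have [sd|sd] := ltP s d.
    rewrite qL//= -[L _]/(val (mkbd (Lbd (r s)))) -af aL.
    by have [-> //] := aP t; exact: ltW.
  rewrite qR/=; last by rewrite /m; lra.
  by rewrite kh; [rewrite /h/= abt cK|exact: ot].
Qed.

End Lift.

(** * Right homotopy inverses *)

Section RightInverse.
Variable R : realType.
Local Notation line := (stdSpace R).
Local Notation E n := (stdSpace 'rV[R]_n).

(* With [K] from the identity to [phi \o g], extend [b] to [y] so that
   [phi \o f ~ y ~ phi \o g \o y]; near the boundary this loop runs back and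
   forth along [K] and can be contracted. Compressing it gives a homotopy from
   [f] to [g \o y]. *)
Lemma compressible_right_inverse n (Z W : diffSpace R) (phi : Z -> W) (g : W -> Z)
    (K : prodSpace W line -> W) :
  smooth phi -> smooth g -> smooth K -> (forall w (s : R), s <= 0 -> K (w, s) = w) ->
  (forall w (s : R), 1 <= s -> K (w, s) = phi (g w)) ->
  compressible n.+1 phi -> compressible n g.
Proof.
move=> sphi sg sK K0 K1 cphi eps b f e0 sb sf fb.
have sfc := @smooth_face R n.
pose P := prodSpace (E n) line.
have s1 (O : set P) : smooth_in O (fun p : P => p.1).
  exact: smooth_in_fst (@smooth_in_id _ _ _).
have s2 (O : set P) : smooth_in O (fun p : P => p.2).
  exact: smooth_in_snd (@smooth_in_id _ _ _).
pose face' i (p : P) : line := face i p.1.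
have sfc' i : smooth (face' i) by apply: smooth_inT; apply: (smooth_comp_on (sfc i)).
have [chi [schi chi1 chi0]] := cutoff sfc (c' := eps / 4) (c := eps / 2) ltac:(lra).
have sKb (O : set P) (s : P -> line) : (forall p, O p -> out eps p.1) -> smooth_in O s ->
    smooth_in O (fun p => K (b p.1, s p)).
  move=> oO ss; apply: (smooth_comp_on sK); apply: smooth_in_pair => //.
  by apply: (smooth_in_comp sb).
have [Y [sY Yo Yi]] : exists Y : P -> W, [/\ smooth Y,
    (forall p, out eps p.1 -> Y p = K (b p.1, 1 - smoothstep p.2 * chi p.1)) &
    (forall p, inn (eps / 2) p.1 -> Y p = phi (f p.1))].
  apply: (@glue_low _ _ _ _ sfc' _ (eps / 2) eps) => //; first lra.
  - apply: sKb => //; apply: smooth_inB; first exact: smooth_in_cst.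
    by apply: smooth_inM; [exact: smooth_in_step|exact: (smooth_comp_on schi)].
  - by apply: (smooth_comp_on sphi); exact: (smooth_comp_on sf).
  - by move=> p ot it; rewrite chi0// mulr0 subr0 K1// fb.
have io (t : E n) : out eps t \/ inn (eps / 2) t by apply: low_or_high; lra.
have o4 (t : E n) : out (eps / 4) t -> out eps t by apply: low_sub; lra.
have o16 (t : E n) : out (eps / 16) t -> out (eps / 4) t by apply: low_sub; lra.
pose y (t : E n) := Y (t, 1).
have sy : smooth y.
  apply: smooth_inT; apply: (smooth_comp_on sY); apply: smooth_in_pair => //.
  exact: smooth_in_cst.
have Y0 t (s : R) : s <= 0 -> Y (t, s) = phi (f t).
  move=> s0; have [ot|it] := io t; last by rewrite Yi.
  by rewrite Yo//= smoothstep_le0// mul0r subr0 K1// fb.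
have Y1 t (s : R) : 1 <= s -> Y (t, s) = y t.
  move=> s0; rewrite /y; have [ot|it] := io t; last by rewrite !Yi.
  by rewrite !Yo /= ?(smoothstep_ge1 s0) ?(smoothstep_ge1 (lexx 1)).
have Y4 (t : E n) (s : R) : out (eps / 4) t -> Y (t, s) = K (b t, 1 - smoothstep s).
  by move=> ot; rewrite Yo/= ?chi1 ?mulr1//; exact: o4.
have y4 (t : E n) : out (eps / 4) t -> y t = b t.
  by move=> ot; rewrite /y Y4// K0// smoothstep_ge1// subrr.
have s3 (O : set P) : smooth_in O (fun p : P => 3 * (p.2 : R) : line).
  by apply: smooth_inM => //; exact: smooth_in_cst.
have s3' (O : set P) : smooth_in O (fun p : P => smoothstep (3 * (p.2 : R) - 2) : line).
  by apply: smooth_in_step; apply: smooth_inB => //; exact: smooth_in_cst.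
have o2 : dopen [set p : P | (p.2 : R) < 2/3] by apply: dopen_ltl; apply: smooth_inT.
have o1 : dopen [set p : P | 1/3 < (p.2 : R)] by apply: dopen_ltr; apply: smooth_inT.
have [|q [sq q1 q2]] := glue2 o2 o1
    (f1 := fun p : P => Y (p.1, 3 * (p.2 : R)))
    (f2 := fun p : P => K (y p.1, smoothstep (3 * (p.2 : R) - 2)))
    (smooth_comp_on sY (smooth_in_pair (s1 _) (s3 _)))
    (smooth_comp_on sK (smooth_in_pair (smooth_comp_on sy (s1 _)) (s3' _))).
  by move=> [t s] /= s1' s2'; rewrite Y1 ?K0// ?smoothstep_le0//; lra.
have {}sq : smooth q.
  apply: smooth_inT; apply: smooth_in_sub sq => -[t s] _ /=.
  by have [?|?] := ltP s (2/3); [left|right; lra].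
have q4 (t : E n) (s : R) : out (eps / 4) t ->
    q (t, s) = K (b t, 1 - (smoothstep (3 * s) - smoothstep (3 * s - 2))).
  move=> ot; have [?|?] := ltP s (2/3).
    rewrite q1//= Y4//; congr (K (_, _)).
    by rewrite (@smoothstep_le0 _ (3 * s - 2)); lra.
  rewrite q2/=; last lra.
  rewrite y4//; congr (K (_, _)); rewrite (@smoothstep_ge1 _ (3 * s)); lra.
(* Near the boundary the time of K in q goes from 1 to 0 and back. The factor [1 - chj] shrinks this
   excursion to the constant time 1 on [out (eps / 16)]. *)
have [chj [schj chj1 chj0]] := cutoff sfc (c' := eps / 16) (c := eps / 8) ltac:(lra).
have [l [sl lo li]] : exists l : P -> W, [/\ smooth l,
    (forall p, out (eps / 4) p.1 -> l p =
       K (b p.1, 1 - (1 - (chj p.1 : R)) * (smoothstep (3 * (p.2 : R)) - smoothstep (3 * (p.2 : R) - 2)))) &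
    (forall p, inn (eps / 8) p.1 -> l p = q p)].
  apply: (@glue_low _ _ _ _ sfc' _ (eps / 8) (eps / 4)) => //; first lra.
  - apply: sKb => [p /o4//|]; apply: smooth_inB; first exact: smooth_in_cst.
    apply: smooth_inM; last by apply: smooth_inB => //; exact: smooth_in_step.
    by apply: smooth_inB; [exact: smooth_in_cst|exact: (smooth_comp_on schj)].
  - exact: smooth_smooth_in.
  - by move=> [t s] /= ot it; rewrite q4// chj0// subr0 mul1r.
have iod (t : E n) : out (eps / 4) t \/ inn (eps / 8) t by apply: low_or_high; lra.
have l0 t (s : R) : s <= 0 -> l (t, s) = phi (f t).
  move=> s0; have [ot|it] := iod t.
    by rewrite lo//= !smoothstep_le0 ?subrr ?mulr0 ?subr0 ?K1 ?fb//; [exact: o4|lra|lra].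
  by rewrite li// q1/= ?Y0//; lra.
have l1 t (s : R) : 1 <= s -> l (t, s) = phi (g (y t)).
  move=> s1'; have [ot|it] := iod t.
    by rewrite lo//= !smoothstep_ge1 ?subrr ?mulr0 ?subr0 ?K1 ?y4//; lra.
  by rewrite li// q2/= ?K1// ?smoothstep_ge1//; lra.
have l16 (t : E n) (s : R) : out (eps / 16) t -> l (t, s) = phi (f t).
  move=> ot; have ot4 := o16 t ot; rewrite lo//= chj1// subrr mul0r subr0 K1//.
  by rewrite fb//; exact: o4.
pose m := Num.min (1/3) (eps / 16).
have m0 : 0 < m by rewrite lt_min; apply/andP; split; lra.
have m3 : m <= 1/3 by rewrite ge_min lexx.
have m16 : m <= eps / 16 by rewrite ge_min lexx orbT.
have om16 (t : E n) : out m t -> out (eps / 16) t by apply: low_sub.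
have otop : dopen [set t : E n.+1 | 1 - (headc t : R) < m].
  apply: (@dopen_ltl _ (E n.+1) (fun t => 1 - (headc t : R))).
  apply: smooth_inT; apply: smooth_inB; first exact: smooth_in_cst.
  exact: smooth_smooth_in (@smooth_headc R n).
have [|B [sB Bj Bt]] := glue2 (@dopen_low _ _ _ _ (@smooth_jface R n) m) otop
    (f1 := fun t : E n.+1 => f (tailc t)) (f2 := fun t : E n.+1 => g (y (tailc t)))
    (smooth_comp_on sf (smooth_smooth_in (@smooth_tailc R n)))
    (smooth_comp_on sg (smooth_comp_on sy (smooth_smooth_in (@smooth_tailc R n)))).
  move=> t /joutE[H /= H'|ot _]; first by exfalso; lra.
  rewrite y4; last by apply: o16; exact: om16.
  by rewrite fb//; apply: o4; apply: o16; exact: om16.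
(* The homotopy occupies the middle third of the first coordinate; as m <= 1/3, it is stationary
   within m of the bottom and top faces. *)
pose f' (t : E n.+1) : W := l (tailc t, 3 * (headc t : R) - 1).
have sf' : smooth f'.
  apply: smooth_inT; apply: (smooth_comp_on sl); apply: smooth_in_pair.
    exact: smooth_smooth_in (@smooth_tailc R n).
  apply: smooth_inB; last exact: smooth_in_cst.
  apply: smooth_inM; first exact: smooth_in_cst.
  exact: smooth_smooth_in (@smooth_headc R n).
have sB' : smooth_in (out m) B.
  by apply: smooth_in_sub sB => t /outSE[H|H]; [right|left].
have f'B t : out m t -> f' t = phi (B t).
  move=> /outSE[H|H]; first by rewrite Bt// /f' l1//; lra.
  rewrite Bj// /f'; move/joutE: H => [H|H]; first by rewrite l0//; lra.
  by rewrite l16//; exact: om16.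
(* Read along the first coordinate, F is the homotopy from f to [g \o y], because it agrees with B
   near the bottom and the top. *)
have [F [sF [m' [m'0 FB _]]]] := cphi m B f' m0 sB' sf' f'B.
exists y; split=> //; exists (Num.min m m').
have n0 : 0 < Num.min m m' by rewrite lt_min m0.
have nm : Num.min m m' <= m by rewrite ge_min lexx.
have nm' : Num.min m m' <= m' by rewrite ge_min lexx orbT.
split=> //.
  by move=> t ot; apply: y4; apply: o16; apply: om16; apply: low_sub ot.
exists (fun p : P => F (consc p.2 p.1)); split.
- by apply: smooth_inT; apply: (smooth_comp_on sF); exact: smooth_in_consc.
- move=> t s s0; have jt c : 0 < c -> jout c (consc s t).
    by move=> c0; apply/joutE; left; rewrite headc_cons; lra.
  by rewrite FB ?Bj ?tailc_cons//; [exact: jt|apply: jout_out; exact: jt].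
- move=> t s s1' /=; rewrite FB; last by apply/outSE; left; rewrite headc_cons; lra.
  by rewrite Bt/= ?tailc_cons// headc_cons; lra.
- move=> t s ot; have jt c : Num.min m m' <= c -> jout c (consc s t).
    by move=> c0; apply/joutE; right; rewrite tailc_cons; apply: low_sub ot.
  by rewrite FB ?Bj ?tailc_cons//; [exact: jt|apply: jout_out; exact: jt].
Qed.

End RightInverse.

(** * Smooth CW complexes *)

Section Codiscrete.
Variables (R : realType) (T : Type).

Let cplot n (U : set 'rV[R]_n) (p : 'rV[R]_n -> T) : Prop := open U.

Let cplot_open n (U : set 'rV[R]_n) p : cplot U p -> open U. Proof. by []. Qed.
Let cplot_ext n (U : set 'rV[R]_n) p q :
  (forall u, U u -> p u = q u) -> cplot U p -> cplot U q.
Proof. by []. Qed.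
Let cplot_cst n (U : set 'rV[R]_n) x : open U -> cplot U (fun=> x).
Proof. by []. Qed.
Let cplot_local n (U : set 'rV[R]_n) p : open U ->
  (forall u, U u -> exists V, [/\ V u, V `<=` U & cplot V p]) -> cplot U p.
Proof. by []. Qed.
Let cplot_comp m n (V : set 'rV[R]_m) (U : set 'rV[R]_n) h p :
  cplot U p -> open V -> smooth_on V h -> (forall v, V v -> U (h v)) ->
  cplot V (p \o h).
Proof. by []. Qed.

(* All maps into a codiscrete space are smooth, so the universal properties of
   pushouts and colimits determine the underlying sets. *)
Definition codiscrete : diffSpace R :=
  DiffSpace cplot_open cplot_ext cplot_cst cplot_local cplot_comp.

Lemma smooth_codiscrete (X : diffSpace R) (f : X -> codiscrete) : smooth f.
Proof. by move=> n U p /plot_open. Qed.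
End Codiscrete.

Section CWFacts.
Variable R : realType.

Lemma smooth_coprod (I : Type) (F : I -> diffSpace R) (Y : diffSpace R)
    (f : forall i, F i -> Y) : (forall i, smooth (f i)) ->
  smooth (fun s : coprodSpace F => f (projT1 s) (projT2 s)).
Proof.
move=> sf n U p [opU H]; apply: plot_local => // u Uu.
have [V [i [q [Vu qV pq]]]] := H u Uu; exists (U `&` V).
have oUV : open (U `&` V) by apply: openI => //; exact: plot_open qV.
split; [by []|exact: subIsetl|].
apply: (@plot_ext _ _ _ _ (f i \o q)) => [v [_ /pq /= ->]//|].
by apply: plot_restr (sf _ _ _ _ qV) oUV _ => v [].
Qed.

Lemma smooth_coprod_in (I : Type) (F : I -> diffSpace R) (i : I) :
  smooth (existT (fun i => F i) i : F i -> coprodSpace F).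
Proof.
move=> n U p pU; split; first exact: plot_open pU.
by move=> u Uu; exists U, i, p; split.
Qed.

Variables (K : diffSpace R) (C : cwStructure K).
Lemma smooth_into n : smooth (@cw_into _ _ C n).
Proof. by have [] := cw_colimit C. Qed.
Lemma into_inc n (x : cw_skel C n) : cw_into (cw_inc x) = cw_into x.
Proof. by have [] := cw_colimit C. Qed.
Lemma smooth_attach n (l : cw_cell C n) : smooth (@cw_attach _ _ C n l).
Proof.
have [[sf _] _ _ _] := cw_pushout C n.
exact: smooth_comp (@smooth_coprod_in _ (fun _ => bdcube R n) l) sf.
Qed.
Lemma smooth_char n (l : cw_cell C n) : smooth (@cw_char _ _ C n l).
Proof.
have [_ [_ sj] _ _] := cw_pushout C n.
exact: smooth_comp (@smooth_coprod_in _ (fun _ => cube R n) l) sj.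
Qed.
Lemma char_bd n (l : cw_cell C n) (t : bdcube R n) :
  cw_char l (val t) = cw_inc (cw_attach l t).
Proof. by have [_ _ H _] := cw_pushout C n; have := H (existT _ l t). Qed.

Lemma skel_map n (Z : diffSpace R) (u : cw_skel C n -> Z) (v : cw_cell C n -> cube R n -> Z) :
  smooth u -> (forall l, smooth (v l)) -> (forall l t, u (cw_attach l t) = v l (val t)) ->
  exists h : cw_skel C n.+1 -> Z,
    [/\ smooth h, forall y, h (cw_inc y) = u y & forall l t, h (cw_char l t) = v l t].
Proof.
move=> su sv uv; have [_ _ _ H] := cw_pushout C n.
have [|h [[sh h1 h2] _]] := H Z u _ su (smooth_coprod sv); first by move=> [l t] /=.
by exists h; split=> // l t; have := h2 (existT _ l t).
Qed.

(** The indicator of the interior of the cell l vanishes on all boundaries, hence descends to the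
    pushout, and there it tells l from other cells. [char_not_inc] uses the interiors of all n-cells
    at once. *)
Lemma char_inj_cell n (l l' : cw_cell C n) (t t' : cube R n) :
  ~ boundary R n t -> cw_char l t = cw_char l' t' -> l = l'.
Proof.
move=> bt E.
have [|h [_ _ hc]] := @skel_map n (codiscrete R Prop) (fun=> False)
    (fun m s => l = m /\ ~ boundary R n s) (@smooth_codiscrete _ _ _ _)
    (fun _ => @smooth_codiscrete _ _ _ _).
  by move=> m s; apply/propext; split=> // -[_ []]; exact: (set_valP s).
by have [] : l = l' /\ ~ boundary R n t' by rewrite -hc -E hc.
Qed.

Lemma char_not_inc n (l : cw_cell C n) (t : cube R n) (y : cw_skel C n) :
  ~ boundary R n t -> cw_char l t <> cw_inc y.
Proof.
move=> bt E.
have [|h [_ hi hc]] := @skel_map n (codiscrete R Prop) (fun=> False)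
    (fun m s => ~ boundary R n s) (@smooth_codiscrete _ _ _ _)
    (fun _ => @smooth_codiscrete _ _ _ _).
  by move=> m s; apply/propext; split=> // -[]; exact: (set_valP s).
by rewrite -(hi y) -E hc.
Qed.

(** By uniqueness in the universal property: the constant [True] and the indicator of the points
    reached solve the same problem, hence coincide. [colimit_cover] rests on the same argument. *)
Lemma skel_cover n (x : cw_skel C n.+1) :
  (exists y, x = cw_inc y) \/ (exists l t, ~ boundary R n t /\ x = cw_char l t).
Proof.
pose u (x : cw_skel C n.+1) := (exists y, x = cw_inc y) \/ (exists l t, x = cw_char l t).
have [_ _ _ H] := cw_pushout C n.
have [h [_ hu]] := H (codiscrete R Prop) (fun=> True) (fun=> True)
  (@smooth_codiscrete _ _ _ _) (@smooth_codiscrete _ _ _ _) (fun=> erefl).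
have h1 : h = (fun=> True) by apply: hu; split=> //; exact: smooth_codiscrete.
have h2 : h = u.
  apply: hu; split; first exact: smooth_codiscrete.
    by move=> y; apply/propext; split=> // _; left; exists y.
  by move=> [l t]; apply/propext; split=> // _; right; exists l, t.
have : u x by rewrite -h2 h1.
case=> [?|[l [t ->]]]; first by left.
have [bt|bt] := pselect (boundary R n t); last by right; exists l, t.
by left; exists (cw_attach l (mkbd bt)); rewrite -char_bd.
Qed.

Lemma colimit_cover (x : K) : exists n (y : cw_skel C n), x = cw_into y.
Proof.
pose u (x : K) := exists n (y : cw_skel C n), x = cw_into y.
have [_ _ _ H] := cw_colimit C.
have [h [_ hu]] := H (codiscrete R Prop) (fun _ _ => True)
  (fun _ => @smooth_codiscrete _ _ _ _) (fun _ _ => erefl).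
have h1 : h = (fun=> True) by apply: hu; split=> //; exact: smooth_codiscrete.
have h2 : h = u.
  apply: hu; split; first exact: smooth_codiscrete.
  by move=> k y; apply/propext; split=> // _; exists k, y.
by rewrite -/(u x) -h2 h1.
Qed.

Fixpoint incs m k (x : cw_skel C k) : cw_skel C (m + k) :=
  if m is m'.+1 then cw_inc (incs m' x) else x.

Lemma into_incs m k (x : cw_skel C k) : cw_into (incs m x) = cw_into x.
Proof. by elim: m => //= m IH; rewrite into_inc. Qed.

Lemma incs_inj m k : injective (@incs m k).
Proof. by elim: m => //= m IH x y /cw_inc_inj/IH. Qed.

Let tot := {k & cw_skel C k}.
Let sinc (s : tot) : tot := existT _ (projT1 s).+1 (cw_inc (projT2 s)).

(** Stated between dependent pairs because the two skeleta have different, though equal, indices. *)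
Let incs_inc m k (x : cw_skel C k) :
  existT _ (m + k.+1)%N (incs m (cw_inc x)) = existT _ (m.+1 + k)%N (incs m.+1 x) :> tot.
Proof. by elim: m => //= m /(congr1 sinc). Qed.

(** The property of becoming equal to x in some later skeleton is compatible with the inclusions, so
    it descends to the colimit and can be evaluated at the common image of x and y. *)
Lemma into_inj k : injective (@cw_into _ _ C k).
Proof.
move=> x y xy.
pose g j (z : cw_skel C j) := exists a b,
  existT _ (a + k)%N (incs a x) = existT _ (b + j)%N (incs b z) :> tot.
have gg j z : g j.+1 (cw_inc z) = g j z.
  apply/propext; split=> -[a [b E]].
    by exists a, b.+1; rewrite E incs_inc.
  by exists a.+1, b; rewrite incs_inc; move: E => /(congr1 sinc).
have [_ _ _ H] := cw_colimit C.
have [h [[_ hg] _]] := H (codiscrete R Prop) g (fun _ => @smooth_codiscrete _ _ _ _) gg.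
have : g k y by rewrite -hg -xy hg; exists 0%N, 0%N.
move=> [a [b E]]; have := congr1 (@projT1 _ _) E => /= /eqP.
rewrite eqn_add2r => /eqP ab; subst b.
by apply: (@incs_inj a); exact: (Eqdep_dec.inj_pair2_eq_dec _ PeanoNat.Nat.eq_dec _ _ _ _ E).
Qed.

Lemma skel_point k (x : cw_skel C k) : exists n (l : cw_cell C n) t,
  ~ boundary R n t /\ cw_into x = cw_into (cw_char l t).
Proof.
elim: k x => [x|k IH x]; first by case: (cw_skel0 x).
have [[y ->]|[l [t [bt ->]]]] := skel_cover x; last by exists k, l, t.
by rewrite into_inc; exact: IH.
Qed.

(** If the dimensions differ, the point of the lower cell already lies in the skeleton to which the
    higher cell is attached, against [char_not_inc]. *)
Lemma cells_disjoint n n' (l : cw_cell C n) (l' : cw_cell C n') t t' :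
  ~ boundary R n t -> ~ boundary R n' t' ->
  cw_into (cw_char l t) = cw_into (cw_char l' t') ->
  existT _ n l = existT (@cw_cell _ _ C) n' l'.
Proof.
wlog nn : n n' l l' t t' / (n <= n')%N.
  move=> IH bt bt' E; have [nn|nn] := leqP n n'; first exact: (IH _ _ _ _ t t').
  by apply/esym; apply: (IH _ _ _ _ t' t) => //; exact: ltnW.
move=> bt bt' E; move: nn; rewrite leq_eqVlt => /predU1P[nn|nn].
  by subst n'; congr existT; apply: char_inj_cell bt _; exact: into_inj E.
have [m nm] : exists m, n' = (m + n.+1)%N by exists (n' - n.+1)%N; rewrite subnK.
subst n'; exfalso.
apply: (@char_not_inc _ l' t' (incs m (cw_char l t)) bt').
by apply: into_inj; rewrite into_inc into_incs.
Qed.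

Lemma mid_cube n : cube_set R n (const_mx 2^-1 : 'rV[R]_n).
Proof. by move=> j; rewrite mxE; lra. Qed.

(** [cw_skel k] holds the cells of dimension below k. If it were everything while k <= n, the centre
    of an n-cell would come from [cw_skel n]. *)
Lemma dim_cell N n (l : cw_cell C n) : cw_dim_lt C N -> (n < N)%N.
Proof.
move=> [k kN [_ [g [_ _ gK]]]]; rewrite ltnNge; apply/negP => Nn.
have [m nm] : exists m, n = (m + k)%N by exists (n - k)%N; rewrite subnK//; exact: leq_trans Nn.
subst n; pose c := mkcube (@mid_cube (m + k)).
have bc : ~ boundary R _ c by case=> j; rewrite /coord /= mxE => -[]; lra.
apply: (@char_not_inc _ l c (incs m (g (cw_into (cw_char l c)))) bc).
by apply: into_inj; rewrite into_inc into_incs gK.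
Qed.

(** What relative lifting asks of B. It holds for the empty set too, which gives the absolute
    case. *)
Definition saturated (B : set K) := forall n (l : cw_cell C n),
  (forall t, B (cw_into (cw_char l t))) \/
  (forall t, ~ boundary R n t -> ~ B (cw_into (cw_char l t))).

End CWFacts.

Section Subcomplex.
Variables (R : realType) (K : diffSpace R) (C : cwStructure K) (B : set K)
  (D : cwStructure (subSpace B)).
Hypothesis sub : is_subcomplex C D.

(** A point of B in the interior of a cell of C is interior to a cell of D, whose characteristic map
    is that of a cell of C. Disjointness of open cells identifies the two, so the whole closed cell
    lies in B. *)
Lemma subcomplex_saturated : saturated C B.
Proof.
move=> n l; have [[t [bt Bt]]|H] := pselect (exists t, ~ boundary R n t /\ B (cw_into (cw_char l t))).
  left; pose b : subSpace B := exist _ (cw_into (cw_char l t)) (mem_set Bt).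
  have [k [y yb]] := colimit_cover D b.
  have [n1 [l1 [t1 [bt1 E1]]]] := skel_point y.
  have [m1 Em] := sub l1.
  have E : cw_into (cw_char l t) = cw_into (cw_char m1 t1) by rewrite -Em -E1 -yb.
  have := cells_disjoint bt bt1 E.
  pose P (s : {n & cw_cell C n}) := forall t, B (cw_into (cw_char (projT2 s) t)).
  move=> Es; rewrite -[forall t, _]/(P (existT _ n l)) Es => s /=.
  by rewrite -Em; exact: (set_valP (cw_into (cw_char l1 s))).
by right=> t bt Bt; apply: H; exists t.
Qed.

(** Inside K the attaching maps of D are attaching maps of C, and injectivity of [cw_into] brings
    their tameness back to D. *)
Lemma subcomplex_gathered : gathered C -> gathered D.
Proof.
move=> gC n l; have [m Em] := sub l; have [eps [e0 [_ te]]] := gC n m.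
exists eps; split=> //; split; first exact: smooth_attach.
move=> j a t s ts st; apply: (@into_inj _ _ D); apply: val_inj.
have E u : val (cw_into (cw_attach l u)) = cw_into (cw_attach m u).
  by rewrite -[cw_into (cw_attach l u)]into_inc -[cw_into (cw_attach m u)]into_inc -!char_bd Em.
by rewrite !E (te j a t s).
Qed.

End Subcomplex.

(** * Lifting over a relative gathered complex *)

Section GlobalLift.
Variables (R : realType) (K : diffSpace R) (C : cwStructure K) (B : set K).
Hypotheses (gC : gathered C) (sB : saturated C B).
Variables (Z W : diffSpace R) (e : Z -> W).
Hypotheses (se : smooth e) (inh : W -> inhabited Z)
  (ce : forall n, cw_cell C n -> compressible n e).
Variables (f : K -> W) (a : subSpace B -> prodSpace Z (pathSpace W)).
Hypotheses (sf : smooth f) (sa : smooth a) (aP : forall b, path_lift e 4^-1 (a b))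
  (af : forall b, path_start (a b) = f (val b)).

(* Each cell attachment consumes some of the initial stationary time, hence a
   strictly decreasing sequence of thresholds. *)
Let d (n : nat) : R := (n%:R + 4)^-1.

Let dV_gt0 n : 0 < n%:R + 4 :> R. Proof. by rewrite ltr_wpDl. Qed.
Let d_gt0 n : 0 < d n. Proof. by rewrite invr_gt0. Qed.
Let d_lt n : d n.+1 < d n.
Proof. by rewrite ltf_pV2 ?posrE// ltrD2r ltr_nat. Qed.
Let d_le n : d n <= 4^-1.
Proof. by rewrite lef_pV2 ?posrE// lerDr. Qed.

Let good n (F : cw_skel C n -> prodSpace Z (pathSpace W)) :=
  [/\ smooth F, forall x, path_lift e (d n) (F x), forall x, path_start (F x) = f (cw_into x) &
    forall x (b : subSpace B), cw_into x = val b -> F x = a b].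

(** A cell inside B receives the prescribed value a. Any other cell meets B at most in its boundary,
    where F already agrees with a, and is lifted by [cell_lift]. *)
Let good_step n (F : cw_skel C n -> prodSpace Z (pathSpace W)) : good F ->
  exists F' : cw_skel C n.+1 -> prodSpace Z (pathSpace W),
    good F' /\ forall x, F' (cw_inc x) = F x.
Proof.
move=> [sF FP Ff Fa].
have cell (l : cw_cell C n) : exists G : cube R n -> prodSpace Z (pathSpace W),
    [/\ smooth G, forall t, path_lift e (d n.+1) (G t),
      forall t, path_start (G t) = f (cw_into (cw_char l t)),
      forall t, F (cw_attach l t) = G (val t) &
      forall t (b : subSpace B), cw_into (cw_char l t) = val b -> G t = a b].
  have [H|H] := sB l.
    pose c t : subSpace B := exist _ (cw_into (cw_char l t)) (mem_set (H t)).
    exists (fun t => a (c t)); split.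
    - apply: smooth_comp sa; apply: smooth_inT; apply: smooth_in_sub_intro.
      apply: (smooth_comp_on (@smooth_into _ _ C n.+1)).
      exact: smooth_smooth_in (@smooth_char _ _ C n l).
    - by move=> t; apply: path_lift_le (aP _); exact: d_le.
    - by move=> t; rewrite af.
    - by move=> t; apply: Fa; rewrite /= char_bd into_inc.
    - by move=> t b tb; congr a; exact: val_inj.
  have [eps [e0 [_ te]]] := gC l.
  have sFa : smooth (fun t => F (cw_attach l t)) by exact: smooth_comp (@smooth_attach _ _ _ _ l) sF.
  have tFa : tame (fun t => F (cw_attach l t)).
    by exists eps; split=> //; split=> // j b t s ts st; rewrite (te j b t s).
  have sfc : smooth (fun t => f (cw_into (cw_char l t))).
    apply: smooth_comp sf; apply: smooth_comp (@smooth_into _ _ _ _).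
    exact: smooth_char.
  have d1 : d n < 1 by apply: le_lt_trans (d_le n) _; lra.
  have Fs t : path_start (F (cw_attach l t)) = f (cw_into (cw_char l (val t))).
    by rewrite Ff char_bd into_inc.
  have [G [sG GP Gf GF]] := cell_lift se (ce l) inh (d_gt0 n.+1) (d_lt n) d1 tFa sfc
    (fun t => FP (cw_attach l t)) Fs.
  exists G; split=> // t b tb.
  have [bt|bt] := pselect (boundary R n t); last first.
    by case: (H t bt); rewrite tb; exact: (set_valP b).
  rewrite -[t]/(val (mkbd bt)) GF; apply: Fa.
  by rewrite -into_inc -char_bd.
have [G HG] := choice cell.
have [|||F' [sF' Fi Fc]] := @skel_map _ _ C n _ F G => //.
- by move=> l; have [] := HG l.
- by move=> l t; have [] := HG l.
exists F'; split=> //; split=> //.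
- move=> x; have [[y ->]|[l [t [_ ->]]]] := skel_cover x.
    by rewrite Fi; apply: path_lift_le (FP y); exact: ltW.
  by rewrite Fc; have [] := HG l.
- move=> x; have [[y ->]|[l [t [_ ->]]]] := skel_cover x; first by rewrite Fi into_inc.
  by rewrite Fc; have [] := HG l.
- move=> x b; have [[y ->]|[l [t [_ ->]]]] := skel_cover x.
    by rewrite Fi into_inc; exact: Fa.
  by rewrite Fc; have [_ _ _ _] := HG l; exact.
Qed.

Lemma global_lift : exists F : K -> prodSpace Z (pathSpace W),
  [/\ smooth F, forall x, path_lift e 0 (F x), forall x, path_start (F x) = f x &
    forall b, F (val b) = a b].
Proof.
have g0 : exists F : cw_skel C 0 -> prodSpace Z (pathSpace W), good F.
  have em (T : Type) (x : cw_skel C 0) : T by case: (cw_skel0 x).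
  exists (fun x => em _ x); split; try by move=> x; exact: em.
  by move=> n U p pU; apply: plot_local => [|u _]; [exact: plot_open pU|exact: em _ (p u)].
(* Lifts are chosen recursively together with their properties, so that each extends the previous
   one strictly, as the colimit requires. *)
pose next n (S : {F : cw_skel C n -> prodSpace Z (pathSpace W) | good F}) :=
  cid (good_step (svalP S)).
pose Fs := nat_rect (fun n => {F : cw_skel C n -> prodSpace Z (pathSpace W) | good F})
  (cid g0) (fun n S => exist _ (sval (next n S)) (svalP (next n S)).1).
have FsS n x : sval (Fs n.+1) (cw_inc x) = sval (Fs n) x.
  by rewrite /=; case: (next n (Fs n)) => F [].
have [_ _ _ H] := cw_colimit C.
have sFs n : smooth (sval (Fs n)) by have [] := svalP (Fs n).
have [F [[sF FE] _]] := H _ (fun n => sval (Fs n)) sFs FsS.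
exists F; split=> //.
- move=> x; have [n [y ->]] := colimit_cover C x; rewrite FE.
  by have [_ + _ _] := svalP (Fs n) => /(_ y); apply: path_lift_le; exact: ltW.
- move=> x; have [n [y ->]] := colimit_cover C x; rewrite FE.
  by have [_ _ + _] := svalP (Fs n); exact.
- move=> b; have [n [y yb]] := colimit_cover C (val b); rewrite yb FE.
  by have [_ _ _] := svalP (Fs n); exact.
Qed.

End GlobalLift.

(** * Homotopy equivalences of pairs *)

Section PairHomotopy.
Variables (R : realType) (X Y : diffSpace R) (A : set X) (B : set Y).
Local Notation line := (stdSpace R).

Lemma pair_homotopicP (f g : pairMap A B) :
  pair_homotopic f g <-> htpy_in (fun x y => A x -> B y) f g.
Proof.
split=> [[H [sH H0 H1 HA]]|[k [sk k0 k1 kA]]].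
  exists (fun p => H (p.1, stepI p.2)); split.
  - apply: smooth_inT; apply: (smooth_comp_on sH); apply: smooth_in_pair.
      exact: smooth_in_fst (@smooth_in_id _ _ _).
    by apply: (smooth_comp_on (@smooth_stepI R)); exact: smooth_in_snd (@smooth_in_id _ _ _).
  - by move=> t s s0; rewrite stepI_le0// H0.
  - by move=> t s s0; rewrite stepI_ge1// H1.
  - by move=> t s /= At; exact: HA.
exists (fun p => k (p.1, val p.2)); split.
- apply: smooth_inT; apply: (smooth_comp_on sk); apply: smooth_in_pair.
    exact: smooth_in_fst (@smooth_in_id _ _ _).
  by apply: smooth_in_val; exact: smooth_in_snd (@smooth_in_id _ _ _).
- by move=> x; exact: k0.
- by move=> x; exact: k1.
- by move=> x t Ax; exact: kA.
Qed.

End PairHomotopy.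

Section Whitehead.
Variable R : realType.
Local Notation line := (stdSpace R).

Lemma exists_right_inverse (X Y : diffSpace R) (A : set X) (B : set Y)
    (CY : cwStructure Y) (CB : cwStructure (subSpace B)) (phi : pairMap A B) :
  gathered CY -> is_subcomplex CY CB ->
  (forall n, cw_cell CY n -> compressible n phi) ->
  (forall n, cw_cell CB n -> compressible n (pair_restr phi)) ->
  (Y -> inhabited X) -> (subSpace B -> inhabited (subSpace A)) ->
  exists g : pairMap B A, pair_homotopic (pair_id B) (pair_comp phi g).
Proof.
move=> gY subB cY cB iX iA.
have sphi := pair_smooth phi; have srestr := pair_restr_smooth phi.
have emp (T : Type) (b : subSpace (set0 : set (subSpace B))) : T by case: (set_valP b).
have sat0 : saturated CB set0 by move=> n l; right=> t _ [].
have se0 : smooth (emp (prodSpace (subSpace A) (pathSpace (subSpace B)))).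
  by move=> n U p pU; apply: plot_local => [|u _]; [exact: plot_open pU|exact: emp _ (p u)].
(* The absolute case over B: a lift relative to the empty set. *)
have [FB [sFB FBP FBs _]] := global_lift (subcomplex_gathered subB gY) sat0 srestr iA cB
  (@smooth_id _ _) se0 (fun b => emp _ b) (fun b => emp _ b).
(* The lift over B has no pause left. The inner time [2 s - 1/2] is negative for s < 1/4 and exceeds
   1 for s > 3/4, which creates the initial pause 1/4 expected by [global_lift]. *)
pose k (p : prodSpace (subSpace B) line) : Y :=
  val (sval (FB p.1).2 (smoothstep (2 * (p.2 : R) - 2^-1))).
have sk : smooth k.
  apply: smooth_inT; apply: (@smooth_in_val _ _ _ _ B).
  apply: (smooth_in_eval (f := fun p : prodSpace (subSpace B) line => (FB p.1).2)
    (s := fun p => smoothstep (2 * (p.2 : R) - 2^-1))).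
    apply: (@smooth_in_snd _ _ (subSpace A) _ _ (fun p : prodSpace (subSpace B) line => FB p.1)).
    by apply: (smooth_comp_on sFB); exact: smooth_in_fst (@smooth_in_id _ _ _).
  apply: smooth_in_step; apply: smooth_inB; last exact: smooth_in_cst.
  apply: smooth_inM; first exact: smooth_in_cst.
  exact: smooth_in_snd (@smooth_in_id _ _ _).
have k0 b (s : R) : s <= 4^-1 -> k (b, s) = val b.
  move=> sd; rewrite /k /= smoothstep_le0; last lra.
  by rewrite -/(path_start (FB b)) FBs.
have k1 b (s : R) : 1 <= s -> k (b, s) = phi (val (FB b).1).
  move=> sd; rewrite /k /= smoothstep_ge1; last lra.
  by have [_ ->] := FBP b.
pose a (b : subSpace B) : prodSpace X (pathSpace Y) := (val (FB b).1, curry_path sk b).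
have sa : smooth a.
  apply: smooth_inT; apply: smooth_in_pair; last exact: smooth_smooth_in (smooth_curry sk).
  apply: smooth_in_val; apply: (@smooth_in_fst _ _ _ (pathSpace (subSpace B))).
  exact: smooth_smooth_in.
have as_ b : path_start (a b) = val b by rewrite /path_start /= k0//; lra.
have aP b : path_lift phi 4^-1 (a b).
  by split=> s sd; [rewrite as_ /= k0|rewrite /= k1].
have [F [sF FP Fs Fa]] := global_lift gY (subcomplex_saturated subB) sphi iX cY
  (@smooth_id _ _) sa aP as_.
have sg : smooth (fun y => (F y).1).
  by apply: smooth_inT; apply: (@smooth_in_fst _ _ _ (pathSpace Y)); exact: smooth_smooth_in.
have gA y : B y -> A (F y).1.
  move=> By; pose b : subSpace B := exist _ y (mem_set By).
  by rewrite -[y]/(val b) Fa; exact: (set_valP (FB b).1).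
exists (PairMap sg gA).
exists (fun p => sval (F p.1).2 (val p.2)); split.
- apply: smooth_inT.
  apply: (smooth_in_eval (f := fun p : prodSpace Y (I01 R) => (F p.1).2) (s := fun p => val p.2)).
    apply: (@smooth_in_snd _ _ X _ _ (fun p : prodSpace Y (I01 R) => F p.1)).
    by apply: (smooth_comp_on sF); exact: smooth_in_fst (@smooth_in_id _ _ _).
  by apply: smooth_in_val; exact: smooth_in_snd (@smooth_in_id _ _ _).
- by move=> y; rewrite /= -/(path_start (F y)) Fs.
- by move=> y /=; have [_ ->] := FP y.
- move=> y t By /=; pose b : subSpace B := exist _ y (mem_set By).
  by rewrite -[y]/(val b) Fa /=; exact: set_valP.
Qed.

(** A homotopy of pairs restricts to B, so the argument for Y applies to the restrictions as
    well. *)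
Lemma compressible_restr_right_inverse n (X Y : diffSpace R) (A : set X) (B : set Y)
    (phi : pairMap A B) (g : pairMap B A) :
  pair_homotopic (pair_id B) (pair_comp phi g) ->
  (compressible n.+1 phi -> compressible n g) /\
  (compressible n.+1 (pair_restr phi) -> compressible n (pair_restr g)).
Proof.
move=> /pair_homotopicP[K [sK K0 K1 KB]]; split.
  exact: compressible_right_inverse (pair_smooth phi) (pair_smooth g) sK K0 K1.
have KB' (p : prodSpace (subSpace B) line) : B (K (val p.1, p.2)).
  by apply: KB; exact: set_valP.
pose K' (p : prodSpace (subSpace B) line) : subSpace B :=
  exist _ (K (val p.1, p.2)) (mem_set (KB' p)).
apply: (@compressible_right_inverse _ _ _ _ _ _ K' (pair_restr_smooth phi) (pair_restr_smooth g)).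
- apply: smooth_inT; apply: smooth_in_sub_intro; apply: (smooth_comp_on sK); apply: smooth_in_pair.
    by apply: smooth_in_val; exact: smooth_in_fst (@smooth_in_id _ _ _).
  exact: smooth_in_snd (@smooth_in_id _ _ _).
- by move=> w s s0; apply: val_inj; exact: K0.
- by move=> w s s1; apply: val_inj; exact: K1.
Qed.

Lemma compressible_homotopy_equivalence (X Y : diffSpace R) (A : set X) (B : set Y)
    (CX : cwStructure X) (CA : cwStructure (subSpace A))
    (CY : cwStructure Y) (CB : cwStructure (subSpace B)) (phi : pairMap A B) :
  gathered CX -> is_subcomplex CX CA -> gathered CY -> is_subcomplex CY CB ->
  (forall n, cw_cell CY n -> compressible n phi) ->
  (forall n, cw_cell CB n -> compressible n (pair_restr phi)) ->
  (forall n, cw_cell CX n -> compressible n.+1 phi) ->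
  (forall n, cw_cell CA n -> compressible n.+1 (pair_restr phi)) ->
  (Y -> inhabited X) -> (subSpace B -> inhabited (subSpace A)) ->
  pair_homotopy_equivalence phi.
Proof.
move=> gX subA gY subB cY cB cX cA iX iA.
have [g hg] := exists_right_inverse gY subB cY cB iX iA.
have cgX n : cw_cell CX n -> compressible n g.
  by move=> l; apply: (compressible_restr_right_inverse n hg).1; exact: cX.
have cgA n : cw_cell CA n -> compressible n (pair_restr g).
  by move=> l; apply: (compressible_restr_right_inverse n hg).2; exact: cA.
have [psi hpsi] := exists_right_inverse gX subA cgX cgA
  (fun x => inhabits (phi x)) (fun a => inhabits (pair_restr phi a)).
move/pair_homotopicP: (hg) => cg; move/pair_homotopicP: hpsi => cpsi.
exists g; split; apply/pair_homotopicP; last exact: htpy_in_sym.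
(* With psi a right homotopy inverse of g, the chain is [g \o phi] ~ [g \o phi \o g \o psi] ~
   [g \o psi] ~ identity; [h1] is the first link and [h2] the second, reversed. *)
have gphiA x y : (A x -> A y) -> A x -> A (g (phi y)).
  by move=> xy /xy/(pair_sub phi)/(pair_sub g).
have h1 := htpy_in_comp (d := fun x y => A x -> A y)
  (smooth_comp (pair_smooth phi) (pair_smooth g)) gphiA cpsi.
have gB y z : (B y -> B z) -> B y -> A (g z) by move=> yz /yz/(pair_sub g).
have h3 := htpy_in_comp (d := fun y x => B y -> A x) (pair_smooth g) gB cg.
have psiA x z : (B (psi x) -> A z) -> A x -> A z by move=> H /(pair_sub psi)/H.
have h2 := htpy_in_precomp (d := fun x z => A x -> A z) (pair_smooth psi) psiA h3.
exact: (htpy_in_trans h1 (htpy_in_trans (htpy_in_sym h2) (htpy_in_sym cpsi))).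
Qed.

(** Surjectivity on path components excludes an empty source over a non-empty target; this provides
    the default point in [cell_lift]. *)
Lemma N_equivalence_inhabited N (X Y : diffSpace R) (f : X -> Y) (sf : smooth f) :
  N_equivalence N sf -> Y -> inhabited X.
Proof.
move=> [_ surj _ _] y; have [c _] := surj (to_quot (@path_joined R Y) y).
by have [x _] := quot_ex c; exists.
Qed.

End Whitehead.

Theorem theorem6p7 (R : realType) (X Y : diffSpace R) (A : set X) (B : set Y)
    (CX : cwStructure X) (CA : cwStructure (subSpace A))
    (CY : cwStructure Y) (CB : cwStructure (subSpace B))
    (gX : gathered CX) (subA : is_subcomplex CX CA)
    (gY : gathered CY) (subB : is_subcomplex CY CB) :
  (forall N : nat,
      cw_dim_lt CX N -> cw_dim_lt CA N -> cw_dim_lt CY N -> cw_dim_lt CB N ->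
      forall phi : pairMap A B,
        pair_N_equivalence N phi -> pair_homotopy_equivalence phi) /\
  (forall phi : pairMap A B,
      pair_weak_equivalence phi -> pair_homotopy_equivalence phi).
Proof.
split=> [N dX dA dY dB phi [e eA]|phi w].
  apply: (compressible_homotopy_equivalence gX subA gY subB).
  - by move=> n l; apply: (N_equivalence_compressible e); exact: ltnW (dim_cell l dY).
  - by move=> n l; apply: (N_equivalence_compressible eA); exact: ltnW (dim_cell l dB).
  (* Over X one dimension more is demanded; a cell of dimension n < N satisfies [n.+1 <= N], so the
     strict bound pays for it. *)
  - by move=> n l; apply: (N_equivalence_compressible e); exact: dim_cell l dX.
  - by move=> n l; apply: (N_equivalence_compressible eA); exact: dim_cell l dA.
  - exact: N_equivalence_inhabited e.
  - exact: N_equivalence_inhabited eA.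
apply: (compressible_homotopy_equivalence gX subA gY subB).
- by move=> n l; apply: (N_equivalence_compressible (w n).1).
- by move=> n l; apply: (N_equivalence_compressible (w n).2).
- by move=> n l; apply: (N_equivalence_compressible (w n.+1).1).
- by move=> n l; apply: (N_equivalence_compressible (w n.+1).2).
- exact: N_equivalence_inhabited (w 0%N).1.
- exact: N_equivalence_inhabited (w 0%N).2.
Qed.
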